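(* Let $q^*_{sym}$ be the optimal symmetric quality function, i.e. $q=q^*_{sym}(\theta)$ is the solution of $V'(q)=\tilde C^P_q(q,\theta)+\tilde C^I_q(q,\theta)/(1-F(\theta))^{n-1}$ (with $q^*_{sym}(1)=0$), and let $\theta(q)$ be the inverse of $q^*_{sym}(\theta)$. Let $s^*$ satisfy $$s^{*\prime}(q)=C^P_q(q,\theta(q))+\frac{C^I_q(q,\theta(q))}{(1-F(\theta(q)))^{n-1}}.$$ Then the first-score auction with score $S(q,p)=s^*(q)-p$ solves problem (P) with the restriction to symmetric mechanisms, i.e. the bound $\overline U_{sym}$ on the buyer's expected utility is attained, and thus the first-score auction is an optimal symmetric mechanism.
   Context: Setting. A buyer procures one contract from $n\ge 2$ firms. Firm $i$ has a private type $\theta_i\in[0,1]$; types are independent with cdf $F$ and strictly positive density $f$. $V(q)$ is the buyer's value of quality $q\ge0$; $C^P(q,\theta)$ and $C^I(q,\theta)$ are production (winner-pay) and investment (all-pay) costs; all derivatives used are assumed to exist. Firm $i$'s payoff is $\Pi_i=t_i-C^P(q_i,\theta_i)z_i-C^I(q_i,\theta_i)$ ($z_i$ its share of the contract, $t_i$ the transfer to it); the buyer's payoff is $U=\sum_i(V(q_i)z_i-t_i)$. Virtual costs: $\tilde C^P=C^P+C^P_\theta F/f$, $\tilde C^I=C^I+C^I_\theta F/f$ (subscripts denote partial derivatives). Standing assumptions. $C^P_q>0$, $C^P_\theta>0$, $C^P_{q\theta}>0$; $C^I_q>0$, $C^I_\theta>0$, $C^I_{q\theta}>0$ for $q>0$;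 $C^I(0,\theta)=0$, $C^I_q(0,\theta)=0$; $V'\ge0$, $V''\le0$; $\tilde C^P_\theta>0$, $\tilde C^P_{qq}>0$, $\tilde C^P_{q\theta}\ge0$; $\tilde C^I_\theta>0$ for $q>0$, $\tilde C^I_{qq}>0$, $\tilde C^I_{q\theta}\ge0$. For every $\theta$: $V'(q)>\tilde C^P_q(q,\theta)$ at $q=0$, and $V'(q)<\tilde C^P_q(q,\theta)+\tilde C^I_q(q,\theta)$ at $q=\infty$ (i.e. for all large $q$). Mechanisms and problem (P). A mechanism $\mathcal M$ consists of message sets $M_i$ and functions $z_i(\mathbf m,\mathbf q)$, $t_i(\mathbf m,\mathbf q)$, $i=1,\dots,n$. After $\mathcal M$ is announced, each firm learns its type, then chooses quality $q_i\ge0$, then a message $m_i\in M_i$; a strategy is $\sigma_i(\theta_i)=(m_i(\theta_i),q_i(\theta_i))$. Problem (P): maximize the buyer's expected utility over pairs $(\mathcal M,\bm\sigma)$ such that $\bm\sigma$ is a Bayes–Nash equilibrium of $\mathcal M$ (for every firm $i$ and every type $\theta_i$ in the support, $\sigma_i(\theta_i)$ maximizes interim expected payoff over all $(m_i',q_i'')\in M_i\times\mathbb R_+$), interim expected equilibrium payoffs are $\ge0$ for every type, and $z_i(\bm\sigma(\bm\theta))\ge0$, $\sum_i z_i(\bm\sigma(\bm\theta))=1$. Symmetric mechanisms are those whose induced quality functions $q_i(\theta_i)$ and allocation functions $z_i(\bm\theta)$ are invariant under permutations of the firms' indices. Relaxed problem (P2): maximize $\mathbb E\sum_{i=1}^n\big(V(q_i(\theta_i))z_i(\bm\theta)-\tilde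 C^P(q_i(\theta_i),\theta_i)z_i(\bm\theta)-\tilde C^I(q_i(\theta_i),\theta_i)\big)$ over $q_i(\theta_i)\ge0$ and $z_i(\bm\theta)\ge0$ with $\sum_iz_i(\bm\theta)=1$. $\overline U_{sym}$ denotes the value of (P2) under the symmetry constraint; it is an upper bound on the buyer's utility in (P) restricted to symmetric mechanisms. First-score auction with score $s(q)-p$: $M_i=\mathbb R_+$, the message being the price offered. With $W(\mathbf m,\mathbf q)=\{i: s(q_i)-m_i=\max_j(s(q_j)-m_j)\}$, $z_i=\mathbb I(i\in W)/|W|$ and $t_i=m_iz_i$.
   Formalization: For q above q*_sym(0), where θ(q) is undefined, s* is assumed to rise by no more than C^P(q,0)+C^I(q,0) does (equality if θ(q)=0 there); and the production cost C^P is assumed nonnegative, as prices lie in R_+. *)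

(* Defs.v *)
From HB Require Import structures.
From mathcomp Require Import all_boot all_order all_algebra perm.
From mathcomp Require Import interval_inference.
From mathcomp Require Import all_classical all_reals all_analysis.

Set Implicit Arguments.
Unset Strict Implicit.
Unset Printing Implicit Defensive.

Import Order.TTheory GRing.Theory Num.Theory.
Import numFieldNormedType.Exports.

Local Open Scope classical_set_scope.
Local Open Scope ring_scope.

Section calculus.
Context {R : realType}.
Implicit Types (D : set R) (g : R -> R) (C : R -> R -> R).

(* Derivatives relative to a domain: two-sided at interior points of D,
   one-sided at its end points. Values outside D play no role. *)
Definition diff_quot g (x y : R) : R := (g y - g x) / (y - x).
Definition derivable_in D g (x : R) : Prop := cvg (diff_quot g x @ within D x^').
Definition derive_in D g (x : R) : R := lim (diff_quot g x @ within D x^').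

Definition quality : set R := `[0, +oo[.
Definition type01 : set R := `[0, 1].

(* Functions C(q, theta): q is the first argument, theta the second. *)
Definition derivable_q C : Prop :=
  forall q t, quality q -> type01 t -> derivable_in quality (C ^~ t) q.
Definition derivable_t C : Prop :=
  forall q t, quality q -> type01 t -> derivable_in type01 (C q) t.
Definition Dq C (q t : R) : R := derive_in quality (C ^~ t) q.
Definition Dt C (q t : R) : R := derive_in type01 (C q) t.

Definition virtual (F f : R -> R) C (q t : R) : R :=
  C q t + Dt C q t * F t / f t.

End calculus.

Section types.
Context {R : realType}.

Definition type_cdf (P : probability R R) (t : R) : R := fine (P `]-oo, t]%classic).

Definition has_density01 (P : probability R R) (f : R -> R) : Prop :=
  [/\ measurable_fun type01 f,
      (forall t, type01 t -> 0 < f t) &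
      (forall A : set R, measurable A ->
         P A = \int[lebesgue_measure]_(x in A `&` type01) (f x)%:E)%E].

(* Pn is the law of the profile of n independent types with common law P. *)
Definition iid_profile (n : nat) (P : probability R R)
    (Pn : probability (n.-tuple R) R) : Prop :=
  forall A : 'I_n -> set R, (forall i, measurable (A i)) ->
    Pn [set th | forall i, A i (tnth th i)] = (\prod_i fine (P (A i)))%:E.

Definition cube (n : nat) : set (n.-tuple R) :=
  [set th | forall i, type01 (tnth th i)].

End types.
Arguments cube {R} n.

Section assumptions.
Context {R : realType}.
Variables (V f F : R -> R) (CP CI : R -> R -> R).

(* All derivatives occurring in the model, including f' and C_{theta theta},
   which enter the theta-derivative of the virtual cost. *)
Record smooth_cost (C : R -> R -> R) : Prop := SmoothCost {
  smooth_q : derivable_q C;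
  smooth_t : derivable_t C;
  smooth_qt : derivable_t (Dq C);
  smooth_tq : derivable_q (Dt C);
  smooth_tt : derivable_t (Dt C);
  smooth_vq : derivable_q (virtual F f C);
  smooth_vt : derivable_t (virtual F f C);
  smooth_vqq : derivable_q (Dq (virtual F f C));
  smooth_vqt : derivable_t (Dq (virtual F f C)) }.

Let V' := derive_in quality V.
Let V'' := derive_in quality V'.
Let vCP := virtual F f CP.
Let vCI := virtual F f CI.

Record standing_assumptions : Prop := StandingAssumptions {
  V_derivable : forall q, quality q -> derivable_in quality V q;
  V'_derivable : forall q, quality q -> derivable_in quality V' q;
  f_derivable : forall t, type01 t -> derivable_in type01 f t;
  CP_smooth : smooth_cost CP;
  CI_smooth : smooth_cost CI;
  CP_ge0 : forall q t, quality q -> type01 t -> 0 <= CP q t;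
  CP_q : forall q t, quality q -> type01 t -> 0 < Dq CP q t;
  CP_t : forall q t, quality q -> type01 t -> 0 < Dt CP q t;
  CP_qt : forall q t, quality q -> type01 t -> 0 < Dt (Dq CP) q t;
  CI_q : forall (q t : R), 0 < q -> type01 t -> 0 < Dq CI q t;
  CI_t : forall (q t : R), 0 < q -> type01 t -> 0 < Dt CI q t;
  CI_qt : forall (q t : R), 0 < q -> type01 t -> 0 < Dt (Dq CI) q t;
  CI_0 : forall t, type01 t -> CI 0 t = 0;
  CI_q0 : forall t, type01 t -> Dq CI 0 t = 0;
  V'_ge0 : forall q, quality q -> 0 <= V' q;
  V''_le0 : forall q, quality q -> V'' q <= 0;
  vCP_t : forall q t, quality q -> type01 t -> 0 < Dt vCP q t;
  vCP_qq : forall q t, quality q -> type01 t -> 0 < Dq (Dq vCP) q t;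
  vCP_qt : forall q t, quality q -> type01 t -> 0 <= Dt (Dq vCP) q t;
  vCI_t : forall (q t : R), 0 < q -> type01 t -> 0 < Dt vCI q t;
  vCI_qq : forall q t, quality q -> type01 t -> 0 < Dq (Dq vCI) q t;
  vCI_qt : forall q t, quality q -> type01 t -> 0 <= Dt (Dq vCI) q t;
  interior_lo : forall t, type01 t -> Dq vCP 0 t < V' 0;
  interior_hi : forall t, type01 t ->
    exists Q : R, forall q, 0 <= q -> Q <= q -> V' q < Dq vCP q t + Dq vCI q t }.

Definition optimal_symmetric_quality (n : nat) (qs : R -> R) : Prop :=
  (forall t : R, 0 <= t < 1 ->
     0 <= qs t /\
     V' (qs t) = Dq vCP (qs t) t + Dq vCI (qs t) t / (1 - F t) ^+ n.-1)
  /\ qs 1 = 0.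

(* tinv is the inverse theta(q) of qs; the range of qs is [0, qs 0]. At q = 0
   the differential equation reads 0/0, and s is only continuous there. The
   equation says nothing about s above qs 0, where some bound is needed to make
   such qualities unattractive; the one used holds with equality when the
   equation is continued with theta(q) = 0, and also when s is constant there. *)
Definition optimal_score (n : nat) (qs tinv s : R -> R) : Prop :=
  [/\ {within `[0, qs 0], continuous s},
      (forall q : R, 0 < q <= qs 0 ->
         derivable_in `[0, qs 0] s q /\
         derive_in `[0, qs 0] s q =
           Dq CP q (tinv q) + Dq CI q (tinv q) / (1 - F (tinv q)) ^+ n.-1) &
      (forall q : R, qs 0 < q ->
         s q - s (qs 0) <= (CP q 0 + CI q 0) - (CP (qs 0) 0 + CI (qs 0) 0))].

End assumptions.

Section mechanisms.
Context {R : realType}.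
Variable n : nat.

Record mechanism := Mechanism {
  msg : 'I_n -> Type;
  alloc : (forall j, msg j) -> ('I_n -> R) -> 'I_n -> R;
  transfer : (forall j, msg j) -> ('I_n -> R) -> 'I_n -> R }.

Definition strategy (M : mechanism) := forall i : 'I_n, R -> msg M i * R.

Section outcome.
Variables (M : mechanism) (sg : strategy M).

Definition messages (th : n.-tuple R) (j : 'I_n) : msg M j :=
  (sg j (tnth th j)).1.
Definition qualities (th : n.-tuple R) (j : 'I_n) : R := (sg j (tnth th j)).2.

Definition induced_quality (i : 'I_n) (t : R) : R := (sg i t).2.
Definition induced_alloc (i : 'I_n) (th : n.-tuple R) : R :=
  alloc (messages th) (qualities th) i.
Definition induced_transfer (i : 'I_n) (th : n.-tuple R) : R :=
  transfer (messages th) (qualities th) i.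

(* Outcomes for i when i plays (m, q) and the others play sg. They do not
   depend on the i-th component of th. *)
Definition dev_alloc (i : 'I_n) (m : msg M i) (q : R) (th : n.-tuple R) : R :=
  alloc (dfwith (messages th) i m) (dfwith (qualities th) i q) i.
Definition dev_transfer (i : 'I_n) (m : msg M i) (q : R) (th : n.-tuple R) : R :=
  transfer (dfwith (messages th) i m) (dfwith (qualities th) i q) i.

End outcome.

Section feasibility.
Variables (CP CI : R -> R -> R) (Pn : probability (n.-tuple R) R).
Variables (M : mechanism) (sg : strategy M).

(* Types are independent and a deviation outcome ignores the i-th component of
   th, so integrating over th is integrating over the other firms' types. *)
Definition interim_payoff (i : 'I_n) (t : R) (m : msg M i) (q : R) : R :=
  (\int[Pn]_(th in cube n)
     (dev_transfer sg m q th - CP q t * dev_alloc sg m q th - CI q t))%R.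

Definition equilibrium_payoff (i : 'I_n) (t : R) : R :=
  interim_payoff t (sg i t).1 (sg i t).2.

(* The expectations defining the players' payoffs exist. *)
Record well_defined : Prop := WellDefined {
  wd_quality : forall i, measurable_fun type01 (induced_quality sg i);
  wd_alloc : forall i, measurable_fun (cube n) (induced_alloc sg i);
  wd_transfer : forall i,
    Pn.-integrable (cube n) (EFin \o induced_transfer sg i);
  wd_dev_alloc : forall i (m : msg M i) q, 0 <= q ->
    Pn.-integrable (cube n) (EFin \o dev_alloc sg m q);
  wd_dev_transfer : forall i (m : msg M i) q, 0 <= q ->
    Pn.-integrable (cube n) (EFin \o dev_transfer sg m q) }.

Definition bayes_nash : Prop :=
  forall i t, type01 t -> forall (m : msg M i) q, 0 <= q ->
    interim_payoff t m q <= equilibrium_payoff i t.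

Definition individually_rational : Prop :=
  forall i t, type01 t -> 0 <= equilibrium_payoff i t.

End feasibility.

Definition allocation_rule (z : 'I_n -> n.-tuple R -> R) : Prop :=
  forall th, cube n th -> (forall i, 0 <= z i th) /\ \sum_i z i th = 1.

Definition quality_rule (q : 'I_n -> R -> R) : Prop :=
  forall i t, type01 t -> 0 <= q i t.

Definition feasible (CP CI : R -> R -> R) (Pn : probability (n.-tuple R) R)
    (M : mechanism) (sg : strategy M) : Prop :=
  [/\ well_defined Pn sg,
      quality_rule (induced_quality sg),
      allocation_rule (induced_alloc sg),
      bayes_nash CP CI Pn sg &
      individually_rational CP CI Pn sg].

Definition symmetric_rules (q : 'I_n -> R -> R) (z : 'I_n -> n.-tuple R -> R) :
    Prop :=
  (forall i j t, type01 t -> q i t = q j t) /\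
  (forall (p : 'S_n) i th, cube n th ->
     z (p i) th = z i [tuple tnth th (p j) | j < n]).

Definition symmetric_mechanism (M : mechanism) (sg : strategy M) : Prop :=
  symmetric_rules (induced_quality sg) (induced_alloc sg).

Definition buyer_utility (V : R -> R) (Pn : probability (n.-tuple R) R)
    (M : mechanism) (sg : strategy M) : \bar R :=
  (\int[Pn]_(th in cube n)
     (\sum_(i < n) (V (qualities sg th i) * induced_alloc sg i th
                    - induced_transfer sg i th))%R%:E)%E.

Definition relaxed_objective (V f F : R -> R) (CP CI : R -> R -> R)
    (Pn : probability (n.-tuple R) R)
    (q : 'I_n -> R -> R) (z : 'I_n -> n.-tuple R -> R) : \bar R :=
  (\int[Pn]_(th in cube n)
     (\sum_(i < n) (V (q i (tnth th i)) * z i th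
        - virtual F f CP (q i (tnth th i)) (tnth th i) * z i th
        - virtual F f CI (q i (tnth th i)) (tnth th i)))%R%:E)%E.

Definition relaxed_symmetric_value (V f F : R -> R) (CP CI : R -> R -> R)
    (Pn : probability (n.-tuple R) R) : \bar R :=
  ereal_sup [set u | exists (q : 'I_n -> R -> R) (z : 'I_n -> n.-tuple R -> R),
    [/\ (forall i, measurable_fun type01 (q i)),
        (forall i, measurable_fun (cube n) (z i)),
        quality_rule q /\ allocation_rule z,
        symmetric_rules q z &
        u = relaxed_objective V f F CP CI Pn q z]].

Section first_score.
Variable s : R -> R.

Definition score (m : 'I_n -> {nonneg R}) (q : 'I_n -> R) (i : 'I_n) : R :=
  s (q i) - (m i)%:num.

Definition winners (m : 'I_n -> {nonneg R}) (q : 'I_n -> R) : {set 'I_n} :=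
  [set i | [forall j, score m q j <= score m q i]]%SET.

Definition first_score_alloc (m : 'I_n -> {nonneg R}) (q : 'I_n -> R)
    (i : 'I_n) : R := (i \in winners m q)%:R / #|winners m q|%:R.

Definition first_score_auction : mechanism :=
  @Mechanism (fun=> {nonneg R}) first_score_alloc
    (fun m q i => (m i)%:num * first_score_alloc m q i).

End first_score.

End mechanisms.

(* Main.v *)
(* Lower bound on payments. By incentive compatibility the payoff of a firm
   decreases in its type at the rate C^P_theta z + C^I_theta, so that expected
   transfers are at least the expected virtual costs: the buyer gets at most the
   objective of (P2), and exactly that if type 1 earns nothing.

   Upper bound on (P2). Let A and B be a winner-pay and an all-pay cost, sigma a
   score, K(t) = sigma(q*(t)) - A(q*(t),t), and H(k) = E (k - M)^+, where M is the
   best of the n-1 rival values K. As H'(K(t)) = (1-F(t))^(n-1), a function q* with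
   sigma' = A_q + B_q / (1-F)^(n-1) maximizes H(sigma(q) - A(q,t)) - B(q,t) over q.
   For (sigma, A, B) = (V, virtual C^P, virtual C^I) and any other common quality
   function with scores W_i = V(q(t_i)) - A(q(t_i),t_i),
     E max_i W_i - sum_i E (W_i - M_i)^+
   is largest when W = K: with distribution functions b of W and a of K, its layer
   at a given level is 1 - b^n - n a^(n-1) (1 - b), which is maximal at b = a.
   Adding the optimality of q* for H bounds (P2) by its value at q* and the
   allocation to the lowest type.

   Equilibrium. The same optimality with (sigma, A, B) = (s, C^P, C^I) shows that
   the first-score auction has an equilibrium with qualities q*: bidding the score
   E(M | M <= K(t)) yields H(K(t)) - C^I(q*(t),t), and a deviation to quality q
   and any price yields at most H(s(q) - C^P(q,t)) - C^I(q,t). *)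

Require Import Defs.
From HB Require Import structures.
From mathcomp Require Import all_boot all_order all_algebra perm.
From mathcomp Require Import interval_inference ring lra.
From mathcomp Require Import all_classical all_reals all_analysis measurable_realfun.

Set Implicit Arguments.
Unset Strict Implicit.
Unset Printing Implicit Defensive.

Import Order.TTheory GRing.Theory Num.Theory.
Import numFieldNormedType.Exports.
Local Open Scope classical_set_scope.
Local Open Scope ring_scope.

(** * Relative derivatives and monotonicity *)

(** The score is differentiable only away from quality 0 and the gain [H] is merely convex, so no
    payoff is recovered by integrating its derivative. Global optimality comes from one-sided growth
    estimates: a subgradient of [H] is a winning probability, and comparing it with [(1-F)^(n-1)] at
    the type whose optimal quality is the current one signs the growth of the payoff. The two halves
    of the envelope formula need different tools. The lower bound must hold for every mechanism and
    follows from Fatou's lemma; equality is needed only where qualities are bounded, and there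
    convergence is dominated. In (P2) the investment cost of a competing quality function may have
    infinite expectation, so surpluses cannot be split into integrable terms. They are measured
    downwards from a constant, which makes them nonnegative. Competing scores may be unbounded too,
    and are first clamped to the range of [K]. The layer inequality is then arranged without
    subtractions, so that Tonelli applies; at each level it says that the [n]-th power lies above
    its tangent. *)

Section slopes.
Context {R : realType}.
Implicit Types (D : set R) (g : R -> R).

(* The value [d] of the derivative of [g] at [x] relative to [D]; unlike
   [derive_in] this composes without uniqueness of limits. *)
Definition slope_at D g (x d : R) : Prop :=
  forall e : R, 0 < e -> exists2 del : R, 0 < del &
    forall y, D y -> `|y - x| < del -> `|g y - g x - d * (y - x)| <= e * `|y - x|.

Definition cont_at D g (x : R) : Prop :=
  forall e : R, 0 < e -> exists2 del : R, 0 < del &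
    forall y, D y -> `|y - x| < del -> `|g y - g x| <= e.

Lemma derivable_in_slope D g x :
  derivable_in D g x -> slope_at D g x (derive_in D g x).
Proof.
move=> dg e e0; rewrite /derivable_in in dg.
have /cvgrPdist_le /(_ e e0) := dg.
rewrite near_withinE near_withinE => /nbhs_ballP [del /= del0 hdel].
exists del => // y Dy yx.
have [->|nyx] := eqVneq y x; first by rewrite !subrr mulr0 subrr normr0 mulr0.
have := hdel y; rewrite /ball /= distrC => /(_ yx nyx Dy).
rewrite -/(derive_in D g x) => h.
have d0 : 0 < `|y - x| by rewrite normr_gt0 subr_eq0.
rewrite -ler_pdivrMr// -normf_div.
have -> : (g y - g x - derive_in D g x * (y - x)) / (y - x)
          = diff_quot g x y - derive_in D g x.
  by rewrite mulrBl mulfK// subr_eq0.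
by rewrite distrC.
Qed.

Lemma slope_cont D g x d : slope_at D g x d -> cont_at D g x.
Proof.
move=> sg e e0; have [del del0 hdel] := sg 1 ltr01.
have d1 : 0 < `|d| + 1 by rewrite ltr_wpDl.
exists (Num.min del (e / (`|d| + 1))); first by rewrite lt_min del0 divr_gt0.
move=> y Dy; rewrite lt_min => /andP[/(hdel y Dy) h].
rewrite ltr_pdivlMr// => ye.
have -> : g y - g x = (g y - g x - d * (y - x)) + d * (y - x) by rewrite subrK.
apply: (le_trans (ler_normD _ _)).
rewrite normrM; apply: le_trans (ltW ye).
have -> : `|y - x| * (`|d| + 1) = 1 * `|y - x| + `|d| * `|y - x| by ring.
by rewrite lerD2r.
Qed.

Lemma slopeD D g h x d d' : slope_at D g x d -> slope_at D h x d' ->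
  slope_at D (fun t => g t + h t) x (d + d').
Proof.
move=> sg sh e e0; have e2 : 0 < e / 2 by rewrite divr_gt0.
have [a a0 ha] := sg _ e2; have [b b0 hb] := sh _ e2.
exists (Num.min a b); first by rewrite lt_min a0.
move=> y Dy; rewrite lt_min => /andP[/(ha y Dy) h1 /(hb y Dy) h2].
have -> : g y + h y - (g x + h x) - (d + d') * (y - x) =
  (g y - g x - d * (y - x)) + (h y - h x - d' * (y - x)) by ring.
by apply: (le_trans (ler_normD _ _)); rewrite [e]splitr mulrDl lerD.
Qed.

Lemma slopeZ D g x d c : slope_at D g x d ->
  slope_at D (fun t => c * g t) x (c * d).
Proof.
move=> sg e e0; have c1 : 0 < `|c| + 1 by rewrite ltr_wpDl.
have [a a0 ha] := sg _ (divr_gt0 e0 c1).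
exists a => // y Dy /(ha y Dy) h.
have -> : c * g y - c * g x - c * d * (y - x) = c * (g y - g x - d * (y - x)).
  by ring.
rewrite normrM; apply: (le_trans (ler_wpM2l (normr_ge0 _) h)).
rewrite mulrA ler_wpM2r// mulrA ler_pdivrMr// mulrC ler_pM2l//.
by rewrite lerDl.
Qed.

Lemma slopeB D g h x d d' : slope_at D g x d -> slope_at D h x d' ->
  slope_at D (fun t => g t - h t) x (d - d').
Proof.
move=> sg sh; have := slopeD sg (slopeZ (-1) sh).
by under eq_fun do rewrite mulN1r; rewrite mulN1r.
Qed.

Lemma slopeS D D' g x d : D' `<=` D -> slope_at D g x d -> slope_at D' g x d.
Proof.
move=> DD sg e /sg[a a0 ha]; exists a => // y /DD; exact: ha.
Qed.

Lemma contS D D' g x : D' `<=` D -> cont_at D g x -> cont_at D' g x.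
Proof.
move=> DD sg e /sg[a a0 ha]; exists a => // y /DD; exact: ha.
Qed.

Lemma contD D g h x : cont_at D g x -> cont_at D h x ->
  cont_at D (fun t => g t + h t) x.
Proof.
move=> sg sh e e0; have e2 : 0 < e / 2 by rewrite divr_gt0.
have [a a0 ha] := sg _ e2; have [b b0 hb] := sh _ e2.
exists (Num.min a b); first by rewrite lt_min a0.
move=> y Dy; rewrite lt_min => /andP[/(ha y Dy) h1 /(hb y Dy) h2].
have -> : g y + h y - (g x + h x) = (g y - g x) + (h y - h x) by ring.
by apply: (le_trans (ler_normD _ _)); rewrite [e]splitr lerD.
Qed.

Lemma contN D g x : cont_at D g x -> cont_at D (fun t => - g t) x.
Proof.
move=> sg e /sg[a a0 ha]; exists a => // y Dy /(ha y Dy).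
by rewrite -opprD normrN.
Qed.

(* No derivative is involved: [x] ranges over the open interval only, so that
   end points where the slope is infinite or unknown are harmless. *)
Lemma nonincr_local_left g a b : a <= b ->
  (forall x, a <= x <= b -> cont_at `[a, b] g x) ->
  (forall x, a < x < b -> forall e : R, 0 < e -> exists2 del : R, 0 < del &
     forall y, a <= y < x -> x - y < del -> g x - g y <= e * (x - y)) ->
  g b <= g a.
Proof.
rewrite le_eqVlt => /predU1P[->//|ab] cg lg.
suff key (e : R) : 0 < e -> g b - g a <= e * (b - a + 1).
  rewrite -subr_le0; apply/ler_addgt0Pl => e e0; rewrite addr0.
  have ba : 0 < b - a + 1 by rewrite ltr_wpDl// subr_ge0 ltW.
  by have := key _ (divr_gt0 e0 ba); rewrite divfK// gt_eqF.
move=> e0.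
(* Induction on the continuum, downwards from [b]: the infimum [c] of [E] lies in [E] by continuity,
   and a left neighbour of an interior [c] would still lie in [E]. The extra [+ e] pays for leaving
   [b], where only continuity is known. *)
pose E := [set x | a <= x <= b /\ g b - g x <= e * (b - x) + e].
have Eb : E b by split; rewrite ?lexx ?(ltW ab)// !subrr mulr0 add0r ltW.
have lbE : lbound E a by move=> x [/andP[]].
have infE : has_inf E by split; [exists b|exists a].
have lE : has_lbound E by exists a.
pose c := inf E.
have ac : a <= c by apply: lb_le_inf => //; exists b.
have cb : c <= b by exact: (ge_inf lE Eb).
have Ec : E c.
  split; first by rewrite ac.
  apply/ler_addgt0Pl => d d0.
  have [del del0 hdel] := cg c (introT andP (conj ac cb)) _ (divr_gt0 d0 (ltr0Sn R 1)).
  have ee : 0 < e + 1 by rewrite ltr_wpDl// ltW.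
  pose r := Num.min del (d / 2).
  have r0 : 0 < r by rewrite lt_min del0 divr_gt0.
  have [x [Ex1 Ex2] xc] := inf_adherent r0 infE; rewrite -/c in xc.
  have cx : c <= x by exact: (ge_inf lE (conj Ex1 Ex2)).
  have xr : `|x - c| < r by rewrite ger0_norm ?subr_ge0// ltrBlDl.
  have /ler_normlP[_ gx] : `|g x - g c| <= d / 2.
    by apply: hdel; [rewrite /= in_itv/=|apply: lt_le_trans xr _; rewrite ge_min lexx].
  have : e * (b - x) <= e * (b - c) by rewrite ler_pM2l// lerD2l lerN2.
  lra.
have [cb'|cb'] := eqVneq c b.
  have [del del0 hdel] := cg b (introT andP (conj (ltW ab) (lexx b))) _ e0.
  pose x := Num.max a (b - del / 2).
  have xb : x < b by rewrite gt_max ab ltrBlDr ltrDl divr_gt0.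
  have Ex : E x.
    split; first by rewrite le_max lexx (ltW xb).
    have /ler_normlP[h _] : `|g x - g b| <= e.
      apply: hdel; first by rewrite /= in_itv/= le_max lexx (ltW xb).
      rewrite distrC ger0_norm ?subr_ge0 ?(ltW xb)//.
      have : b - del / 2 <= x by rewrite le_max lexx orbT.
      by move: del0; lra.
    have : 0 <= e * (b - x) by rewrite mulr_ge0 ?subr_ge0 ?ltW//.
    lra.
  have : c <= x by exact: (ge_inf lE Ex).
  by rewrite cb' leNgt xb.
have {cb'}cb' : c < b by rewrite lt_neqAle cb' cb.
move: ac; rewrite le_eqVlt => /predU1P[aE|ac].
  by case: Ec => _; rewrite -aE (_ : e * (b - a + 1) = e * (b - a) + e)//; ring.
have [del del0 hdel] := lg c (introT andP (conj ac cb')) e e0.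
pose x := Num.max a (c - del / 2).
have xc : x < c by rewrite gt_max ac ltrBlDr ltrDl divr_gt0.
have ax : a <= x by rewrite le_max lexx.
have xd : c - x < del.
  have : c - del / 2 <= x by rewrite le_max lexx orbT.
  by move: del0; lra.
have hx := hdel x (introT andP (conj ax xc)) xd.
have : c <= x.
  apply: (ge_inf lE); split; first by rewrite ax (ltW (lt_le_trans xc cb)).
  case: Ec => _ Ec2.
  have -> : e * (b - x) = e * (b - c) + e * (c - x) by ring.
  lra.
by rewrite leNgt xc.
Qed.

Lemma nondecr_local_right g a b : a <= b ->
  (forall x, a <= x <= b -> cont_at `[a, b] g x) ->
  (forall x, a < x < b -> forall e : R, 0 < e -> exists2 del : R, 0 < del &
     forall y, x < y <= b -> y - x < del -> g x - g y <= e * (y - x)) ->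
  g a <= g b.
Proof.
move=> ab cg lg.
have := @nonincr_local_left (fun x => g (- x)) (- b) (- a).
rewrite !opprK; apply.
- by rewrite lerN2.
- move=> x /andP[h1 h2] e /(cg (- x)) [|d d0 hd]; first by rewrite lerNr h2 lerNl h1.
  exists d => // y; rewrite /= in_itv/= => /andP[y1 y2] yx; apply: hd.
    by rewrite /= in_itv/= lerNr y2 lerNl y1.
  by rewrite -opprD normrN.
- move=> x /andP[h1 h2] e e0; have [|d d0 hd] := lg (- x) _ e e0.
    by rewrite ltrNr h2 ltrNl h1.
  exists d => // y /andP[y1 y2] yx.
  have := hd (- y); rewrite ltrN2 y2 lerNl y1 opprK addrC; exact.
Qed.

Lemma nondecr_slope g a b : a <= b ->
  (forall x, a <= x <= b -> cont_at `[a, b] g x) ->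
  (forall x, a < x < b -> exists2 d, 0 <= d & slope_at `[a, b] g x d) ->
  g a <= g b.
Proof.
move=> ab cg sg; apply: nondecr_local_right => // x axb e e0.
have [d d0 /(_ e e0)[del del0 h]] := sg x axb.
case/andP: axb => ax xb.
exists del => // y /andP[xy yb] yx.
have := h y; rewrite /= in_itv/= yb (ltW (lt_trans ax xy)).
rewrite (ger0_norm (_ : 0 <= y - x)) ?subr_ge0 ?(ltW xy)// => /(_ isT yx).
move=> /ler_normlP[h1 _].
have : 0 <= d * (y - x) by rewrite mulr_ge0// subr_ge0 ltW.
lra.
Qed.

(** Equal values at the ends would make the monotone [g] constant, which contradicts a positive
    slope at the midpoint. *)
Lemma incr_slope g a b : a < b ->
  (forall x, a <= x <= b -> cont_at `[a, b] g x) ->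
  (forall x, a < x < b -> exists2 d, 0 < d & slope_at `[a, b] g x d) ->
  g a < g b.
Proof.
move=> ab cg sg; rewrite lt_neqAle nondecr_slope ?ltW// ?andbT; last first.
  by move=> x /sg[d d0 sd]; exists d => //; exact: ltW.
apply/eqP => gab.
have sub x : a <= x <= b -> g x = g a.
  move=> /andP[ax xb]; apply/eqP; rewrite eq_le; apply/andP; split.
    rewrite gab; apply: nondecr_slope => //.
      move=> y /andP[xy yb]; apply: (@contS `[a, b]).
        by apply: subset_itv; rewrite ?bnd_simp.
      by apply: cg; rewrite (le_trans ax xy).
    move=> y /andP[xy yb]; have [|d d0 sd] := sg y.
      by rewrite (le_lt_trans ax xy).
    exists d; first exact: ltW.
    by apply: slopeS sd; apply: subset_itv; rewrite ?bnd_simp.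
  apply: nondecr_slope => //.
    move=> y /andP[xy yb]; apply: (@contS `[a, b]).
      by apply: subset_itv; rewrite ?bnd_simp.
    by apply: cg; rewrite xy (le_trans yb).
  move=> y /andP[xy yb]; have [|d d0 sd] := sg y.
    by rewrite xy (lt_le_trans yb).
  exists d; first exact: ltW.
  by apply: slopeS sd; apply: subset_itv; rewrite ?bnd_simp.
pose x := (a + b) / 2.
have /andP[ax xb] : a < x < b by move: ab; rewrite /x => ab; lra.
have [|d d0 /(_ _ (divr_gt0 d0 (ltr0Sn R 1)))[del del0 h]] := sg x.
  by rewrite ax xb.
pose y := Num.min b (x + del / 2).
have xy : x < y by rewrite lt_min xb ltrDl divr_gt0.
have yb : y <= b by rewrite ge_min lexx.
have := h y; rewrite /= in_itv/= yb (ltW (lt_trans ax xy)).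
rewrite (ger0_norm (_ : 0 <= y - x)) ?subr_ge0 ?(ltW xy)// => /(_ isT).
have yx : y - x < del.
  have : y <= x + del / 2 by rewrite ge_min lexx orbT.
  by move: del0; lra.
move=> /(_ yx) /ler_normlP[+ _].
rewrite !sub ?(ltW ax) ?(ltW xb)// ?yb ?(ltW (lt_trans ax xy))//.
have : 0 < d * (y - x) by rewrite mulr_gt0// subr_gt0.
lra.
Qed.

End slopes.

(** * Best replies to a score *)

Section score_design.
Context {R : realType}.
Variables (sigma qs tinv y : R -> R) (A B a b : R -> R -> R).

Hypothesis qs_antitone : forall t u : R, 0 <= t -> t <= u -> u <= 1 -> qs u <= qs t.
Hypothesis qs1 : qs 1 = 0.
Hypothesis tinv_range : forall q : R, 0 <= q <= qs 0 -> 0 <= tinv q <= 1.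
Hypothesis tinvK : forall q : R, 0 <= q <= qs 0 -> qs (tinv q) = q.
Hypothesis y_gt0 : forall t : R, 0 <= t < 1 -> 0 < y t.
Hypothesis y0 : y 0 = 1.

Hypothesis A_slope : forall q t : R, 0 <= q -> type01 t ->
  slope_at quality (A ^~ t) q (a q t).
Hypothesis B_slope : forall q t : R, 0 <= q -> type01 t ->
  slope_at quality (B ^~ t) q (b q t).
Hypothesis A_mono : forall q t u : R, 0 <= q -> 0 <= t -> t <= u -> u <= 1 ->
  A q t <= A q u.
Hypothesis a_mono : forall q t u : R, 0 <= q -> 0 <= t -> t <= u -> u <= 1 ->
  a q t <= a q u.
Hypothesis b_mono : forall q t u : R, 0 <= q -> 0 <= t -> t <= u -> u <= 1 ->
  b q t <= b q u.
Hypothesis b_ge0 : forall q t : R, 0 <= q -> type01 t -> 0 <= b q t.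

Hypothesis sigma_cont : forall q : R, 0 <= q <= qs 0 -> cont_at `[0, qs 0] sigma q.
Hypothesis sigma_slope : forall q : R, 0 < q <= qs 0 ->
  slope_at `[0, qs 0] sigma q (a q (tinv q) + b q (tinv q) / y (tinv q)).
Hypothesis sigma_above : forall q : R, qs 0 < q ->
  sigma q - sigma (qs 0) <= (A q 0 + B q 0) - (A (qs 0) 0 + B (qs 0) 0).

Definition type_score (t : R) : R := sigma (qs t) - A (qs t) t.

Let qs_ge0 (t : R) : 0 <= t <= 1 -> 0 <= qs t.
Proof. by move=> /andP[t0 t1]; rewrite -qs1 qs_antitone. Qed.

Let qs_le (t : R) : 0 <= t <= 1 -> qs t <= qs 0.
Proof. by move=> /andP[t0 t1]; rewrite qs_antitone. Qed.

Let T01 (t : R) : 0 <= t <= 1 -> type01 t.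
Proof. by rewrite /type01 /= in_itv. Qed.

Let tinv_lt1 (q : R) : 0 < q <= qs 0 -> 0 <= tinv q < 1.
Proof.
move=> /andP[q0 q1]; have qq : 0 <= q <= qs 0 by rewrite (ltW q0).
have /andP[-> t1] := tinv_range qq; rewrite lt_neqAle t1 andbT.
apply/eqP => tq; have := tinvK qq; rewrite tq qs1 => qE.
by rewrite qE ltxx in q0.
Qed.

Let tinv_le (q t : R) : 0 <= q <= qs 0 -> 0 <= t <= 1 -> qs t < q -> tinv q <= t.
Proof.
move=> qq /andP[t0 t1] tq; rewrite leNgt; apply/negP => lt.
have /andP[_ u1] := tinv_range qq.
by have := qs_antitone t0 (ltW lt) u1; rewrite tinvK// leNgt tq.
Qed.

Let tinv_ge (q t : R) : 0 <= q <= qs 0 -> 0 <= t <= 1 -> q < qs t -> t <= tinv q.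
Proof.
move=> qq /andP[t0 t1] tq; rewrite leNgt; apply/negP => lt.
have /andP[u0 _] := tinv_range qq.
by have := qs_antitone u0 (ltW lt) t1; rewrite tinvK// leNgt tq.
Qed.

Let sub_itv (p r : R) : 0 <= p -> r <= qs 0 -> `[p, r]%classic `<=` `[0, qs 0]%classic.
Proof. by move=> p0 r1; apply: subset_itv; rewrite bnd_simp. Qed.

Let sub_quality (p r : R) : 0 <= p -> `[p, r]%classic `<=` @quality R.
Proof. by move=> p0; apply: subset_itv; rewrite bnd_simp. Qed.

(** Between [qs u] and [qs t] the type [tinv x] is at least [t], so [sigma] grows there at least as
    fast as the cost of type [t]. The increment of [A] in the type is kept on the left because it
    yields strict decrease whenever [A] increases strictly in the type. *)
Lemma type_score_antitone (t u : R) : 0 <= t -> t <= u -> u <= 1 ->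
  type_score u + (A (qs u) u - A (qs u) t) <= type_score t.
Proof.
move=> t0 tu u1.
have t01 : 0 <= t <= 1 by rewrite t0 (le_trans tu).
have u01 : 0 <= u <= 1 by rewrite u1 (le_trans t0).
rewrite /type_score addrA subrK.
apply: (@nondecr_slope _ (fun r => sigma r - A r t)).
- exact: qs_antitone.
- move=> x /andP[ux xt].
  have x0 : 0 <= x by rewrite (le_trans _ ux) ?qs_ge0.
  have xq : x <= qs 0 by rewrite (le_trans xt)// qs_le.
  apply: contD; [|apply: contN].
    by apply: contS (sigma_cont _); [exact: sub_itv (qs_ge0 _) (qs_le _)|rewrite x0].
  by apply: contS (slope_cont (A_slope x0 (T01 t01))); exact: sub_quality (qs_ge0 _).
- move=> x /andP[ux xt].
  have x0 : 0 < x by rewrite (le_lt_trans _ ux) ?qs_ge0.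
  have xq : x <= qs 0 by rewrite (le_trans (ltW xt))// qs_le.
  have x01 : 0 < x <= qs 0 by rewrite x0.
  have x01' : 0 <= x <= qs 0 by rewrite ltW.
  have /andP[tx0 tx1] := tinv_lt1 x01.
  exists (a x (tinv x) + b x (tinv x) / y (tinv x) - a x t).
    rewrite subr_ge0; apply: (@le_trans _ _ (a x (tinv x))).
      by apply: a_mono; rewrite ?(ltW x0) ?(ltW tx1)// tinv_ge.
    rewrite lerDl divr_ge0 ?b_ge0 ?(ltW x0)//; last by rewrite ltW// y_gt0 ?tx0.
    by apply: T01; rewrite tx0 ltW.
  apply: slopeB.
    by apply: slopeS (sigma_slope x01); exact: sub_itv (qs_ge0 _) (qs_le _).
  by apply: slopeS (A_slope (ltW x0) (T01 t01)); exact: sub_quality (qs_ge0 _).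
Qed.

(* The slope of [sigma] at [q] makes [q] stationary for the type [tinv q], which
   wins with probability [y (tinv q)]; as marginal costs increase in the type,
   the payoff of a type [t] increases up to [qs t] and decreases from there. The
   function [H] is convex, hence controlled through subgradients only. *)
Section best_response.
Variable H : R -> R.
(** [w] is a subgradient of [H] at [k]. Read as a winning probability, it is at most that of type
    [t] below the score of [t], and at least that of [t] above it. *)
Hypothesis H_sub_below : forall t k : R, type01 t -> k <= type_score t ->
  exists2 w : R, 0 <= w <= y t & forall l : R, H k - H l <= w * (k - l).
Hypothesis H_sub_above : forall t k : R, type01 t -> type_score t <= k ->
  exists2 w : R, y t <= w <= 1 & forall l : R, H k - H l <= w * (k - l).

Let Phi (t q : R) := H (sigma q - A q t) - B q t.

Let H_sub (k : R) : exists2 w : R, 0 <= w <= 1 & forall l : R, H k - H l <= w * (k - l).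
Proof.
have T0 : type01 (0 : R) by apply: T01; rewrite lexx ler01.
have [k0|/ltW k0] := leP k (type_score 0).
  by have [w + hw] := H_sub_below T0 k0; rewrite y0; exists w.
have [w /andP[]+ w1 hw] := H_sub_above T0 k0; rewrite y0 => w0.
by exists w => //; rewrite w1 (le_trans _ w0).
Qed.

Lemma payoff_ndecr (k l : R) : k <= l -> H k <= H l.
Proof.
move=> kl; have [w /andP[w0 _] hw] := H_sub k.
rewrite -subr_le0 (le_trans (hw l))//.
by rewrite mulr_ge0_le0// subr_le0.
Qed.

Lemma payoff_lip (k l : R) : k <= l -> H l - H k <= l - k.
Proof.
move=> kl; have [w /andP[w0 w1] hw] := H_sub l.
by rewrite (le_trans (hw k))// -[leRHS]mul1r ler_wpM2r// subr_ge0.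
Qed.

Let H_cont D g x : cont_at D g x -> cont_at D (H \o g) x.
Proof.
move=> cg e /cg[d d0 hd]; exists d => // z Dz /(hd z Dz); apply: le_trans => /=.
have [gzx|/ltW gzx] := leP (g x) (g z).
  by rewrite !ger0_norm ?subr_ge0 ?payoff_ndecr// payoff_lip.
by rewrite distrC (distrC (g z)) !ger0_norm ?subr_ge0 ?payoff_ndecr// payoff_lip.
Qed.

Let Phi_cont (t p r x : R) : 0 <= p -> r <= qs 0 -> type01 t -> p <= x <= r ->
  cont_at `[p, r] (Phi t) x.
Proof.
move=> p0 r1 tt /andP[px xr].
have x0 : 0 <= x by rewrite (le_trans p0).
have x1 : x <= qs 0 by rewrite (le_trans xr).
apply: contD; last first.
  by apply: contN; apply: contS (slope_cont (B_slope x0 tt)); exact: sub_quality.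
apply: (@H_cont _ (fun q => sigma q - A q t)); apply: contD; [|apply: contN].
  by apply: contS (sigma_cont _); [exact: sub_itv|rewrite x0].
by apply: contS (slope_cont (A_slope x0 tt)); exact: sub_quality.
Qed.

Let Phi_decr (t q : R) : type01 t -> qs t <= q -> q <= qs 0 -> Phi t q <= Phi t (qs t).
Proof.
move=> tt tq q1; have t01 : 0 <= t <= 1 by move: tt; rewrite /type01/= in_itv.
apply: nonincr_local_left => //.
  by move=> x; apply: Phi_cont => //; exact: qs_ge0.
move=> x /andP[tx xq] e e0.
have x0 : 0 < x by rewrite (le_lt_trans _ tx) ?qs_ge0.
have x1 : x <= qs 0 by rewrite (le_trans (ltW xq)).
have x01 : 0 < x <= qs 0 by rewrite x0.
have x01' : 0 <= x <= qs 0 by rewrite ltW.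
have /andP[u0 u1] := tinv_lt1 x01; set u := tinv x in u0 u1.
have u01 : 0 <= u <= 1 by rewrite u0 ltW.
have ut : u <= t by apply: tinv_le.
have yu : 0 < y u by rewrite y_gt0// u0.
have kK : sigma x - A x t <= type_score u.
  rewrite /type_score /u tinvK// lerD2l lerN2.
  by apply: A_mono; rewrite ?(ltW x0)//; case/andP: t01.
have [w /andP[w0 wu] hw] := H_sub_below (T01 u01) kK.
(* The slope at [x] of the payoff linearised along [w]. As [w <= y u], the term [w * (b x u / y u)]
   is at most [b x u]; as [u <= t], the marginal costs of [t] dominate those of [u]. The subgradient
   inequality bounds [H] at [x] minus [H] elsewhere from above, which proves a decrease when tested
   on the left of [x] and an increase when tested on the right. *)
pose d := w * (a x u + b x u / y u - a x t) - b x t.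
have d0 : d <= 0.
  rewrite subr_le0; apply: (@le_trans _ _ (w * (b x u / y u))).
    rewrite ler_wpM2l// lerBlDr addrC lerD2l.
    by apply: a_mono; rewrite ?(ltW x0)//; case/andP: t01.
  apply: (@le_trans _ _ (b x u)).
    rewrite mulrA ler_pdivrMr// mulrC ler_wpM2l// b_ge0 ?(ltW x0)//.
  by apply: b_mono; rewrite ?(ltW x0)//; case/andP: t01.
have sd : slope_at `[qs t, q] (fun r => w * (sigma r - A r t) - B r t) x d.
  apply: slopeB; last first.
    by apply: slopeS (B_slope (ltW x0) tt); exact: sub_quality (qs_ge0 _).
  apply: slopeZ; apply: slopeB.
    by apply: slopeS (sigma_slope x01); exact: sub_itv (qs_ge0 _) _.
  by apply: slopeS (A_slope (ltW x0) tt); exact: sub_quality (qs_ge0 _).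
have [del del0 hdel] := sd e e0.
exists del => // z /andP[tz zx] xz.
have := hdel z; rewrite /= in_itv/= tz (ltW (lt_trans zx xq)) distrC.
rewrite (ger0_norm (_ : 0 <= x - z)) ?subr_ge0 ?(ltW zx)// => /(_ isT xz).
move=> /ler_normlP[+ _].
have := hw (sigma z - A z t); rewrite /Phi.
have : d * (z - x) >= 0 by rewrite mulr_le0// subr_le0 ltW.
lra.
Qed.

Let Phi_incr (t q : R) : type01 t -> 0 <= q -> q <= qs t -> Phi t q <= Phi t (qs t).
Proof.
move=> tt q0 qt; have t01 : 0 <= t <= 1 by move: tt; rewrite /type01/= in_itv.
apply: nondecr_local_right => //.
  by move=> x; apply: Phi_cont => //; exact: qs_le.
move=> x /andP[qx xt] e e0.
have x0 : 0 < x by rewrite (le_lt_trans _ qx).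
have x1 : x <= qs 0 by rewrite (le_trans (ltW xt))// qs_le.
have x01 : 0 < x <= qs 0 by rewrite x0.
have x01' : 0 <= x <= qs 0 by rewrite ltW.
have /andP[u0 u1] := tinv_lt1 x01; set u := tinv x in u0 u1.
have u01 : 0 <= u <= 1 by rewrite u0 ltW.
have tu : t <= u by apply: tinv_ge.
have yu : 0 < y u by rewrite y_gt0// u0.
have kK : type_score u <= sigma x - A x t.
  rewrite /type_score /u tinvK// lerD2l lerN2.
  by apply: A_mono; rewrite ?(ltW x0) ?(ltW u1)//; case/andP: t01.
have [w /andP[wu w1] hw] := H_sub_above (T01 u01) kK.
have w0 : 0 <= w by rewrite (le_trans _ wu)// ltW.
(* Both comparisons are reversed here: [y u <= w] and [t <= u]. *)
pose d := w * (a x u + b x u / y u - a x t) - b x t.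
have d0 : 0 <= d.
  rewrite subr_ge0; apply: (@le_trans _ _ (w * (b x u / y u))); last first.
    rewrite ler_wpM2l// lerBrDr addrC lerD2r.
    by apply: a_mono; rewrite ?(ltW x0) ?(ltW u1)//; case/andP: t01.
  apply: (@le_trans _ _ (b x u)).
    by apply: b_mono; rewrite ?(ltW x0) ?(ltW u1)//; case/andP: t01.
  rewrite mulrA ler_pdivlMr// mulrC ler_wpM2r// b_ge0 ?(ltW x0)//.
have sd : slope_at `[q, qs t] (fun r => w * (sigma r - A r t) - B r t) x d.
  apply: slopeB; last first.
    by apply: slopeS (B_slope (ltW x0) tt); exact: sub_quality.
  apply: slopeZ; apply: slopeB.
    by apply: slopeS (sigma_slope x01); exact: sub_itv _ (qs_le _).
  by apply: slopeS (A_slope (ltW x0) tt); exact: sub_quality.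
have [del del0 hdel] := sd e e0.
exists del => // z /andP[xz zt] zx.
have := hdel z; rewrite /= in_itv/= zt (ltW (lt_trans qx xz)).
rewrite (ger0_norm (_ : 0 <= z - x)) ?subr_ge0 ?(ltW xz)// => /(_ isT zx).
move=> /ler_normlP[+ _].
have := hw (sigma z - A z t); rewrite /Phi.
have : d * (z - x) >= 0 by rewrite mulr_ge0// subr_ge0 ltW.
lra.
Qed.

Let increment_mono (C c : R -> R -> R) :
  (forall q t : R, 0 <= q -> type01 t -> slope_at quality (C ^~ t) q (c q t)) ->
  (forall q t u : R, 0 <= q -> 0 <= t -> t <= u -> u <= 1 -> c q t <= c q u) ->
  forall p q t : R, 0 <= p -> p <= q -> type01 t -> C q 0 - C p 0 <= C q t - C p t.
Proof.
move=> sC mc p q t p0 pq tt.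
have /andP[t0 t1] : 0 <= t <= 1 by move: tt; rewrite /type01/= in_itv.
have T0 : type01 (0 : R) by apply: T01; rewrite lexx ler01.
suff : C p t - C p 0 <= C q t - C q 0 by lra.
apply: (@nondecr_slope _ (fun r => C r t - C r 0)) => //.
  move=> x /andP[px xq]; have x0 : 0 <= x by rewrite (le_trans p0).
  apply: contD; [|apply: contN].
    by apply: contS (slope_cont (sC _ _ x0 tt)); exact: sub_quality.
  by apply: contS (slope_cont (sC _ _ x0 T0)); exact: sub_quality.
move=> x /andP[px xq]; have x0 : 0 <= x by rewrite (le_trans p0)// ltW.
exists (c x t - c x 0); first by rewrite subr_ge0 mc.
apply: slopeB; [apply: slopeS (sC _ _ x0 tt)|apply: slopeS (sC _ _ x0 T0)];
  exact: sub_quality.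
Qed.

Lemma best_response (t q : R) : type01 t -> 0 <= q ->
  H (sigma q - A q t) - B q t <= H (type_score t) - B (qs t) t.
Proof.
move=> tt q0; rewrite -/(Phi t q).
have t01 : 0 <= t <= 1 by move: tt; rewrite /type01/= in_itv.
have [qt|/ltW qt] := leP q (qs t); first exact: Phi_incr.
have [q1|q1] := leP q (qs 0); first exact: Phi_decr.
(* Past [qs 0] the score rises by at most the total cost increment of type 0, hence of type [t],
   since marginal costs increase in the type. [H] is 1-Lipschitz and nondecreasing, so the gain
   cannot outgrow these costs. *)
apply: (@le_trans _ _ (Phi t (qs 0))); last first.
  by apply: Phi_decr => //; exact: qs_le.
have Q0 : 0 <= qs 0 by rewrite qs_ge0// lexx ler01.
have hA := increment_mono A_slope a_mono Q0 (ltW q1) tt.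
have hB := increment_mono B_slope b_mono Q0 (ltW q1) tt.
have hs := sigma_above q1.
have hB0 : B (qs 0) t <= B q t.
  apply: (@nondecr_slope _ (B ^~ t)); first exact: ltW.
    move=> x /andP[px xq]; apply: (@contS _ quality); first exact: sub_quality.
    by apply: slope_cont (B_slope _ tt); rewrite (le_trans Q0).
  move=> x /andP[px xq]; have x0 : 0 <= x by rewrite (le_trans Q0)// ltW.
  exists (b x t); first exact: b_ge0.
  by apply: slopeS (B_slope x0 tt); exact: sub_quality.
rewrite /Phi.
have [kk|/ltW kk] := leP (sigma (qs 0) - A (qs 0) t) (sigma q - A q t).
  by have := payoff_lip kk; lra.
by have := payoff_ndecr kk; lra.
Qed.

End best_response.
End score_design.

(** * Costs, virtual costs and the optimal quality *)

Section slope_facts.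
Context {R : realType}.
Implicit Types (D : set R) (g : R -> R).

Lemma cont_atP D g (x : R) : cont_at D g x <-> g @ within D (nbhs x) --> g x.
Proof.
split=> [cg|/cvgrPdist_le cg e e0].
  apply/cvgrPdist_le => e /cg[d d0 hd].
  rewrite near_withinE; apply/nbhs_ballP; exists d => //= y.
  by rewrite /ball/= distrC => yx Dy; rewrite distrC; exact: hd.
have := cg e e0; rewrite near_withinE => /nbhs_ballP[d /= d0 hd].
exists d => // y Dy yx; rewrite distrC; apply: hd => //.
by rewrite /ball/= distrC.
Qed.

Lemma derive_in_nondecr D g a b : `[a, b] `<=` D -> a <= b ->
  (forall x : R, D x -> derivable_in D g x) ->
  (forall x : R, a < x < b -> 0 <= derive_in D g x) -> g a <= g b.
Proof.
move=> abD ab dg g0; apply: nondecr_slope => // x axb.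
  apply: (contS abD); apply: (slope_cont (derivable_in_slope (dg _ _))).
  by apply: abD; rewrite /= in_itv.
exists (derive_in D g x); first exact: g0.
apply: (slopeS abD); apply: (derivable_in_slope (dg _ _)).
by apply: abD; rewrite /= in_itv/=; case/andP: axb => /ltW-> /ltW->.
Qed.

Lemma derive_in_incr D g a b : `[a, b] `<=` D -> a < b ->
  (forall x : R, D x -> derivable_in D g x) ->
  (forall x : R, a < x < b -> 0 < derive_in D g x) -> g a < g b.
Proof.
move=> abD ab dg g0; apply: incr_slope => // x axb.
  apply: (contS abD); apply: (slope_cont (derivable_in_slope (dg _ _))).
  by apply: abD; rewrite /= in_itv.
exists (derive_in D g x); first exact: g0.
apply: (slopeS abD); apply: (derivable_in_slope (dg _ _)).
by apply: abD; rewrite /= in_itv/=; case/andP: axb => /ltW-> /ltW->.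
Qed.

Lemma slope_ge0 D g (x d : R) : limit_point D x ->
  (forall y z : R, D y -> D z -> y <= z -> g y <= g z) -> D x ->
  slope_at D g x d -> 0 <= d.
Proof.
move=> lx mg Dx sg; rewrite leNgt; apply/negP => d0.
have e0 : 0 < - d / 2 by rewrite divr_gt0 ?oppr_gt0.
have [del del0 hdel] := sg _ e0.
have /lx [y [yx Dy xy]] : nbhs x (ball x del) by exact: nbhsx_ballx.
move: xy; rewrite /ball/= distrC => xy.
have := hdel y Dy xy; have [yx'|] := ltP y x.
  have gyx : g y <= g x by rewrite mg// ltW.
  rewrite (ltr0_norm (_ : y - x < 0)) ?subr_lt0// => /ler_normlP[h1 h2].
  have : 0 < d * (y - x) by rewrite nmulr_rgt0// subr_lt0.
  lra.
rewrite le_eqVlt eq_sym (negbTE yx)/= => yx'.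
have gyx : g x <= g y by rewrite mg// ltW.
rewrite (gtr0_norm (_ : 0 < y - x)) ?subr_gt0// => /ler_normlP[h1 h2].
have : d * (y - x) < 0 by rewrite nmulr_rlt0// subr_gt0.
lra.
Qed.

Lemma quality_limit (x : R) : quality x -> limit_point (@quality R) x.
Proof.
rewrite /quality/= in_itv/= andbT => x0 U /nbhs_ballP[e /= e0 xU].
exists (x + e / 2); split.
- by rewrite -subr_eq0 addrC addKr gt_eqF// divr_gt0.
- by rewrite /= in_itv/= andbT addr_ge0// divr_ge0// ltW.
- apply: xU; rewrite /ball/= opprD addNKr normrN gtr0_norm ?divr_gt0//.
  by rewrite ltr_pdivrMr// ltr_pMr// ltr1n.
Qed.

Lemma type01_limit (x : R) : type01 x -> limit_point (@type01 R) x.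
Proof.
rewrite /type01/= in_itv/= => /andP[x0 x1] U /nbhs_ballP[e /= e0 xU].
have [xh|xh] := leP x (2^-1).
  pose r := Num.min e (2^-1) / 2.
  have r0 : 0 < r by rewrite divr_gt0// lt_min e0 invr_gt0 ltr0n.
  have re : r < e.
    have : Num.min e 2^-1 <= e by rewrite ge_min lexx.
    by rewrite /r; lra.
  have rh : r <= 2^-1.
    have : Num.min e 2^-1 <= 2^-1 by rewrite ge_min lexx orbT.
    by rewrite /r; lra.
  exists (x + r); split.
  - by rewrite -subr_eq0 addrC addKr gt_eqF.
  - by rewrite /= in_itv/=; apply/andP; split; lra.
  - by apply: xU; rewrite /ball/= opprD addNKr normrN gtr0_norm.
pose r := Num.min e (2^-1) / 2.
have r0 : 0 < r by rewrite divr_gt0// lt_min e0 invr_gt0 ltr0n.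
have re : r < e.
  have : Num.min e 2^-1 <= e by rewrite ge_min lexx.
  by rewrite /r; lra.
have rh : r <= 2^-1.
  have : Num.min e 2^-1 <= 2^-1 by rewrite ge_min lexx orbT.
  by rewrite /r; lra.
exists (x - r); split.
- by rewrite -subr_eq0 addrC addKr oppr_eq0 gt_eqF.
- by rewrite /= in_itv/=; apply/andP; split; lra.
- by apply: xU; rewrite /ball/= opprB addrC subrK gtr0_norm.
Qed.

(** Increasing differences: the difference of the costs of two types has a nonnegative slope in the
    quality. *)
Lemma cost_increment_mono (C c : R -> R -> R) :
  (forall q t : R, 0 <= q -> type01 t -> slope_at quality (C ^~ t) q (c q t)) ->
  (forall q t u : R, 0 <= q -> 0 <= t -> t <= u -> u <= 1 -> c q t <= c q u) ->
  forall p q t u : R, 0 <= p -> p <= q -> 0 <= t -> t <= u -> u <= 1 ->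
  C q t - C p t <= C q u - C p u.
Proof.
move=> sC mc p q t u p0 pq t0 tu u1.
have tt : type01 t by rewrite /type01/= in_itv/= t0 (le_trans tu).
have uu : type01 u by rewrite /type01/= in_itv/= u1 (le_trans t0).
suff : C p u - C p t <= C q u - C q t by lra.
have sub : `[p, q]%classic `<=` @quality R.
  by apply: subset_itv; rewrite bnd_simp.
apply: (@nondecr_slope _ (fun r => C r u - C r t)) => //.
  move=> x /andP[px xq]; have x0 : 0 <= x by rewrite (le_trans p0).
  apply: contD; [|apply: contN].
    exact: (contS sub (slope_cont (sC _ _ x0 uu))).
  exact: (contS sub (slope_cont (sC _ _ x0 tt))).
move=> x /andP[px xq]; have x0 : 0 <= x by rewrite (le_trans p0)// ltW.
exists (c x u - c x t); first by rewrite subr_ge0 mc.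
by apply: slopeB; [exact: (slopeS sub (sC _ _ x0 uu))|exact: (slopeS sub (sC _ _ x0 tt))].
Qed.

End slope_facts.

(** * Monotonicity of costs and virtual costs *)

Section model.
Context {R : realType}.
Variables (V f F : R -> R) (CP CI : R -> R -> R).
Hypothesis hA : standing_assumptions V f F CP CI.
Hypothesis f_gt0 : forall t : R, type01 t -> 0 < f t.
Hypothesis F0 : F 0 = 0.
Hypothesis F1 : F 1 = 1.
Hypothesis F_incr : forall t u : R, 0 <= t -> t < u -> u <= 1 -> F t < F u.
Hypothesis F_cont : forall t : R, type01 t -> cont_at type01 F t.

Local Notation V' := (derive_in quality V).
Local Notation vCP := (virtual F f CP).
Local Notation vCI := (virtual F f CI).

Let T01 (t : R) : 0 <= t <= 1 -> type01 t.
Proof. by rewrite /type01 /= in_itv. Qed.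

Let Q (t : R) : 0 <= t -> quality t.
Proof. by rewrite /quality /= in_itv/= andbT. Qed.

Let subT (t u : R) : 0 <= t -> u <= 1 -> `[t, u]%classic `<=` @type01 R.
Proof. by move=> t0 u1; apply: subset_itv; rewrite bnd_simp. Qed.

Let subQ (p q : R) : 0 <= p -> `[p, q]%classic `<=` @quality R.
Proof. by move=> p0; apply: subset_itv; rewrite bnd_simp. Qed.

Lemma F_ge0 (t : R) : type01 t -> 0 <= F t.
Proof.
rewrite /type01/= in_itv/= => /andP[+ t1]; rewrite le_eqVlt.
by move=> /predU1P[<-|t0]; rewrite ?F0// -F0 ltW// F_incr.
Qed.

Lemma CP_incr_t (q t u : R) : 0 <= q -> 0 <= t -> t < u -> u <= 1 -> CP q t < CP q u.
Proof.
move=> q0 t0 tu u1; apply: (@derive_in_incr _ type01) => //; first exact: subT.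
  by move=> x xT; exact: (smooth_t (CP_smooth hA)) (Q q0) xT.
move=> x /andP[tx xu]; apply: (CP_t hA) => //; first exact: Q.
by apply: T01; rewrite (le_trans t0 (ltW tx)) (le_trans (ltW xu)).
Qed.

Lemma CP_mono_t (q t u : R) : 0 <= q -> 0 <= t -> t <= u -> u <= 1 -> CP q t <= CP q u.
Proof.
move=> q0 t0; rewrite le_eqVlt => /predU1P[->//|tu] u1.
by rewrite ltW// CP_incr_t.
Qed.

Lemma CPq_mono_t (q t u : R) : 0 <= q -> 0 <= t -> t <= u -> u <= 1 ->
  Dq CP q t <= Dq CP q u.
Proof.
move=> q0 t0 tu u1; apply: (@derive_in_nondecr _ type01) => //; first exact: subT.
  by move=> x xT; exact: (smooth_qt (CP_smooth hA)) (Q q0) xT.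
move=> x /andP[tx xu]; apply: ltW; apply: (CP_qt hA) => //; first exact: Q.
by apply: T01; rewrite (le_trans t0 (ltW tx)) (le_trans (ltW xu)).
Qed.

Lemma CIq_mono_t (q t u : R) : 0 <= q -> 0 <= t -> t <= u -> u <= 1 ->
  Dq CI q t <= Dq CI q u.
Proof.
rewrite le_eqVlt => /predU1P[<-|q0] t0 tu u1.
  by rewrite !(CI_q0 hA)//; apply: T01; rewrite ?u1 ?t0 ?(le_trans tu) ?(le_trans t0).
apply: (@derive_in_nondecr _ type01) => //; first exact: subT.
  by move=> x xT; exact: (smooth_qt (CI_smooth hA)) (Q (ltW q0)) xT.
move=> x /andP[tx xu]; apply: ltW; apply: (CI_qt hA) => //.
by apply: T01; rewrite (le_trans t0 (ltW tx)) (le_trans (ltW xu)).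
Qed.

Lemma CIq_ge0 (q t : R) : 0 <= q -> type01 t -> 0 <= Dq CI q t.
Proof.
rewrite le_eqVlt => /predU1P[<- tt|q0 tt]; first by rewrite (CI_q0 hA).
by apply: ltW; exact: (CI_q hA).
Qed.

Lemma CP_slope_q (q t : R) : 0 <= q -> type01 t -> slope_at quality (CP ^~ t) q (Dq CP q t).
Proof.
by move=> q0 tt; exact: (derivable_in_slope (smooth_q (CP_smooth hA) (Q q0) tt)).
Qed.

Lemma CI_slope_q (q t : R) : 0 <= q -> type01 t -> slope_at quality (CI ^~ t) q (Dq CI q t).
Proof.
by move=> q0 tt; exact: (derivable_in_slope (smooth_q (CI_smooth hA) (Q q0) tt)).
Qed.

Lemma vCP_slope_q (q t : R) : 0 <= q -> type01 t -> slope_at quality (vCP ^~ t) q (Dq vCP q t).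
Proof.
by move=> q0 tt; exact: (derivable_in_slope (smooth_vq (CP_smooth hA) (Q q0) tt)).
Qed.

Lemma vCI_slope_q (q t : R) : 0 <= q -> type01 t -> slope_at quality (vCI ^~ t) q (Dq vCI q t).
Proof.
by move=> q0 tt; exact: (derivable_in_slope (smooth_vq (CI_smooth hA) (Q q0) tt)).
Qed.

Lemma CP_slope_t (q t : R) : 0 <= q -> type01 t -> slope_at type01 (CP q) t (Dt CP q t).
Proof.
by move=> q0 tt; exact: (derivable_in_slope (smooth_t (CP_smooth hA) (Q q0) tt)).
Qed.

Lemma CI_slope_t (q t : R) : 0 <= q -> type01 t -> slope_at type01 (CI q) t (Dt CI q t).
Proof.
by move=> q0 tt; exact: (derivable_in_slope (smooth_t (CI_smooth hA) (Q q0) tt)).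
Qed.

Lemma CPt_cont_q (q t : R) : 0 <= q -> type01 t -> cont_at quality (Dt CP ^~ t) q.
Proof.
move=> q0 tt; apply: slope_cont.
exact: (derivable_in_slope (smooth_tq (CP_smooth hA) (Q q0) tt)).
Qed.

Lemma CIt_cont_q (q t : R) : 0 <= q -> type01 t -> cont_at quality (Dt CI ^~ t) q.
Proof.
move=> q0 tt; apply: slope_cont.
exact: (derivable_in_slope (smooth_tq (CI_smooth hA) (Q q0) tt)).
Qed.

Lemma CPt_cont_t (q t : R) : 0 <= q -> type01 t -> cont_at type01 (Dt CP q) t.
Proof.
move=> q0 tt; apply: slope_cont.
exact: (derivable_in_slope (smooth_tt (CP_smooth hA) (Q q0) tt)).
Qed.

Lemma CIt_cont_t (q t : R) : 0 <= q -> type01 t -> cont_at type01 (Dt CI q) t.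
Proof.
move=> q0 tt; apply: slope_cont.
exact: (derivable_in_slope (smooth_tt (CI_smooth hA) (Q q0) tt)).
Qed.

Lemma CP_mono_q (p q t : R) : 0 <= p -> p <= q -> type01 t -> CP p t <= CP q t.
Proof.
move=> p0 pq tt; apply: (@derive_in_nondecr _ quality (CP ^~ t)) => //.
- exact: subQ.
- by move=> x xQ; exact: (smooth_q (CP_smooth hA)).
- move=> x /andP[px _]; apply: ltW; apply: (CP_q hA) => //.
  by apply: Q; rewrite (le_trans p0)// ltW.
Qed.

Lemma CI_mono_q (p q t : R) : 0 <= p -> p <= q -> type01 t -> CI p t <= CI q t.
Proof.
move=> p0 pq tt; apply: (@derive_in_nondecr _ quality (CI ^~ t)) => //.
- exact: subQ.
- by move=> x xQ; exact: (smooth_q (CI_smooth hA)).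
- by move=> x /andP[px _]; apply: CIq_ge0 => //; rewrite (le_trans p0)// ltW.
Qed.

Lemma V_mono (p q : R) : 0 <= p -> p <= q -> V p <= V q.
Proof.
move=> p0 pq; apply: (@derive_in_nondecr _ quality V) => //.
- exact: subQ.
- by move=> x xQ; exact: (V_derivable hA).
- move=> x /andP[px _]; apply: (V'_ge0 hA).
  by apply: Q; rewrite (le_trans p0)// ltW.
Qed.

Lemma CI_ge0 (q t : R) : 0 <= q -> type01 t -> 0 <= CI q t.
Proof. by move=> q0 tt; rewrite -(CI_0 hA tt) CI_mono_q. Qed.

(** The assumption concerns the type derivative of the marginal cost in quality. Instead of
    interchanging the two derivatives, the increment from [p] to [q] is shown to be nondecreasing in
    the type, so its type slope is nonnegative. *)
Lemma CPt_mono_q (p q t : R) : 0 <= p -> p <= q -> type01 t -> Dt CP p t <= Dt CP q t.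
Proof.
move=> p0 pq tt; rewrite -subr_ge0.
apply: (slope_ge0 (type01_limit tt) _ tt
  (slopeB (CP_slope_t (le_trans p0 pq) tt) (CP_slope_t p0 tt))).
move=> x z; rewrite /type01/= !in_itv/= => /andP[x0 x1] /andP[z0 z1] xz.
exact: (cost_increment_mono CP_slope_q CPq_mono_t).
Qed.

Lemma CIt_mono_q (p q t : R) : 0 <= p -> p <= q -> type01 t -> Dt CI p t <= Dt CI q t.
Proof.
move=> p0 pq tt; rewrite -subr_ge0.
apply: (slope_ge0 (type01_limit tt) _ tt
  (slopeB (CI_slope_t (le_trans p0 pq) tt) (CI_slope_t p0 tt))).
move=> x z; rewrite /type01/= !in_itv/= => /andP[x0 x1] /andP[z0 z1] xz.
exact: (cost_increment_mono CI_slope_q CIq_mono_t).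
Qed.

Lemma CPt_ge0 (q t : R) : 0 <= q -> type01 t -> 0 <= Dt CP q t.
Proof. by move=> q0 tt; apply: ltW; exact: (CP_t hA (Q q0) tt). Qed.

(** [CI 0] vanishes on the types, so both it and its negative are nondecreasing; this bounds the
    slope from both sides and spares an argument on uniqueness of slopes. *)
Lemma CIt0 (t : R) : type01 t -> Dt CI 0 t = 0.
Proof.
move=> tt; have s0 := CI_slope_t (lexx 0) tt.
apply/eqP; rewrite eq_le; apply/andP; split; last first.
  apply: (slope_ge0 (type01_limit tt) _ tt s0) => x z xT zT _.
  by rewrite !(CI_0 hA).
rewrite -oppr_ge0 -mulN1r.
apply: (slope_ge0 (type01_limit tt) _ tt (slopeZ (-1) s0)) => x z xT zT _.
by rewrite !(CI_0 hA).
Qed.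

Lemma CIt_ge0 (q t : R) : 0 <= q -> type01 t -> 0 <= Dt CI q t.
Proof. by move=> q0 tt; rewrite -(CIt0 tt) CIt_mono_q. Qed.

Lemma CI_mono_t (q t u : R) : 0 <= q -> 0 <= t -> t <= u -> u <= 1 -> CI q t <= CI q u.
Proof.
move=> q0 t0 tu u1; apply: (@derive_in_nondecr _ type01) => //; first exact: subT.
  by move=> x xT; exact: (smooth_t (CI_smooth hA)) (Q q0) xT.
move=> x /andP[tx xu]; apply: CIt_ge0 => //.
by apply: T01; rewrite (le_trans t0 (ltW tx)) (le_trans (ltW xu)).
Qed.

Lemma vCI_mono_q (p q t : R) : 0 <= p -> p <= q -> type01 t -> vCI p t <= vCI q t.
Proof.
move=> p0 pq tt; rewrite /virtual lerD ?CI_mono_q// -!mulrA ler_wpM2r ?CIt_mono_q//.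
by rewrite divr_ge0 ?F_ge0// ltW// f_gt0.
Qed.

Lemma vCP_ge0 (q t : R) : 0 <= q -> type01 t -> 0 <= vCP q t.
Proof.
move=> q0 tt; rewrite /virtual addr_ge0 ?(CP_ge0 hA)//; first exact: Q.
by rewrite divr_ge0 ?mulr_ge0 ?CPt_ge0 ?F_ge0// ltW// f_gt0.
Qed.

Lemma vCI_ge0 (q t : R) : 0 <= q -> type01 t -> 0 <= vCI q t.
Proof.
move=> q0 tt; rewrite /virtual addr_ge0 ?CI_ge0//.
by rewrite divr_ge0 ?mulr_ge0 ?CIt_ge0 ?F_ge0// ltW// f_gt0.
Qed.

Lemma vCP_mono_t (q t u : R) : 0 <= q -> 0 <= t -> t <= u -> u <= 1 -> vCP q t <= vCP q u.
Proof.
move=> q0 t0 tu u1; apply: (@derive_in_nondecr _ type01) => //; first exact: subT.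
  by move=> x xT; exact: (smooth_vt (CP_smooth hA)) (Q q0) xT.
move=> x /andP[tx xu]; apply: ltW; apply: (vCP_t hA) => //; first exact: Q.
by apply: T01; rewrite (le_trans t0 (ltW tx)) (le_trans (ltW xu)).
Qed.

Lemma vCI_mono_t (q t u : R) : 0 <= q -> 0 <= t -> t <= u -> u <= 1 -> vCI q t <= vCI q u.
Proof.
rewrite le_eqVlt => /predU1P[<- t0 tu u1|q0 t0 tu u1].
  have tT : type01 t by apply: T01; rewrite t0 (le_trans tu).
  have uT : type01 u by apply: T01; rewrite u1 (le_trans t0).
  by rewrite /virtual !(CI_0 hA)// !CIt0// !mul0r.
apply: (@derive_in_nondecr _ type01) => //; first exact: subT.
  by move=> x xT; exact: (smooth_vt (CI_smooth hA)) (Q (ltW q0)) xT.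
move=> x /andP[tx xu]; apply: ltW; apply: (vCI_t hA) => //.
by apply: T01; rewrite (le_trans t0 (ltW tx)) (le_trans (ltW xu)).
Qed.

Lemma vCPq_mono_t (q t u : R) : 0 <= q -> 0 <= t -> t <= u -> u <= 1 ->
  Dq vCP q t <= Dq vCP q u.
Proof.
move=> q0 t0 tu u1; apply: (@derive_in_nondecr _ type01) => //; first exact: subT.
  by move=> x xT; exact: (smooth_vqt (CP_smooth hA)) (Q q0) xT.
move=> x /andP[tx xu]; apply: (vCP_qt hA) => //; first exact: Q.
by apply: T01; rewrite (le_trans t0 (ltW tx)) (le_trans (ltW xu)).
Qed.

Lemma vCIq_mono_t (q t u : R) : 0 <= q -> 0 <= t -> t <= u -> u <= 1 ->
  Dq vCI q t <= Dq vCI q u.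
Proof.
move=> q0 t0 tu u1; apply: (@derive_in_nondecr _ type01) => //; first exact: subT.
  by move=> x xT; exact: (smooth_vqt (CI_smooth hA)) (Q q0) xT.
move=> x /andP[tx xu]; apply: (vCI_qt hA) => //; first exact: Q.
by apply: T01; rewrite (le_trans t0 (ltW tx)) (le_trans (ltW xu)).
Qed.

Lemma vCPq_incr_q (p q t : R) : 0 <= p -> p < q -> type01 t -> Dq vCP p t < Dq vCP q t.
Proof.
move=> p0 pq tt; apply: (@derive_in_incr _ quality (Dq vCP ^~ t)) => //.
- exact: subQ.
- by move=> x xQ; exact: (smooth_vqq (CP_smooth hA)).
- move=> x /andP[px _]; apply: (vCP_qq hA) => //.
  by apply: Q; rewrite (le_trans p0)// ltW.
Qed.

Lemma vCIq_incr_q (p q t : R) : 0 <= p -> p < q -> type01 t -> Dq vCI p t < Dq vCI q t.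
Proof.
move=> p0 pq tt; apply: (@derive_in_incr _ quality (Dq vCI ^~ t)) => //.
- exact: subQ.
- by move=> x xQ; exact: (smooth_vqq (CI_smooth hA)).
- move=> x /andP[px _]; apply: (vCI_qq hA) => //.
  by apply: Q; rewrite (le_trans p0)// ltW.
Qed.

Lemma vCIq_ge0 (q t : R) : 0 <= q -> type01 t -> 0 <= Dq vCI q t.
Proof.
move=> q0 tt.
have h0 : 0 <= Dq vCI 0 t.
  apply: (slope_ge0 (quality_limit (Q (lexx 0))) _ (Q (lexx 0))
    (vCI_slope_q (lexx 0) tt)) => x z; rewrite /quality/= !in_itv/= !andbT.
  by move=> x0 z0 xz; rewrite vCI_mono_q.
move: q0; rewrite le_eqVlt => /predU1P[<-//|q0].
by rewrite (le_trans h0)// ltW// vCIq_incr_q.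
Qed.

Lemma vCIq_gt0 (q t : R) : 0 < q -> type01 t -> 0 < Dq vCI q t.
Proof. by move=> q0 tt; rewrite (le_lt_trans (vCIq_ge0 (lexx 0) tt))// vCIq_incr_q. Qed.

Lemma V'_antitone p q : 0 <= p -> p <= q -> V' q <= V' p.
Proof.
move=> p0 pq; rewrite -lerN2.
have sV x : 0 <= x -> slope_at quality (fun r => - V' r) x (- derive_in quality V' x).
  move=> x0; have /(slopeZ (-1)) := derivable_in_slope (V'_derivable hA (Q x0)).
  by under eq_fun do rewrite mulN1r; rewrite mulN1r.
apply: (@nondecr_slope _ (fun r => - V' r)) => //.
  move=> x /andP[px _]; apply: (contS (subQ p0)).
  by apply: (slope_cont (sV _ _)); rewrite (le_trans p0).
move=> x /andP[px _]; have x0 : 0 <= x by rewrite (le_trans p0)// ltW.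
exists (- derive_in quality V' x); first by rewrite oppr_ge0 (V''_le0 hA)//; exact: Q.
exact: (slopeS (subQ p0) (sV _ x0)).
Qed.

(** * The optimal quality function and its inverse *)

Section optimal_quality.
Variables (n : nat) (qs tinv : R -> R).
Hypothesis hn : (2 <= n)%N.
Hypothesis hqs : optimal_symmetric_quality V f F CP CI n qs.
Hypothesis htinv : forall t : R, 0 <= t <= 1 -> tinv (qs t) = t.

(* The probability that a firm of type [t] has the lowest of the [n] types. *)
Definition lowest_prob (m : nat) (G : R -> R) (t : R) : R := (1 - G t) ^+ m.-1.
Local Notation y := (lowest_prob n F).

Let n10 : (0 < n.-1)%N. Proof. by case: n hn => [|[]]. Qed.

Let F_le1 (t : R) : type01 t -> F t <= 1.
Proof.
rewrite /type01/= in_itv/= => /andP[t0]; rewrite le_eqVlt.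
by move=> /predU1P[->|t1]; rewrite ?F1// -F1 ltW// F_incr.
Qed.

Lemma lowest_prob0 : y 0 = 1.
Proof. by rewrite /lowest_prob F0 subr0 expr1n. Qed.

Lemma lowest_prob1 : y 1 = 0.
Proof. by rewrite /lowest_prob F1 subrr expr0n -[n.-1]prednK. Qed.

Lemma lowest_prob_gt0 (t : R) : 0 <= t < 1 -> 0 < y t.
Proof.
by move=> /andP[t0 t1]; rewrite /lowest_prob exprn_gt0// subr_gt0 -F1 F_incr.
Qed.

Lemma lowest_prob_antitone (t u : R) : 0 <= t -> t <= u -> u <= 1 -> y u <= y t.
Proof.
move=> t0; rewrite le_eqVlt => /predU1P[->//|tu] u1.
rewrite /lowest_prob lerXn2r ?nnegrE ?subr_ge0 ?F_le1//.
- by apply: T01; rewrite u1 (le_trans t0)// ltW.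
- by apply: T01; rewrite t0 (le_trans (ltW tu)).
- by rewrite lerD2l lerN2 ltW// F_incr.
Qed.

Lemma lowest_prob_cont (t : R) : type01 t -> cont_at type01 y t.
Proof.
move=> tt; apply/cont_atP; have /cont_atP Ft := F_cont tt.
rewrite /lowest_prob; apply: (@cvg_comp _ _ _ (fun x => 1 - F x) (fun z => z ^+ n.-1)
  _ (nbhs (1 - F t))); last exact: exprn_continuous.
by apply: cvgB => //; exact: cvg_cst.
Qed.

(** The first-order condition of the optimal quality: its zero in [q] is [qs t]. It decreases
    strictly in [q] and weakly in [t], which makes [qs] antitone. *)
Let G (q t : R) := V' q - Dq vCP q t - Dq vCI q t / y t.

Let qs_ge0 (t : R) : 0 <= t <= 1 -> 0 <= qs t.
Proof.
move=> /andP[t0]; rewrite le_eqVlt => /predU1P[->|t1]; first by case: hqs => _ ->.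
by case: hqs => /(_ t)[|]//; rewrite t0.
Qed.

Let G_qs (t : R) : 0 <= t < 1 -> G (qs t) t = 0.
Proof. by move=> /(hqs.1)[_ e]; rewrite /G e /lowest_prob; ring. Qed.

Let G_decr (p q t : R) : 0 <= t < 1 -> 0 <= p -> p < q -> G q t < G p t.
Proof.
move=> t1 p0 pq; have yt := lowest_prob_gt0 t1.
have tt : type01 t by apply: T01; case/andP: t1 => -> /ltW.
have h1 := V'_antitone p0 (ltW pq).
have h2 := vCPq_incr_q p0 pq tt.
have h3 : Dq vCI p t / y t <= Dq vCI q t / y t.
  by rewrite ler_wpM2r// ?invr_ge0 ?ltW// vCIq_incr_q.
by rewrite /G; lra.
Qed.

Let G_antitone (q t u : R) : 0 <= q -> 0 <= t -> t <= u -> u < 1 -> G q u <= G q t.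
Proof.
move=> q0 t0 tu u1; have u01 : 0 <= u < 1 by rewrite (le_trans t0).
have uT : type01 u by apply: T01; rewrite (le_trans t0)//= ltW.
have h1 := vCPq_mono_t q0 t0 tu (ltW u1).
have h2 : Dq vCI q t / y t <= Dq vCI q u / y u.
  apply: ler_pM => //.
  - by apply: vCIq_ge0 => //; apply: T01; rewrite t0 (le_trans tu)// ltW.
  - by rewrite invr_ge0 ltW// lowest_prob_gt0// t0 (le_lt_trans tu).
  - by rewrite vCIq_mono_t// ltW.
  - rewrite lef_pV2 ?posrE ?lowest_prob_gt0// ?t0 ?(le_lt_trans tu)//.
    by rewrite lowest_prob_antitone// ltW.
by rewrite /G; lra.
Qed.

Lemma qs_antitone (t u : R) : 0 <= t -> t <= u -> u <= 1 -> qs u <= qs t.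
Proof.
move=> t0 tu; rewrite le_eqVlt => /predU1P[u1|u1].
  by rewrite u1 (hqs.2) qs_ge0// t0 -u1.
have t01 : 0 <= t < 1 by rewrite t0 (le_lt_trans tu).
have u01 : 0 <= u < 1 by rewrite (le_trans t0).
rewrite leNgt; apply/negP => lt.
have tq : 0 <= qs t by rewrite qs_ge0// t0 ltW//; case/andP: t01.
have := G_decr t01 tq lt; have := G_antitone (le_trans tq (ltW lt)) t0 tu u1.
by rewrite !G_qs//; lra.
Qed.

(** Near type 1 the winning probability [y t] vanishes while the marginal virtual investment cost
    stays above its positive value at type 0, so their quotient exceeds any bound. *)
Let G_near1 (q : R) : 0 < q -> exists2 t, 0 <= t < 1 & G q t < 0.
Proof.
move=> q0; have T0 : type01 (0 : R) by apply: T01; rewrite lexx ler01.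
have T1 : type01 (1 : R) by apply: T01; rewrite lexx ler01.
have b0 := vCIq_gt0 q0 T0.
set b := Dq vCI q 0 in b0.
pose c := `|V' q - Dq vCP q 0| + 1.
have c0 : 0 < c by rewrite ltr_wpDl.
have bc0 : 0 < b / c / 2 by rewrite !divr_gt0.
have [del del0 hdel] := lowest_prob_cont T1 bc0.
pose t := Num.max 0 (1 - del / 2).
have t0 : 0 <= t by rewrite le_max lexx.
have t1 : t < 1 by rewrite gt_max ltr01 ltrBlDr ltrDl divr_gt0.
have t01 : 0 <= t < 1 by rewrite t0.
have tT : type01 t by apply: T01; rewrite t0 ltW.
exists t => //; have := hdel t tT.
rewrite lowest_prob1 subr0 distrC (ger0_norm (_ : 0 <= 1 - t)) ?subr_ge0 ?(ltW t1)//.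
have ht : 1 - t < del.
  have : 1 - del / 2 <= t by rewrite le_max lexx orbT.
  by move: del0; lra.
move=> /(_ ht); have yt := lowest_prob_gt0 t01; rewrite gtr0_norm// => hy.
have h1 := vCPq_mono_t (ltW q0) (lexx 0) t0 (ltW t1).
have h2 : c < Dq vCI q t / y t.
  rewrite ltr_pdivlMr//; apply: (@lt_le_trans _ _ b); last first.
    by rewrite vCIq_mono_t// ltW.
  rewrite mulrC -ltr_pdivlMr//; apply: (le_lt_trans hy).
  by rewrite ltr_pdivrMr// ltr_pMr ?divr_gt0// ltr1n.
have := ler_norm (V' q - Dq vCP q 0); rewrite /G -/b.
by move: h2; rewrite /c; lra.
Qed.

(** Continuity of [qs] is not assumed. The intermediate value theorem is applied to the first-order
    condition as a function of the type, at fixed [q]; strict monotonicity in [q] identifies [qs] at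
    the zero. This turns the left inverse [tinv] into an inverse on the whole of [[0, qs 0]]. *)
Lemma qs_surj (q : R) : 0 <= q <= qs 0 -> exists2 t, 0 <= t <= 1 & qs t = q.
Proof.
move=> /andP[+ q1]; rewrite le_eqVlt => /predU1P[<-|q0].
  by exists 1; rewrite ?lexx ?ler01//; exact: hqs.2.
have [u /andP[u0 u1] Gu] := G_near1 q0.
have G0 : 0 <= G q 0.
  rewrite leNgt; apply/negP => h; have l01 : 0 <= (0 : R) < 1 by rewrite lexx ltr01.
  move: q1; rewrite le_eqVlt => /predU1P[qE|q1].
    by move: h; rewrite qE G_qs// ltxx.
  by have := G_decr l01 (ltW q0) q1; rewrite G_qs//; lra.
have cG : {within `[0, u], continuous (G q)}.
  apply/subspace_continuousP => t /=; rewrite in_itv/= => /andP[t0 tu].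
  have t01 : 0 <= t < 1 by rewrite t0 (le_lt_trans tu).
  have tT : type01 t by apply: T01; rewrite t0 ltW// (le_lt_trans tu).
  have sub : `[0, u]%classic `<=` @type01 R by apply: subT => //; exact: ltW.
  have /cont_atP c1 := contS sub (lowest_prob_cont tT).
  have /cont_atP c2 := contS sub (slope_cont
    (derivable_in_slope (smooth_vqt (CP_smooth hA) (Q (ltW q0)) tT))).
  have /cont_atP c3 := contS sub (slope_cont
    (derivable_in_slope (smooth_vqt (CI_smooth hA) (Q (ltW q0)) tT))).
  apply: cvgB; first by apply: cvgB => //; exact: cvg_cst.
  by apply: cvgM => //; apply: cvgV => //; rewrite gt_eqF// lowest_prob_gt0.
have [|t] := IVT u0 cG (v := 0).
  by rewrite ge_min (ltW Gu) orbT le_max G0.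
rewrite in_itv/= => /andP[t0 tu] Gt; exists t.
  by rewrite t0 ltW// (le_lt_trans tu).
have t01 : 0 <= t < 1 by rewrite t0 (le_lt_trans tu).
have qt0 : 0 <= qs t by rewrite qs_ge0// t0 ltW//; case/andP: t01.
apply/eqP; rewrite eq_le !leNgt; apply/andP; split; apply/negP => lt.
  by have := G_decr t01 (ltW q0) lt; rewrite Gt G_qs// ltxx.
by have := G_decr t01 qt0 lt; rewrite Gt G_qs// ltxx.
Qed.

Lemma tinv_range (q : R) : 0 <= q <= qs 0 -> 0 <= tinv q <= 1.
Proof. by move=> /qs_surj[t t01 <-]; rewrite htinv. Qed.

Lemma tinvK (q : R) : 0 <= q <= qs 0 -> qs (tinv q) = q.
Proof. by move=> /qs_surj[t t01 <-]; rewrite htinv. Qed.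

(** The first-order condition of type [tinv q], read as a differential equation in [q]: [V] is to
    the virtual costs what the score is to the actual ones. *)
Lemma V_slope (q : R) : 0 < q <= qs 0 -> slope_at `[0, qs 0] V q
  (Dq vCP q (tinv q) + Dq vCI q (tinv q) / y (tinv q)).
Proof.
move=> /andP[q0 q1]; have q01 : 0 <= q <= qs 0 by rewrite ltW.
have /andP[t0 t1] := tinv_range q01.
have t01 : 0 <= tinv q < 1.
  rewrite t0 lt_neqAle t1 andbT; apply/eqP => tq; have := tinvK q01.
  by rewrite tq (hqs.2) => qE; move: q0; rewrite -qE ltxx.
have := G_qs t01; rewrite /G tinvK// => e.
have -> : Dq vCP q (tinv q) + Dq vCI q (tinv q) / y (tinv q) = V' q by lra.
apply: (slopeS (subQ (lexx 0))).
exact: (derivable_in_slope (V_derivable hA (Q (ltW q0)))).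
Qed.

(** For type 0, which wins with probability [y 0 = 1], marginal value is below total marginal
    virtual cost at every quality beyond [qs 0]. *)
Lemma V_above (q : R) : qs 0 < q ->
  V q - V (qs 0) <= (vCP q 0 + vCI q 0) - (vCP (qs 0) 0 + vCI (qs 0) 0).
Proof.
move=> q1; have Q0 : 0 <= qs 0 by rewrite qs_ge0// lexx ler01.
have T0 : type01 (0 : R) by apply: T01; rewrite lexx ler01.
have l01 : 0 <= (0 : R) < 1 by rewrite lexx ltr01.
suff : (vCP (qs 0) 0 + vCI (qs 0) 0) - V (qs 0) <= (vCP q 0 + vCI q 0) - V q by lra.
have sl x : 0 <= x -> slope_at `[qs 0, q]%classic
    (fun r => (vCP r 0 + vCI r 0) - V r) x ((Dq vCP x 0 + Dq vCI x 0) - V' x).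
  move=> x0; apply: (slopeS (subQ Q0)); apply: slopeB; last first.
    exact: (derivable_in_slope (V_derivable hA (Q x0))).
  by apply: slopeD; [exact: vCP_slope_q|exact: vCI_slope_q].
apply: (@nondecr_slope _ (fun r => (vCP r 0 + vCI r 0) - V r)).
- exact: ltW.
- by move=> x /andP[xq _]; apply: (slope_cont (sl _ _)); exact: le_trans xq.
- move=> x /andP[xq _]; have x0 : 0 <= x by rewrite (le_trans Q0)// ltW.
  exists (Dq vCP x 0 + Dq vCI x 0 - V' x); last exact: sl.
  have := G_decr l01 Q0 xq; rewrite G_qs// /G lowest_prob0 divr1; lra.
Qed.

Lemma V_cont (q : R) : 0 <= q <= qs 0 -> cont_at `[0, qs 0] V q.
Proof.
move=> /andP[q0 _]; apply: (contS (subQ (lexx 0))).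
exact: (slope_cont (derivable_in_slope (V_derivable hA (Q q0)))).
Qed.

Section score.
Variable s : R -> R.
Hypothesis hs : optimal_score F CP CI n qs tinv s.

Lemma score_cont (q : R) : 0 <= q <= qs 0 -> cont_at `[0, qs 0] s q.
Proof.
move=> q01; case: hs => /subspace_continuousP cs _ _.
by apply/cont_atP; apply: cs; rewrite /= in_itv.
Qed.

Lemma score_slope (q : R) : 0 < q <= qs 0 -> slope_at `[0, qs 0] s q
  (Dq CP q (tinv q) + Dq CI q (tinv q) / y (tinv q)).
Proof.
by move=> q01; case: hs => _ /(_ _ q01)[/derivable_in_slope + <-].
Qed.

End score.
End optimal_quality.
End model.

(** * Independent types *)

Section tuple_measures.
Context {R : realType} {n : nat}.
Implicit Types (A : 'I_n -> set R) (m : {measure set (n.-tuple R) -> \bar R}).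

Definition rectangle A : set (n.-tuple R) :=
  [set th | forall i, A i (tnth th i)].

Lemma measurable_rectangle A : (forall i, measurable (A i)) ->
  measurable (rectangle A).
Proof.
move=> mA; rewrite [X in measurable X](_ : _ =
    \bigcap_(i in [set: 'I_n]) (@tnth n R ^~ i) @^-1` A i); last first.
  by apply/seteqP; split => [th h i _|th h i]; [exact: h|exact: (h i Logic.I)].
apply: fin_bigcap_measurable; first exact: finite_finset.
by move=> i _; rewrite -[X in measurable X]setTI; exact: measurable_tnth.
Qed.

Lemma measurable_cube : measurable (@cube R n).
Proof. by apply: (@measurable_rectangle (fun=> type01)) => i; exact: measurable_itv. Qed.

(** Rectangles form a generating pi-system. Since [iid_profile] prescribes the measure of rectangles
    only, every statement on the law of profiles passes through this. *)
Lemma measure_rectangle_unique m1 m2 : (m1 setT < +oo)%E ->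
  (forall A, (forall i, measurable (A i)) -> m1 (rectangle A) = m2 (rectangle A)) ->
  forall B, measurable B -> m1 B = m2 B.
Proof.
move=> m1oo m12.
pose G := [set B | exists2 A, (forall i, measurable (A i)) & B = rectangle A].
have GT : G setT.
  by exists (fun=> setT) => //; apply/seteqP; split.
apply: (@measure_unique _ _ _ G (fun=> setT)) => //.
- apply/seteqP; split.
    apply: smallest_sub; first exact: smallest_sigma_algebra.
    move=> B; rewrite -bigcup_seq => -[i _ [A mA <-]].
    apply: sub_sigma_algebra.
    exists (fun j => if j == i then A else setT).
      by move=> j; case: ifP.
    rewrite setTI; apply/seteqP; split=> [th h j|th /(_ i)]; last by rewrite eqxx.
    by case: ifPn => // /eqP ->.
  apply: smallest_sub; first exact: sigma_algebra_measurable.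
  by move=> B [A mA ->]; exact: measurable_rectangle.
- move=> B C [A1 mA1 ->] [A2 mA2 ->]; exists (fun i => A1 i `&` A2 i).
    by move=> i; exact: measurableI.
  by apply/seteqP; split=> th; [move=> [h1 h2] i; split|move=> h; split=> i; have [] := h i].
- by apply/seteqP; split => // x _; exists 0%N.
- by move=> B [A mA ->]; exact: m12.
Qed.

End tuple_measures.

Section integration.
Context d (T : measurableType d) {R : realType} (mu : probability T R).
Local Open Scope ereal_scope.

Lemma integral_full_measure (D : set T) (g : T -> \bar R) :
  measurable D -> mu D = 1 -> measurable_fun setT g ->
  \int[mu]_x g x = \int[mu]_(x in D) g x.
Proof.
move=> mD D1 mg; rewrite [RHS]integral_mkcond.
apply: ae_eq_integral => //.
  by apply/(measurable_restrictT _ mD); exact: measurable_funTS.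
exists (~` D); split; first exact: measurableC.
  by apply: (etrans (probability_setC mu mD)); rewrite D1 subee.
move=> x /= gx Dx; apply: gx => _; rewrite patchE ifT//; exact: mem_set.
Qed.

End integration.

Section independent_types.
Context {R : realType} {n : nat} (P : probability R R)
  (Pn : probability (n.-tuple R) R).
Hypothesis hPn : iid_profile P Pn.
Hypothesis P01 : P type01 = 1%E.
Implicit Types (i : 'I_n) (t : R) (th : n.-tuple R).

Definition with_type i t th : n.-tuple R :=
  [tuple if j == i then t else tnth th j | j < n].

Lemma with_typeE i t th j :
  tnth (with_type i t th) j = if j == i then t else tnth th j.
Proof. by rewrite tnth_mktuple. Qed.

Lemma cube_with_type i t th : type01 t -> cube n th -> cube n (with_type i t th).
Proof. by move=> tt ct j; rewrite with_typeE; case: ifP => // _; exact: ct. Qed.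

Lemma iid_profile_unique (m : {measure set (n.-tuple R) -> \bar R}) :
  (forall A, (forall i, measurable (A i)) ->
    m (rectangle A) = (\prod_i fine (P (A i)))%:E) ->
  forall B, measurable B -> Pn B = m B.
Proof.
move=> hm; apply: measure_rectangle_unique.
  by rewrite [X in (X < _)%E]probability_setT ltry.
by move=> A mA; rewrite hm//; exact: hPn.
Qed.

Lemma cube_prob1 : Pn (cube n) = 1%E.
Proof.
rewrite [LHS](@hPn (fun=> type01) (fun=> measurable_itv _)) big1// => i _.
by rewrite -[X in fine X]/(P type01) P01.
Qed.

Lemma measurable_with_type i :
  measurable_fun setT (fun x : R * n.-tuple R => with_type i x.1 x.2).
Proof.
apply/measurable_fun_tnthP => j; rewrite (_ : _ \o _ =
    fun x => if j == i then x.1 else tnth x.2 j); last first.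
  by apply/funext => x /=; rewrite with_typeE.
case: (j == i); first exact: measurable_fst.
exact: (measurableT_comp (measurable_tnth j) measurable_snd).
Qed.

Lemma measurable_with_type2 i t : measurable_fun setT (with_type i t).
Proof.
rewrite (_ : with_type i t = (fun x : R * n.-tuple R => with_type i x.1 x.2) \o (fun th => (t, th))) //.
apply: measurableT_comp; first exact: measurable_with_type.
exact: measurable_fun_pair.
Qed.

(** Redrawing the type of firm [i] independently leaves the law of the profile unchanged. This
    replaces a decomposition of tuples into one type and the others, and reduces conditioning on a
    type to Fubini's theorem. *)
Lemma resample_measure i (B : set (n.-tuple R)) : measurable B ->
  Pn B = pushforward (P \x Pn)%E (fun x : R * n.-tuple R => with_type i x.1 x.2) B.
Proof.
have mw := measurable_with_type i.
move: B; apply: iid_profile_unique => A mA.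
pose A' j := if j == i then setT else A j.
have wE : (fun x : R * n.-tuple R => with_type i x.1 x.2) @^-1` rectangle A =
    A i `*` rectangle A'.
  apply/seteqP; split=> [[t th] /= h|[t th] /= [h1 h2] j].
    split; first by have := h i; rewrite with_typeE eqxx.
    by move=> j; rewrite /A'; case: ifPn => // ji; have := h j; rewrite with_typeE (negbTE ji).
  rewrite with_typeE; case: ifPn => [/eqP->//|ji].
  by have := h2 j; rewrite /A' (negbTE ji).
have mA' j : measurable (A' j) by rewrite /A'; case: ifP.
rewrite -[LHS]/((P \x Pn)%E (_ @^-1` rectangle A)) wE.
apply: (etrans (product_measure1E _ _ (mA i) (measurable_rectangle mA'))).
have PA : P (A i) = (fine (P (A i)))%:E by rewrite fineK// fin_num_measure.
transitivity ((fine (P (A i)))%:E * (\prod_j fine (P (A' j)))%:E)%E.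
  by congr (_ * _)%E; [exact: PA|exact: hPn].
rewrite -EFinM.
rewrite [in RHS](bigD1 i)//= [in LHS](bigD1 i)//= {1}/A' eqxx.
rewrite [P setT]probability_setT mul1r; congr (_ * _)%:E.
by apply: eq_bigr => j ji; rewrite /A' (negbTE ji).
Qed.

End independent_types.

Section resampling.
Context {R : realType} {n : nat} (P : probability R R)
  (Pn : probability (n.-tuple R) R).
Hypothesis hPn : iid_profile P Pn.
Hypothesis P01 : P type01 = 1%E.
Variables (i : 'I_n) (h : n.-tuple R -> \bar R).
Hypothesis mh : measurable_fun (cube n) h.
Local Open Scope ereal_scope.

Let phi := fun x : R * n.-tuple R => with_type i x.1 x.2.
Let h' := h \_ (cube n).

Let mh' : measurable_fun setT h'.
Proof. by apply/(measurable_restrictT _ measurable_cube). Qed.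

Let mhphi : measurable_fun setT (h' \o phi).
Proof. by apply: measurableT_comp => //; exact: measurable_with_type. Qed.

Let inner_cube t : type01 t ->
  \int[Pn]_th h' (with_type i t th) = \int[Pn]_(th in cube n) h (with_type i t th).
Proof.
move=> tt; rewrite (integral_full_measure (D := cube n))//.
- apply: eq_integral => th; rewrite inE => ct.
  by rewrite /h' patchE ifT// inE; exact: cube_with_type.
- exact: measurable_cube.
- exact: cube_prob1 hPn P01.
- apply: measurableT_comp => //; exact: measurable_with_type2.
Qed.

Let outer (F : R -> \bar R) : measurable_fun setT F ->
  (forall t, F t = \int[Pn]_th h' (with_type i t th)) ->
  \int[P]_t F t = \int[P]_(t in type01) \int[Pn]_(th in cube n) h (with_type i t th).
Proof.
move=> mF FE; rewrite (integral_full_measure (D := type01))//; last exact: measurable_itv.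
by apply: eq_integral => t; rewrite inE => tt; rewrite FE inner_cube.
Qed.

Lemma ge0_resample_integral : (forall th, cube n th -> 0 <= h th) ->
  \int[Pn]_(th in cube n) h th =
  \int[P]_(t in type01) \int[Pn]_(th in cube n) h (with_type i t th).
Proof.
move=> h0; have h'0 th : 0 <= h' th.
  by rewrite /h' patchE; case: ifPn => //; rewrite inE => /h0.
rewrite integral_mkcond -/h'.
transitivity (\int[pushforward (P \x Pn) phi]_th h' th).
  apply: eq_measure_integral; first exact: measurable_with_type.
  by move=> ? A mA _; exact: (resample_measure hPn).
rewrite ge0_integral_pushforward//; last exact: measurable_with_type.
rewrite preimage_setT fubini_tonelli1//; last by move=> x; exact: h'0.
apply: outer => //; apply: measurable_fun_fubini_tonelli_F => //.
by move=> x; exact: h'0.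
Qed.

Lemma measurable_resample : (forall th, cube n th -> 0 <= h th) ->
  measurable_fun type01 (fun t => \int[Pn]_(th in cube n) h (with_type i t th)).
Proof.
move=> h0; have h'0 th : 0 <= h' th.
  by rewrite /h' patchE; case: ifPn => //; rewrite inE => /h0.
apply: (eq_measurable_fun (fun t => \int[Pn]_th h' (with_type i t th))).
  by move=> t; rewrite inE => tt; rewrite inner_cube.
apply: measurable_funTS.
apply: (@measurable_fun_fubini_tonelli_F _ _ _ _ _ Pn (h' \o phi)) => //.
by move=> x; exact: h'0.
Qed.

Lemma resample_integral : Pn.-integrable (cube n) h ->
  \int[Pn]_(th in cube n) h th =
  \int[P]_(t in type01) \int[Pn]_(th in cube n) h (with_type i t th).
Proof.
move=> /(integrable_mkcond _ measurable_cube) ih; rewrite -/h' in ih.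
have ihphi : (P \x Pn).-integrable setT (h' \o phi).
  apply/integrableP; split => //.
  have /integrableP[_] := ih; apply: le_lt_trans.
  rewrite -[X in X <= _](ge0_integral_pushforward _ _ measurableT
     (f := fun th => `|h' th|)) //; last 2 first.
    exact: measurable_with_type.
    by apply: measurableT_comp.
  rewrite (eq_measure_integral Pn)//; first exact: measurable_with_type.
  by move=> ? A mA _; exact: (esym (resample_measure hPn _ mA)).
rewrite integral_mkcond -/h'.
transitivity (\int[pushforward (P \x Pn) phi]_th h' th).
  apply: eq_measure_integral; first exact: measurable_with_type.
  by move=> ? A mA _; exact: (resample_measure hPn).
rewrite integral_pushforward//; last exact: measurable_with_type.
rewrite preimage_setT -integral12_prod_meas1//.
by apply: outer => //; exact: (measurable_fubini_F ihphi).
Qed.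

End resampling.

(** * The law of a single type *)

Section type_law.
Context {R : realType} (P : probability R R) (f : R -> R).
Hypothesis hf : has_density01 P f.
Hypothesis f_cont : forall t : R, type01 t -> cont_at type01 f t.
Local Notation F := (type_cdf P).
Local Notation mu := (@lebesgue_measure R).

Let mT : measurable (@type01 R). Proof. exact: measurable_itv. Qed.

Let PE (A : set R) : measurable A -> P A = (\int[mu]_(x in A `&` type01) (f x)%:E)%E.
Proof. by case: hf => _ _; exact. Qed.

Let f_gt0 (t : R) : type01 t -> 0 < f t. Proof. by case: hf => _ + _; exact. Qed.

Lemma P_type01 : P type01 = 1%E.
Proof.
by rewrite -(@probability_setT _ _ _ P) !PE// ?setIid ?setTI.
Qed.

Lemma P_set1 (t : R) : P [set t] = 0%E.
Proof.
rewrite PE//; have [tt|tt] := pselect (type01 t).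
  rewrite (_ : _ `&` _ = [set t]) ?integral_set1//.
  by apply/seteqP; split => [x []//|x ->]; split.
rewrite (_ : _ `&` _ = set0) ?integral_set0//.
by apply/seteqP; split => // x [->].
Qed.

Lemma cdf_0 : F 0 = 0.
Proof.
rewrite /type_cdf PE; last exact: measurable_itv.
rewrite (_ : _ `&` _ = [set 0]) ?integral_set1//.
apply/seteqP; split => [x|x ->].
  by rewrite /type01/= !in_itv/= => -[x0 /andP[x1 _]]; apply/eqP; rewrite eq_le x0.
by rewrite /type01/= !in_itv/= !lexx ler01.
Qed.

Lemma cdf_1 : F 1 = 1.
Proof.
rewrite /type_cdf PE; last exact: measurable_itv.
rewrite (_ : _ `&` _ = type01 `&` type01) -?PE ?P_type01//.
rewrite setIid; apply/seteqP; split => [x []//|x].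
by rewrite /type01/= !in_itv/= => xT; split => //; case/andP: xT.
Qed.

Lemma cdf_itv (t u : R) : t <= u -> (F u - F t)%:E = P `]t, u]%classic.
Proof.
move=> tu; rewrite /type_cdf EFinB !fineK ?fin_num_measure//.
have -> : `]-oo, u]%classic = `]-oo, t]%classic `|` `]t, u]%classic :> set R.
  by rewrite -itv_bndbnd_setU// bnd_simp.
rewrite measureU//; first by rewrite addeAC subee ?add0e// fin_num_measure.
apply/seteqP; split => // x [] /=; rewrite !in_itv/= => xt /andP[tx _].
by move: tx; rewrite ltNge xt.
Qed.

(** A continuous positive density on a compact interval lies between two constants, the lower one
    positive. The lower one makes [F] strictly increasing, the upper one continuous. *)
Lemma cdf_lipschitz : exists2 mM : R * R, 0 < mM.1 &
  forall t u : R, 0 <= t -> t <= u -> u <= 1 ->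
    mM.1 * (u - t) <= F u - F t <= mM.2 * (u - t).
Proof.
have fc : {within `[0, 1], continuous f}.
  by apply/subspace_continuousP => t tt; apply/cont_atP; exact: f_cont.
have [a aT fa] := EVT_min (@ler01 R) fc.
have [b bT fb] := EVT_max (@ler01 R) fc.
exists (f a, f b) => /=; first exact: f_gt0.
move=> t u t0 tu u1; rewrite -!lee_fin cdf_itv// PE; last exact: measurable_itv.
have sub : `]t, u]%classic `<=` @type01 R.
  by apply: subset_itv; rewrite bnd_simp.
have sT x : `]t, u]%classic x -> x \in `[0, 1] by move=> /sub.
rewrite setIidl//.
have lebE : mu `]t, u]%classic = (u - t)%:E.
  rewrite lebesgue_measure_itv/= lte_fin; case: ltP => // ut.
  have -> : u = t by apply/eqP; rewrite eq_le ut.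
  by rewrite subrr.
have mf : measurable_fun `]t, u]%classic (EFin \o f).
  apply/measurable_EFinP; case: hf => mf _ _; exact: measurable_funS mf.
rewrite !EFinM -lebE -!integral_cst//; apply/andP; split; apply: ge0_le_integral => //.
- by move=> x _; rewrite lee_fin ltW// f_gt0.
- by move=> x /sT xT; rewrite lee_fin fa.
- by move=> x /sT xT; rewrite lee_fin; apply/ltW/f_gt0.
- by move=> x /sT xT; rewrite lee_fin fb.
Qed.

Lemma cdf_incr (t u : R) : 0 <= t -> t < u -> u <= 1 -> F t < F u.
Proof.
move=> t0 tu u1; have [mM m0 /(_ t u t0 (ltW tu) u1)/andP[h _]] := cdf_lipschitz.
by rewrite -subr_gt0 (lt_le_trans _ h)// mulr_gt0// subr_gt0.
Qed.

Lemma cdf_cont (t : R) : type01 t -> cont_at type01 F t.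
Proof.
move=> tt e e0; have [[m M] /= m0 h] := cdf_lipschitz.
have M0 : 0 < M.
  have /andP[h1 h2] := h 0 1 (lexx 0) ler01 (lexx 1).
  by move: h1 h2; lra.
exists (e / M); first by rewrite divr_gt0.
have key x z : type01 x -> type01 z -> x <= z -> z - x < e / M -> `|F z - F x| <= e.
  rewrite /type01/= !in_itv/= => /andP[x0 x1] /andP[z0 z1] xz.
  rewrite ltr_pdivlMr// mulrC => ze; have /andP[h1 h2] := h x z x0 xz z1.
  rewrite ger0_norm; first by rewrite (le_trans h2)// ltW.
  by rewrite (le_trans _ h1)// mulr_ge0 ?subr_ge0// ltW.
move=> z zT zt; have [tz|/ltW tz] := leP t z.
  by apply: key => //; move: zt; rewrite ger0_norm// subr_ge0.
by rewrite distrC; apply: key => //; move: zt; rewrite distrC ger0_norm// subr_ge0.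
Qed.

Local Open Scope ereal_scope.

(** The density is given through probabilities of sets only. It agrees almost everywhere with the
    Radon-Nikodym derivative, through which integrals are transferred. *)
Lemma density_integral (g : R -> \bar R) : measurable_fun type01 g ->
  (forall t : R, type01 t -> 0 <= g t) ->
  \int[P]_(t in type01) g t = \int[mu]_(t in type01) (g t * (f t)%:E).
Proof.
move=> mg g0.
(* [lebesgue_measure] lives on [measurableTypeR R], whose display differs from
   that of [R]; the law of the identity transports [P] there. *)
have mid : measurable_fun setT (idfun : R -> measurableTypeR R).
  by move=> _ A mA; rewrite setTI.
pose X : {mfun R >-> measurableTypeR R} :=
  HB.pack (idfun : R -> measurableTypeR R) (isMeasurableFun.Build _ _ _ _ _ mid).
pose P' := distribution P X.
have PE' (A : set (measurableTypeR R)) : measurable A ->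
  P' A = \int[mu]_(x in A `&` type01) (f x)%:E by exact: PE.
have mf : measurable_fun (type01 : set (measurableTypeR R)) (EFin \o f).
  by apply/measurable_EFinP; case: hf.
have Pmu : P' `<< mu.
  apply/null_content_dominatesP => A mA A0; rewrite PE'//.
  apply: null_set_integral; first exact: measurableI.
    exact: measurable_funS mf.
  by apply: subset_measure0 A0 => //; exact: measurableI.
pose h := Radon_Nikodym_SigmaFinite.f P' mu.
pose g' := g \_ type01.
have g'0 x : 0 <= g' x by rewrite /g' patchE; case: ifPn => //; rewrite inE => /g0.
have mg' : measurable_fun setT g' by apply/(measurable_restrictT _ mT).
transitivity (\int[P']_(t in type01) g' t).
  rewrite ge0_integral_pushforward//; last exact: measurable_funTS.
  by apply: eq_integral => t tT; rewrite /= /g' patchE tT.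
rewrite -(Radon_Nikodym_SigmaFinite.change_of_variables Pmu g'0 mT); last first.
  exact: measurable_funTS.
have mh : measurable_fun (type01 : set (measurableTypeR R)) h.
  apply: measurable_funTS.
  exact: measurable_int (Radon_Nikodym_SigmaFinite.f_integrable Pmu).
apply: ae_eq_integral => //.
- by apply: emeasurable_funM => //; exact: measurable_funTS.
- exact: emeasurable_funM.
have : ae_eq mu type01 h (EFin \o f).
  apply: integral_ae_eq => //.
    apply: (integrableS measurableT) => //.
    exact: Radon_Nikodym_SigmaFinite.f_integrable.
  move=> E ET mE; rewrite -Radon_Nikodym_SigmaFinite.f_integral//.
  by apply: (etrans (PE' E mE)); rewrite setIidl.
apply: filterS => x hx xT.
by rewrite /g' patchE mem_set// -/h hx.
Qed.

End type_law.

Section bounded_integrals.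
Context d (T : measurableType d) {R : realType} (mu : probability T R).
Implicit Types (D : set T) (f g : T -> R).

Lemma measurable_natbool D (b : T -> bool) : measurable_fun D b ->
  measurable_fun D (fun x => (b x)%:R : R).
Proof.
move=> mb; apply: (@measurableT_comp _ _ _ _ _ _ (fun c : bool => c%:R : R)) => //.
Qed.

Lemma bounded_integrable D g c : measurable D -> measurable_fun D g ->
  (forall x, D x -> `|g x| <= c) -> mu.-integrable D (EFin \o g).
Proof.
move=> mD mg gc; have ic := finite_measure_integrable_cst mu c mD.
apply: le_integrable ic => //; first exact/measurable_EFinP.
move=> x Dx /=; rewrite lee_fin (le_trans (gc x Dx))//.
exact: ler_norm.
Qed.

Lemma Rintegral_cst1 D c : measurable D -> mu D = 1%E ->
  \int[mu]_(x in D) c = c.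
Proof.
move=> mD D1; have e : fine (mu D) = 1 by rewrite D1.
by rewrite Rintegral_cst// -[RHS]mulr1; congr (_ * _); exact: e.
Qed.

Lemma EFin_Rintegral D g : measurable D -> mu.-integrable D (EFin \o g) ->
  (\int[mu]_(x in D) g x)%:E = (\int[mu]_(x in D) (g x)%:E)%E.
Proof. by move=> mD ig; rewrite /Rintegral fineK// integrable_fin_num. Qed.

Lemma Rintegral_natbool D (b : T -> bool) : measurable D ->
  measurable_fun setT b -> \int[mu]_(x in D) (b x)%:R = fine (mu (D `&` [set x | b x])).
Proof.
move=> mD mb; have mS : measurable [set x | b x].
  have := mb measurableT [set true]; rewrite setTI; exact.
rewrite /Rintegral; congr fine.
rewrite (eq_integral (fun x => (\1_[set x | b x] x)%:E)).
  by rewrite integral_indic// setIC.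
move=> x _; rewrite indicE; congr ((nat_of_bool _)%:R%:E).
by apply/idP/idP => [h|/set_mem//]; exact: mem_set.
Qed.

End bounded_integrals.

(** * Competing against the lowest rival type *)

Section lowest_rival.
Context {R : realType} {n : nat} (P : probability R R)
  (Pn : probability (n.-tuple R) R).
Hypothesis hn : (2 <= n)%N.
Hypothesis hPn : iid_profile P Pn.
Hypothesis P01 : P type01 = 1%E.
Implicit Types (i j : 'I_n) (t k : R) (th : n.-tuple R).
Local Notation C := (@cube R n).

(** The lowest rival type. The default 1 is the highest type, so it never undercuts an actual rival
    on the cube. *)
Definition rival i th : R := \big[Num.min/1]_(j < n | j != i) tnth th j.

Lemma measurable_rival i : measurable_fun setT (rival i).
Proof.
rewrite (_ : rival i = fun th => \big[Num.min/1]_(j <- index_enum 'I_n | j != i) tnth th j) //.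
elim: (index_enum 'I_n) => [|j s IHs].
  by under eq_fun do rewrite big_nil; exact: measurable_cst.
under eq_fun do rewrite big_cons.
case: (j != i) => //.
by apply: measurable_minr => //; exact: measurable_tnth.
Qed.

Lemma cube_le1 th j : C th -> tnth th j <= 1.
Proof. by move=> /(_ j); rewrite /type01/= in_itv/= => /andP[]. Qed.

Lemma rival_le i j th : j != i -> rival i th <= tnth th j.
Proof. by move=> ji; exact: bigmin_le_cond. Qed.

Lemma other_index i : exists j, j != i.
Proof.
have n0 : (0 < n)%N by exact: leq_trans hn.
have [i0|i0] := eqVneq (val i) 0%N.
  by exists (Ordinal hn); apply/eqP => /(congr1 val)/=; rewrite i0.
by exists (Ordinal n0); apply/eqP => /(congr1 val)/= e; move: i0; rewrite /= -e.
Qed.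

Lemma rival_attained i th : C th -> exists2 j, j != i & rival i th = tnth th j.
Proof.
move=> cth; have [j ji] := other_index i.
have [|k ki kE] := @eq_bigmin _ _ _ 1 j (fun j => j != i) (tnth th) ji.
  by move=> k _; exact: cube_le1.
by exists k.
Qed.

Lemma rival01 i th : C th -> type01 (rival i th).
Proof. by move=> cth; have [j _ ->] := rival_attained i cth; exact: cth. Qed.

Lemma rival_with_type i t th : rival i (with_type i t th) = rival i th.
Proof.
by apply: eq_bigr => j ji; rewrite with_typeE (negbTE ji).
Qed.

(** A minimum belongs to an upper set exactly when all the terms do, so the event is a rectangle. *)
Lemma rival_law i (U : set R) : measurable U ->
  (forall u v, type01 u -> type01 v -> u <= v -> U u -> U v) ->
  Pn (C `&` [set th | U (rival i th)]) = ((fine (P (U `&` type01))) ^+ n.-1)%:E.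
Proof.
move=> mU upU.
pose A j := if j == i then type01 else U `&` type01.
have mA j : measurable (A j).
  by rewrite /A; case: ifP => _; [exact: measurable_itv|apply: measurableI => //; exact: measurable_itv].
have -> : C `&` [set th | U (rival i th)] = rectangle A.
  apply/seteqP; split => [th [cth /= Ui] j|th h].
    rewrite /A; case: ifPn => [_|ji]; first exact: cth.
    split; last exact: cth.
    by apply: upU Ui; [exact: rival01|exact: cth|exact: rival_le].
  have cth : C th by move=> j; have := h j; rewrite /A; case: ifP => // _ [].
  split=> //=; have [j ji ->] := rival_attained i cth.
  by have := h j; rewrite /A (negbTE ji) => -[].
rewrite (hPn mA) (bigD1 i)//= {1}/A eqxx P01 mul1r.
rewrite (eq_bigr (fun=> fine (P (U `&` type01)))); last first.
  by move=> j ji; rewrite /A (negbTE ji).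
by rewrite prodr_const cardC1 card_ord.
Qed.

(** Transposing two coordinates preserves the law and maps the rivals of [i] to those of [j]. *)
Lemma exchange_types i j (phi : R -> R) : measurable_fun setT phi ->
  (forall u, type01 u -> 0 <= phi u) ->
  (\int[Pn]_(th in C) (phi (rival i th))%:E = \int[Pn]_(th in C) (phi (rival j th))%:E)%E.
Proof.
move=> mphi phi0.
pose sw th : n.-tuple R := [tuple tnth th (tperm i j l) | l < n].
have msw : measurable_fun setT sw.
  apply/measurable_fun_tnthP => l; rewrite (_ : _ \o _ = fun th => tnth th (tperm i j l)).
    exact: measurable_tnth.
  by apply/funext => th /=; rewrite tnth_mktuple.
have swC : sw @^-1` C = C.
  apply/seteqP; split => th h l; last by rewrite tnth_mktuple; exact: h.
  by have := h (tperm i j l); rewrite tnth_mktuple tpermK.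
have swr th : rival i (sw th) = rival j th.
  rewrite /rival [RHS](reindex_inj (@perm_inj _ (tperm i j))).
  apply: eq_big => l; last by rewrite tnth_mktuple.
  by rewrite -{2}(tpermL i j) (inj_eq perm_inj).
have mrec (A : 'I_n -> set R) : (forall i, measurable (A i)) ->
    pushforward Pn sw (rectangle A) = (\prod_i fine (P (A i)))%:E.
  move=> mA; rewrite /pushforward.
  have -> : sw @^-1` rectangle A = rectangle (fun l => A (tperm i j l)).
    apply/seteqP; split => th h l; have := h (tperm i j l);
      by rewrite tnth_mktuple tpermK.
  rewrite (hPn (fun l => mA _)); congr EFin.
  by rewrite [RHS](reindex_inj (@perm_inj _ (tperm i j))).
transitivity (\int[pushforward Pn sw]_(th in C) (phi (rival i th))%:E)%E.
  apply: eq_measure_integral => A mA _.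
  exact: (iid_profile_unique hPn mrec mA).
have mr : measurable_fun C (fun th => (phi (rival i th))%:E).
  apply/measurable_EFinP; apply: measurable_funTS; apply: measurableT_comp => //.
  exact: measurable_rival.
rewrite ge0_integral_pushforward//; last 2 first.
- exact: measurable_cube.
- by move=> th; rewrite inE => cth; rewrite lee_fin phi0//; exact: rival01.
by rewrite swC; apply: eq_integral => th _; rewrite /= swr.
Qed.

End lowest_rival.

Section rival_gain.
Context {R : realType} {n : nat} (P : probability R R) (f : R -> R)
  (Pn : probability (n.-tuple R) R).
Hypothesis hn : (2 <= n)%N.
Implicit Types (i j : 'I_n) (t u k l : R).
Hypothesis hPn : iid_profile P Pn.
Hypothesis hf : has_density01 P f.
Local Notation C := (@cube R n).
Local Notation F := (type_cdf P).
Local Notation y := (lowest_prob n F).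

Let P01 : P type01 = 1%E. Proof. exact: P_type01 hf. Qed.
Let C1 : Pn C = 1%E. Proof. exact: cube_prob1 hPn P01. Qed.
Let mC : measurable C. Proof. exact: measurable_cube. Qed.

Lemma P_type_gt (t : R) : 0 <= t <= 1 -> fine (P (`]t, +oo[ `&` @type01 R)) = 1 - F t.
Proof.
move=> /andP[t0 t1]; rewrite -(cdf_1 hf).
have -> : (`]t, +oo[ `&` @type01 R = `]t, 1] :> set R)%classic.
  apply/seteqP; split => x /=; rewrite /type01/= !in_itv/= andbT.
    by move=> [-> /andP[_ ->]].
  by move=> /andP[tx x1]; split => //; rewrite x1 ltW// (le_lt_trans t0).
by rewrite -[LHS]/(fine (P `]t, 1]%classic)) -(cdf_itv P)//.
Qed.

Lemma P_type_ge (t : R) : 0 <= t <= 1 -> fine (P (`[t, +oo[ `&` @type01 R)) = 1 - F t.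
Proof.
move=> t01; rewrite -P_type_gt//; congr fine.
have -> : (`[t, +oo[ `&` @type01 R = [set t] `|` (`]t, +oo[ `&` @type01 R) :> set R)%classic.
  apply/seteqP; split => x /=; rewrite /type01/= !in_itv/= !andbT.
    by rewrite le_eqVlt => -[/predU1P[->|tx] xT]; [left|right].
  by move=> [->|[tx xT]]; [rewrite lexx|rewrite ltW].
rewrite measureU//.
- by rewrite [X in (X + _)%E](P_set1 hf) add0e.
- by apply: measurableI; exact: measurable_itv.
- by apply/seteqP; split => // x [-> []]; rewrite /= in_itv/= ltxx.
Qed.

Lemma rival_gt_prob i t : 0 <= t <= 1 ->
  \int[Pn]_(th in C) (t < rival i th)%R%:R = y t.
Proof.
move=> t01; rewrite Rintegral_natbool//; last first.
  by apply: measurable_fun_ltr => //; exact: measurable_rival.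
have := rival_law (P := P) (Pn := Pn) hn hPn P01 (U := `]t, +oo[%classic) i (measurable_itv _).
rewrite /= => h.
have -> : C `&` [set th | t < rival i th] = C `&` [set th | `]t, +oo[%classic (rival i th)].
  by apply/seteqP; split => th /=; rewrite in_itv/= andbT.
rewrite h/= ?P_type_gt// => u v _ _ uv; rewrite !in_itv/= !andbT => tu.
exact: lt_le_trans uv.
Qed.

Lemma rival_ge_prob i t : 0 <= t <= 1 ->
  \int[Pn]_(th in C) (t <= rival i th)%R%:R = y t.
Proof.
move=> t01; rewrite Rintegral_natbool//; last first.
  by apply: measurable_fun_ler => //; exact: measurable_rival.
have := rival_law (P := P) (Pn := Pn) hn hPn P01 (U := `[t, +oo[%classic) i (measurable_itv _).
rewrite /= => h.
have -> : C `&` [set th | t <= rival i th] = C `&` [set th | `[t, +oo[%classic (rival i th)].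
  by apply/seteqP; split => th /=; rewrite in_itv/= andbT.
rewrite h/= ?P_type_ge// => u v _ _ uv; rewrite !in_itv/= !andbT => tu.
exact: le_trans uv.
Qed.

Section score_function.
Variable K : R -> R.
Hypothesis K_antitone : forall u v : R, u <= v -> K v <= K u.

Lemma measurable_score : measurable_fun setT K.
Proof. by apply: nonincreasing_measurable => // u v uv; exact: K_antitone. Qed.

Lemma measurable_rival_score D i : measurable_fun D (fun th => K (rival i th)).
Proof.
apply: measurable_funTS; apply: measurableT_comp; first exact: measurable_score.
exact: measurable_rival.
Qed.

(* The expected payoff, gross of investment, of a firm that values winning at
   the score [k] in a second-score auction against rivals scoring [K]. *)
Definition rival_gain i k : R :=
  \int[Pn]_(th in C) Num.max 0 (k - K (rival i th)).

Let K_bound i th : C th -> `|K (rival i th)| <= `|K 0| + `|K 1|.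
Proof.
move=> /(rival01 hn i); rewrite /type01/= in_itv/= => /andP[r0 r1].
have := K_antitone r0; have := K_antitone r1.
have := ler_norm (K 0); have := ler_norm (- K 1); rewrite normrN.
have := normr_ge0 (K 0); have := normr_ge0 (K 1).
by rewrite ler_norml => *; apply/andP; split; lra.
Qed.

Let int_gain i k : Pn.-integrable C (EFin \o (fun th => Num.max 0 (k - K (rival i th)))).
Proof.
apply: (@bounded_integrable _ _ _ _ _ _ (`|k| + (`|K 0| + `|K 1|))) => //.
  apply: measurable_maxr => //; apply: measurable_funB => //.
  exact: measurable_rival_score.
move=> th cth; have := K_bound i cth; rewrite ler_norml => /andP[h1 h2].
have := ler_norm k; have := normr_ge0 k.
rewrite (ger0_norm (_ : 0 <= Num.max 0 _)); last by rewrite le_max lexx.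
by rewrite ge_max => *; apply/andP; split; lra.
Qed.

Let int_bool (b : n.-tuple R -> bool) : measurable_fun setT b ->
  Pn.-integrable C (EFin \o (fun th => (b th)%:R : R)).
Proof.
move=> mb; apply: (@bounded_integrable _ _ _ _ _ _ 1) => //.
  by apply: measurable_natbool; exact: measurable_funTS.
by move=> th _; case: (b th); rewrite ?normr1 ?normr0.
Qed.

(** The indicator of winning is a pointwise subgradient of the positive part; its expectation is one
    of the expected gain. *)
Let gain_sub i k (b : n.-tuple R -> bool) : measurable_fun setT b ->
  (forall th l, Num.max 0 (k - K (rival i th)) - Num.max 0 (l - K (rival i th))
     <= (k - l) * (b th)%:R) ->
  forall l : R, rival_gain i k - rival_gain i l <=
     (\int[Pn]_(th in C) (b th)%:R) * (k - l).
Proof.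
move=> mb hb l; rewrite /rival_gain -RintegralB//.
rewrite mulrC -RintegralZl//; last exact: int_bool.
apply: le_Rintegral => //.
- by have := integrableB mC (int_gain i k) (int_gain i l).
- by have := integrableZl mC (k - l) (int_bool mb).
Qed.

(** Winning only by a strict margin gives the least subgradient. From [K r < k <= K t] it follows
    that [t < r], even where [K] is flat. *)
Lemma rival_gain_sub_below i t k : type01 t -> k <= K t ->
  exists2 w : R, 0 <= w <= y t & forall l : R, rival_gain i k - rival_gain i l <= w * (k - l).
Proof.
move=> tt kK; have t01 : 0 <= t <= 1 by move: tt; rewrite /type01/= in_itv.
have mb : measurable_fun setT (fun th => K (rival i th) < k).
  by apply: measurable_fun_ltr => //; exact: measurable_rival_score.
exists (\int[Pn]_(th in C) (K (rival i th) < k)%R%:R).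
  rewrite -(rival_gt_prob i t01); apply/andP; split.
    by apply: Rintegral_ge0 => th _; rewrite ler0n.
  apply: le_Rintegral => //; [exact: int_bool| |].
    by apply: int_bool; apply: measurable_fun_ltr => //; exact: measurable_rival.
  move=> th _; rewrite ler_nat; have [h|//] := ltP (K (rival i th)) k.
  have [//|rt] := ltP t (rival i th).
  by have := K_antitone rt; lra.
apply: gain_sub => // th l; have [h|h] := ltP (K (rival i th)) k.
  rewrite mulr1 (max_r (_ : 0 <= k - _)); last by rewrite subr_ge0 ltW.
  have : l - K (rival i th) <= Num.max 0 (l - K (rival i th)) by rewrite le_max lexx orbT.
  lra.
rewrite mulr0 (max_l (_ : k - _ <= 0)) ?subr_le0//.
by rewrite le_max lexx.
Qed.

(** Winning ties as well gives the largest subgradient: every rival [r >= t] has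
    [K r <= K t <= k]. *)
Lemma rival_gain_sub_above i t k : type01 t -> K t <= k ->
  exists2 w : R, y t <= w <= 1 & forall l : R, rival_gain i k - rival_gain i l <= w * (k - l).
Proof.
move=> tt kK; have t01 : 0 <= t <= 1 by move: tt; rewrite /type01/= in_itv.
have mb : measurable_fun setT (fun th => K (rival i th) <= k).
  by apply: measurable_fun_ler => //; exact: measurable_rival_score.
exists (\int[Pn]_(th in C) (K (rival i th) <= k)%R%:R).
  rewrite -(rival_ge_prob i t01); apply/andP; split.
    apply: le_Rintegral => //; [|exact: int_bool|].
      by apply: int_bool; apply: measurable_fun_ler => //; exact: measurable_rival.
    move=> th _; rewrite ler_nat; have [h|//] := leP t (rival i th).
    by rewrite (le_trans (K_antitone h) kK).
  rewrite -[leRHS](Rintegral_cst1 1 mC C1); apply: le_Rintegral => //.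
  - exact: int_bool.
  - exact: finite_measure_integrable_cst.
  - by move=> th _; rewrite lern1; case: (K _ <= k).
apply: gain_sub => // th l; have [h|h] := leP (K (rival i th)) k.
  rewrite mulr1 (max_r (_ : 0 <= k - _)); last by rewrite subr_ge0.
  have : l - K (rival i th) <= Num.max 0 (l - K (rival i th)) by rewrite le_max lexx orbT.
  lra.
rewrite mulr0 (max_l (_ : k - _ <= 0)); last by rewrite subr_le0 ltW.
by rewrite sub0r oppr_le0 le_max lexx.
Qed.

Lemma rival_gain_ge0 i k : 0 <= rival_gain i k.
Proof. by apply: Rintegral_ge0 => th _; rewrite le_max lexx. Qed.

(* [K] being antitone, [K (rival i th)] is the best rival score: this is what
   [i] expects to lose to it when winning against all types above [t]. *)
Definition tail_score i t : R :=
  \int[Pn]_(th in C) (K (rival i th) * (t < rival i th)%R%:R).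

Let int_tail i t :
  Pn.-integrable C (EFin \o (fun th => K (rival i th) * (t < rival i th)%R%:R)).
Proof.
apply: (@bounded_integrable _ _ _ _ _ _ (`|K 0| + `|K 1|)) => //.
  apply: measurable_funM; first exact: measurable_rival_score.
  apply: measurable_natbool; apply: measurable_funTS.
  by apply: measurable_fun_ltr => //; exact: measurable_rival.
move=> th cth; rewrite normrM; case: (t < _).
  by rewrite normr1 mulr1 K_bound.
by rewrite normr0 mulr0 addr_ge0.
Qed.

Lemma tail_score1 i : tail_score i 1 = 0.
Proof.
rewrite /tail_score -[RHS](Rintegral_cst1 0 mC C1); apply: eq_Rintegral => th.
rewrite inE => /(rival01 hn i); rewrite /type01/= in_itv/= => /andP[_ r1].
by rewrite ltNge r1 mulr0.
Qed.

(** The increment collects [K] over rival types in []t, u]], an event of probability [y t - y u].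
    These bounds stand for the differential relation between the tail score and [y], whose
    derivatives are never formed. *)
Lemma tail_score_increment i t u : 0 <= t -> t <= u -> u <= 1 ->
  K u * (y t - y u) <= tail_score i t - tail_score i u <= K t * (y t - y u).
Proof.
move=> t0 tu u1.
have t01 : 0 <= t <= 1 by rewrite t0 (le_trans tu).
have u01 : 0 <= u <= 1 by rewrite u1 (le_trans t0).
have mlt x : measurable_fun setT (fun th => x < rival i th).
  by apply: measurable_fun_ltr => //; exact: measurable_rival.
have ib x : Pn.-integrable C (EFin \o (fun th => (x < rival i th)%R%:R : R)).
  exact: int_bool.
have iB : Pn.-integrable C
    (EFin \o (fun th => (t < rival i th)%R%:R - (u < rival i th)%R%:R : R)).
  by have := integrableB mC (ib t) (ib u).
have iN : Pn.-integrable C (EFin \o (fun th =>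
    K (rival i th) * (t < rival i th)%R%:R - K (rival i th) * (u < rival i th)%R%:R)).
  by have := integrableB mC (int_tail i t) (int_tail i u).
have iZ c : Pn.-integrable C (EFin \o (fun th =>
    c * ((t < rival i th)%R%:R - (u < rival i th)%R%:R))).
  by have := integrableZl mC c iB.
rewrite -(rival_gt_prob i t01) -(rival_gt_prob i u01) -RintegralB//.
rewrite -!RintegralZl// /tail_score -RintegralB//.
apply/andP; split; apply: le_Rintegral => // th _.
  have [ur|ru] := ltP u (rival i th); first by rewrite (le_lt_trans tu ur) !subrr mulr0.
  rewrite mulr0 !subr0; have [tr|_] := ltP t (rival i th); last by rewrite !mulr0.
  by rewrite !mulr1 K_antitone.
have [ur|ru] := ltP u (rival i th); first by rewrite (le_lt_trans tu ur) !subrr mulr0.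
rewrite mulr0 !subr0; have [tr|_] := ltP t (rival i th); last by rewrite !mulr0.
by rewrite !mulr1 K_antitone// ltW.
Qed.

Lemma tail_score_exchange i j t : tail_score i t = tail_score j t.
Proof.
(* [K 1] is the least value of [K] on types; subtracting it makes the integrand nonnegative, as
   [exchange_types] requires. *)
have key (l : 'I_n) : tail_score l t =
    \int[Pn]_(th in C) ((K (rival l th) - K 1) * (t < rival l th)%R%:R)
    + K 1 * \int[Pn]_(th in C) (t < rival l th)%R%:R.
  have mlt : measurable_fun setT (fun th => t < rival l th).
    by apply: measurable_fun_ltr => //; exact: measurable_rival.
  have h1 := integrableZl mC (K 1) (int_bool mlt).
  have h2 := integrableB mC (int_tail l t) h1.
  rewrite -RintegralZl//; last exact: int_bool.
  rewrite -RintegralD//; last first.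
    apply: eq_integrable h2 => // th _ /=.
    by rewrite mulrBl.
  by apply: eq_Rintegral => th _; rewrite mulrBl subrK.
have mlt : measurable_fun setT (fun u : R => (t < u)%R%:R : R).
  by apply: measurable_natbool; exact: measurable_fun_ltr.
rewrite !key; congr (fine _ + K 1 * fine _).
  apply: (exchange_types hn hPn i j (phi := fun u => (K u - K 1) * (t < u)%R%:R)).
    by apply: measurable_funM => //; apply: measurable_funB => //; exact: measurable_score.
  move=> u; rewrite /type01/= in_itv/= => /andP[_ u1].
  by rewrite mulr_ge0// subr_ge0 K_antitone.
exact: (exchange_types hn hPn i j (phi := fun u => (t < u)%R%:R)).
Qed.

(** The positive part wins exactly when this pays. Winning against the types above a cutoff [t] is
    another rule, hence no better; for [k = K t] it is optimal. *)
Lemma tail_score_gain i k t : 0 <= t <= 1 ->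
  k * y t - tail_score i t <= rival_gain i k.
Proof.
move=> t01; have mlt : measurable_fun setT (fun th => t < rival i th).
  by apply: measurable_fun_ltr => //; exact: measurable_rival.
rewrite -(rival_gt_prob i t01) -RintegralZl//; last exact: int_bool.
have h1 := integrableZl mC k (int_bool mlt).
rewrite /tail_score -RintegralB//.
have h2 := integrableB mC h1 (int_tail i t).
apply: le_Rintegral => // th _; rewrite -mulrBl le_max.
by case: (t < _); rewrite ?mulr0 ?mulr1 lexx ?orbT.
Qed.

Lemma tail_score_gain_eq i t : 0 <= t <= 1 ->
  K t * y t - tail_score i t = rival_gain i (K t).
Proof.
move=> t01; have mlt : measurable_fun setT (fun th => t < rival i th).
  by apply: measurable_fun_ltr => //; exact: measurable_rival.
rewrite -(rival_gt_prob i t01) -RintegralZl//; last exact: int_bool.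
have h1 := integrableZl mC (K t) (int_bool mlt).
rewrite /tail_score -RintegralB//.
apply: eq_Rintegral => th _; rewrite -mulrBl.
have [tr|rt] := ltP t (rival i th).
  by rewrite mulr1 max_r// subr_ge0 K_antitone// ltW.
by rewrite mulr0 max_l// subr_le0 K_antitone.
Qed.

End score_function.
End rival_gain.

(** * The score offered in equilibrium *)

Section equilibrium_score.
Context {R : realType} {n : nat} (P : probability R R) (f : R -> R)
  (Pn : probability (n.-tuple R) R).
Hypothesis hn : (2 <= n)%N.
Implicit Types (i j : 'I_n) (t u k l : R).
Hypothesis hPn : iid_profile P Pn.
Hypothesis hf : has_density01 P f.
Hypothesis f_cont : forall t, type01 t -> cont_at type01 f t.
Local Notation C := (@cube R n).
Local Notation F := (type_cdf P).
Local Notation y := (lowest_prob n F).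
Variable K : R -> R.
Hypothesis K_antitone : forall u v : R, u <= v -> K v <= K u.
Hypothesis K_decr : forall u v : R, 0 <= u -> u < v -> v <= 1 -> K v < K u.
Variable i0 : 'I_n.
Local Notation N := (tail_score Pn K).
Local Notation H := (rival_gain Pn K).

Let P01 : P type01 = 1%E. Proof. exact: P_type01 hf. Qed.
Let C1 : Pn C = 1%E. Proof. exact: cube_prob1 hPn P01. Qed.
Let mC : measurable C. Proof. exact: measurable_cube. Qed.
Let F1 := cdf_1 hf.
Let F_incr := cdf_incr hf f_cont.
Let ygt0 t : 0 <= t < 1 -> 0 < y t. Proof. exact: lowest_prob_gt0. Qed.
Let y1 : y 1 = 0. Proof. exact: lowest_prob1. Qed.
Let ydecr t u : 0 <= t -> t < u -> u <= 1 -> y u < y t.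
Proof.
move=> t0 tu u1; rewrite /lowest_prob ltrXn2r.
- by case: n hn => [|[]].
- rewrite subr_ge0 -F1; move: u1; rewrite le_eqVlt => /predU1P[->//|u1].
  by rewrite ltW// F_incr// (le_trans t0)// ltW.
- by rewrite ltrD2l ltrN2 F_incr.
Qed.
Let incr i t u := tail_score_increment hn hPn hf K_antitone i (t := t) (u := u).
Let N1 i : N i 1 = 0. Proof. exact: (tail_score1 hn hPn hf). Qed.

(* The expected best rival value [K], given that it is below one's own. *)
Definition equilibrium_score t : R := if t < 1 then N i0 t / y t else K 1.
Local Notation S := equilibrium_score.

Lemma equilibrium_scoreE i t : 0 <= t <= 1 -> S t * y t = N i t.
Proof.
move=> /andP[t0]; rewrite le_eqVlt /equilibrium_score => /predU1P[->|t1].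
  by rewrite y1 mulr0 N1.
by rewrite t1 divfK ?gt_eqF ?ygt0 ?t0// (tail_score_exchange hn hPn K_antitone i i0).
Qed.

Lemma equilibrium_score_le t : 0 <= t <= 1 -> S t <= K t.
Proof.
move=> /andP[t0]; rewrite le_eqVlt => /predU1P[->|t1].
  by rewrite /equilibrium_score ltxx.
have /andP[_] := incr i0 t0 (ltW t1) (lexx 1).
by rewrite N1 y1 !subr0 /equilibrium_score t1 ler_pdivrMr// ygt0 ?t0.
Qed.

Let score_lt t : 0 <= t -> t < 1 -> S t < K t.
Proof.
move=> t0 t1; rewrite /equilibrium_score t1 ltr_pdivrMr ?ygt0 ?t0//.
(* Rivals above the midpoint have positive probability [y m] and scores at most [K m < K t], which
   makes the mean strictly smaller than [K t]. *)
pose m := (t + 1) / 2.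
have tm : t < m by rewrite /m; lra.
have m1 : m < 1 by rewrite /m; lra.
have m0 : 0 <= m by rewrite (le_trans t0)// ltW.
have /andP[_ h1] := incr i0 t0 (ltW tm) (ltW m1).
have /andP[_] := incr i0 m0 (ltW m1) (lexx 1); rewrite N1 y1 !subr0 => h2.
have : 0 < (K t - K m) * y m.
  by rewrite mulr_gt0 ?ygt0 ?m0// subr_gt0 K_decr// ltW.
lra.
Qed.

(** The mean over rivals above [t] averages [S u], the mean over rivals above [u], with the values
    of [K] on []t, u]], which are at least [K u > S u]. For [u = 1] the two bounds coincide,
    [S 1 = K 1], and a midpoint provides strictness. *)
Lemma equilibrium_score_decr t u : 0 <= t -> t < u -> u <= 1 -> S u < S t.
Proof.
move=> t0 tu u1.
have t1 : t < 1 by exact: lt_le_trans u1.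
have yt : 0 < y t by rewrite ygt0// t0.
have u0 : 0 <= u by rewrite (le_trans t0)// ltW.
rewrite -(ltr_pM2r yt) (equilibrium_scoreE i0) ?t0 ?(ltW t1)//.
move: u1; rewrite le_eqVlt => /predU1P[uE|u1].
  rewrite {1}uE {1}/equilibrium_score ltxx.
  pose m := (t + 1) / 2.
  have tm : t < m by rewrite /m; lra.
  have m1 : m < 1 by rewrite /m; lra.
  have m0 : 0 <= m by rewrite (le_trans t0)// ltW.
  have /andP[h1 _] := incr i0 t0 (ltW tm) (ltW m1).
  have /andP[] := incr i0 m0 (ltW m1) (lexx 1); rewrite N1 y1 !subr0 => h2 _.
  have : 0 < (K m - K 1) * (y t - y m).
    by rewrite mulr_gt0// subr_gt0 ?K_decr// ydecr// ltW.
  lra.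
have /andP[h1 _] := incr i0 t0 (ltW tu) (ltW u1).
have : 0 < (K u - S u) * (y t - y u).
  by rewrite mulr_gt0// subr_gt0 ?score_lt// ydecr// ltW.
have : S u * y u = N i0 u by apply: equilibrium_scoreE; rewrite u0 ltW.
lra.
Qed.

Lemma equilibrium_score_antitone t u : 0 <= t -> t <= u -> u <= 1 -> S u <= S t.
Proof.
move=> t0; rewrite le_eqVlt => /predU1P[->//|tu] u1.
by rewrite ltW// equilibrium_score_decr.
Qed.

Let int_bool (b : n.-tuple R -> bool) : measurable_fun setT b ->
  Pn.-integrable C (EFin \o (fun th => (b th)%:R : R)).
Proof.
move=> mb; apply: (@bounded_integrable _ _ _ _ _ _ 1) => //.
  by apply: measurable_natbool; exact: measurable_funTS.
by move=> th _; case: (b th); rewrite ?normr1 ?normr0.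
Qed.

(* Ties have probability zero, so a random variable between the indicators of
   [t < rival] and [t <= rival] has expectation [y t]. *)
Lemma winning_prob i t (g : n.-tuple R -> R) : 0 <= t <= 1 ->
  Pn.-integrable C (EFin \o g) ->
  (forall th, C th -> t < rival i th -> g th = 1) ->
  (forall th, C th -> rival i th < t -> g th = 0) ->
  (forall th, C th -> 0 <= g th <= 1) ->
  \int[Pn]_(th in C) g th = y t.
Proof.
move=> t01 ig g1 g0 g01.
have m1 : measurable_fun setT (fun th => t <= rival i th).
  by apply: measurable_fun_ler => //; exact: measurable_rival.
have m2 : measurable_fun setT (fun th => t < rival i th).
  by apply: measurable_fun_ltr => //; exact: measurable_rival.
apply/eqP; rewrite eq_le -{1}(rival_ge_prob hn hPn hf i t01).
rewrite -(rival_gt_prob hn hPn hf i t01); apply/andP; split; apply: le_Rintegral => //.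
- exact: int_bool.
- move=> th cth; case: (ltgtP t (rival i th)) => [tr|rt|_].
  + by rewrite g1.
  + by rewrite g0.
  + by case/andP: (g01 th cth).
- exact: int_bool.
- move=> th cth; case: (ltgtP t (rival i th)) => [tr|rt|_].
  + by rewrite g1.
  + by rewrite g0.
  + by case/andP: (g01 th cth).
Qed.

(** The score [c] wins against the types above some cutoff [x], hence with probability [y x]. There
    [c * y x] is at least the tail score at [x], so the profit is at most that of the cutoff rule
    [x] when the best rival score is paid, which [tail_score_gain] bounds. *)
Lemma deviation_bound i k c (g : n.-tuple R -> R) :
  Pn.-integrable C (EFin \o g) ->
  (forall th, C th -> S (rival i th) < c -> g th = 1) ->
  (forall th, C th -> c < S (rival i th) -> g th = 0) ->
  (forall th, C th -> 0 <= g th <= 1) ->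
  (k - c) * \int[Pn]_(th in C) g th <= H i k.
Proof.
move=> ig g1 g0 g01.
suff [x x01 [xlo xhi hx]] : exists2 x, 0 <= x <= 1 &
    [/\ (forall u, 0 <= u <= 1 -> x < u -> S u < c),
        (forall u, 0 <= u <= 1 -> u < x -> c < S u) &
        N i x <= c * y x].
  rewrite (winning_prob (i := i) x01)//; last 2 first.
  - move=> th cth xr; apply: g1 => //; apply: xlo => //.
    by have := rival01 hn i cth; rewrite /type01/= in_itv.
  - move=> th cth xr; apply: g0 => //; apply: xhi => //.
    by have := rival01 hn i cth; rewrite /type01/= in_itv.
  have := tail_score_gain hn hPn hf K_antitone i k x01.
  by rewrite mulrBl; lra.
pose U := [set u : R | 0 <= u <= 1 /\ S u < c].
have [[v Uv]|/forallNP noU] := pselect (exists v, U v); last first.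
  (* No type offers less than [c], so [c] never wins beyond ties and the cutoff is the top type. *)
  exists 1; first by rewrite lexx ler01.
  split; last by rewrite N1 y1 mulr0.
    by move=> u /andP[_ u1]; rewrite ltNge u1.
  move=> u /andP[u0 u1'] u1.
  have c1 : c <= S 1.
    by rewrite leNgt; apply/negP => h; apply: (noU 1); split => //; rewrite lexx ler01.
  by apply: (le_lt_trans c1); exact: equilibrium_score_decr.
have lU : has_lbound U by exists 0 => u [/andP[]].
pose x := inf U.
have x0 : 0 <= x by apply: lb_le_inf; [exists v|move=> u [/andP[]]].
have x1 : x <= 1 by apply: (le_trans (ge_inf lU Uv)); case: Uv => /andP[].
have xlo u : 0 <= u <= 1 -> x < u -> S u < c.
  move=> /andP[u0 u1] xu.
  have [w [/andP[w0 w1] wc] wu] : exists2 w, U w & w < u.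
    have ux : 0 < u - x by rewrite subr_gt0.
    have [w Uw] := inf_adherent ux (conj (ex_intro _ v Uv) lU).
    by rewrite -/x addrC subrK; exists w.
  by apply: le_lt_trans wc; exact: equilibrium_score_antitone (ltW wu) u1.
exists x; first by rewrite x0.
split => //.
  move=> u /andP[u0 u1] ux; pose m := (u + x) / 2.
  have um : u < m by rewrite /m; lra.
  have mx : m < x by rewrite /m; lra.
  have m0 : 0 <= m by rewrite (le_trans u0)// ltW.
  have m1 : m <= 1 by rewrite (le_trans (ltW mx)).
  apply: (@le_lt_trans _ _ (S m)); last exact: equilibrium_score_decr.
  rewrite leNgt; apply/negP => h.
  have : x <= m by apply: (ge_inf lU); split => //; rewrite m0.
  by rewrite leNgt mx.
move: (x1); rewrite le_eqVlt => /predU1P[->|x1']; first by rewrite N1 y1 mulr0.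
(* [S] may jump at [x], so [c] is compared with [S u] for [u] slightly above [x]. The tail score at
   [x] exceeds [S u * y u] by at most [K x * (y x - y u)], and continuity of [y] makes the error
   smaller than [e]. *)
rewrite -subr_le0; apply/ler_addgt0Pl => e e0; rewrite addr0.
have xT : type01 x by rewrite /type01/= in_itv/= x0.
have D0 : 0 < `|K x - c| + 1 by rewrite ltr_wpDl.
have [del del0 hdel] := lowest_prob_cont (cdf_cont hf f_cont) n xT (divr_gt0 e0 D0).
pose u := Num.min 1 (x + del / 2).
have xu : x < u by rewrite lt_min x1' ltrDl divr_gt0.
have u1 : u <= 1 by rewrite ge_min lexx.
have u0 : 0 <= u by rewrite (le_trans x0)// ltW.
have ud : u - x < del.
  have : u <= x + del / 2 by rewrite ge_min lexx orbT.
  by move: del0; lra.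
have := hdel u; rewrite /type01/= in_itv/= u0 u1 => /(_ isT).
rewrite (ger0_norm (_ : 0 <= u - x)) ?subr_ge0 ?(ltW xu)// => /(_ ud).
have yy := ydecr x0 xu u1.
rewrite ltr0_norm ?subr_lt0// opprB ler_pdivlMr// => hy.
have /andP[_ h1] := incr i x0 (ltW xu) u1.
have h2 : S u * y u = N i u by apply: equilibrium_scoreE; rewrite u0.
have yu0 : 0 <= y u.
  move: u1; rewrite le_eqVlt => /predU1P[->|u1]; first by rewrite y1.
  by rewrite ltW// ygt0// u0.
have h3 : S u * y u <= c * y u.
  by rewrite ler_wpM2r// ltW// xlo// u0.
have h4 : (K x - c) * (y x - y u) <= (y x - y u) * (`|K x - c| + 1).
  rewrite mulrC ler_wpM2l// ?subr_ge0 ?(ltW yy)//.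
  by rewrite (le_trans (ler_norm _))// lerDl.
lra.
Qed.

Lemma equilibrium_gain i t (g : n.-tuple R -> R) : 0 <= t <= 1 ->
  Pn.-integrable C (EFin \o g) ->
  (forall th, C th -> S (rival i th) < S t -> g th = 1) ->
  (forall th, C th -> S t < S (rival i th) -> g th = 0) ->
  (forall th, C th -> 0 <= g th <= 1) ->
  (K t - S t) * \int[Pn]_(th in C) g th = H i (K t).
Proof.
move=> t01 ig g1 g0 g01.
have rT th : C th -> 0 <= rival i th <= 1.
  by move=> cth; have := rival01 hn i cth; rewrite /type01/= in_itv.
rewrite (winning_prob (i := i) t01)//; last 2 first.
- move=> th cth tr; apply: g1 => //; have /andP[_ r1] := rT th cth.
  by case/andP: t01 => t0 _; exact: equilibrium_score_decr.
- move=> th cth tr; apply: g0 => //; have /andP[r0 _] := rT th cth.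
  by case/andP: t01 => _ t1; exact: equilibrium_score_decr.
rewrite mulrBl (equilibrium_scoreE i)//.
exact: (tail_score_gain_eq hn hPn hf K_antitone i t01).
Qed.

End equilibrium_score.

(** * Envelope formula and information rents *)

Section measurable_composition.
Context d (T : measurableType d) {R : realType}.

Lemma cont_measurable (D : set R) (g : R -> R) : measurable D ->
  (forall x : R, D x -> cont_at D g x) -> measurable_fun D g.
Proof.
move=> mD cg; apply: subspace_continuous_measurable_fun => //.
by apply/subspace_continuousP => x Dx; apply/cont_atP; exact: cg.
Qed.

(* Monotonicity and continuity in [q] reduce [c < C (a x) (b x)] to a countable
   union over rational lower approximations of [a x]. *)
Lemma measurable_fun_cost (D : set T) (C : R -> R -> R) (a b : T -> R) :
  measurable D -> measurable_fun D a -> measurable_fun D b ->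
  (forall x, D x -> 0 <= a x) -> (forall x, D x -> type01 (b x)) ->
  (forall p q t : R, 0 <= p -> p <= q -> type01 t -> C p t <= C q t) ->
  (forall q t : R, 0 <= q -> type01 t -> cont_at quality (C ^~ t) q) ->
  (forall q : R, 0 <= q -> measurable_fun type01 (C q)) ->
  measurable_fun D (fun x => C (a x) (b x)).
Proof.
move=> mD ma mb a0 b01 Cm Cc mC _.
apply: (measurability _ (RGenOInfty.measurableE R)) => //.
move=> /= _ [_ [c ->] <-].
rewrite [X in measurable X](_ : _ = \bigcup_(r : rat)
    if 0 <= ratr r :> R then (D `&` [set x | ratr r <= a x]) `&`
      (D `&` b @^-1` (type01 `&` [set t | c < C (ratr r) t])) else set0).
  apply: bigcupT_measurable_rat => r; case: ifPn => // r0.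
  apply: measurableI.
    have := ma mD _ (measurable_itv `[ratr r, +oo[).
    by congr measurable; apply/seteqP; split => x [Dx]; rewrite /= ?in_itv/= ?andbT => h;
      split => //=; rewrite ?in_itv/= ?andbT.
  apply: mb => //; have := mC _ r0 (measurable_itv _) _ (measurable_itv `]c, +oo[).
  congr measurable; apply/seteqP; split => t [tt] /=; rewrite ?in_itv/= ?andbT => h;
    by split => //=; rewrite ?in_itv/= ?andbT.
apply/seteqP; split => [x [Dx]|x [r _]] /=; rewrite ?in_itv/= ?andbT; last first.
  case: ifPn => // r0 [[Dx rx] [_ [bx cr]]]; split => //.
  exact: lt_le_trans (Cm _ _ _ r0 rx bx).
move=> cC; have ax := a0 _ Dx; have bx := b01 _ Dx.
move: ax; rewrite le_eqVlt => /predU1P[ax|ax].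
  (* At [a x = 0] there is no smaller quality to approximate from, but 0 is itself rational. *)
  exists 0%Q => //; rewrite raddf0 lexx; split; first by split => //=; rewrite -ax.
  by split=> //=; rewrite ax.
have e0 : 0 < (C (a x) (b x) - c) / 2 by rewrite divr_gt0// subr_gt0.
have [del del0 hdel] := Cc _ _ (ltW ax) bx _ e0.
pose l := Num.max 0 (a x - del).
have la : l < a x by rewrite gt_max ax ltrBlDr ltrDl.
have [r] := rat_in_itvoo la; rewrite in_itv/= => /andP[lr ra].
have r0 : 0 <= ratr r :> R.
  by apply: ltW; apply: le_lt_trans lr; rewrite le_max lexx.
exists r => //; rewrite r0; split; first by split => //=; exact: ltW.
split => //=; split => //=.
have : `|C (ratr r) (b x) - C (a x) (b x)| <= (C (a x) (b x) - c) / 2.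
  apply: hdel; first by rewrite /quality/= in_itv/= r0.
  rewrite ltr0_norm ?subr_lt0// opprB ltrBlDr addrC -ltrBlDr.
  by apply: le_lt_trans lr; rewrite le_max lexx orbT.
by move=> /ler_normlP[h _]; lra.
Qed.

End measurable_composition.

(** * Translation and telescoping of integrals *)

Section translation.
Context {R : realType}.
Local Notation mu := (@lebesgue_measure R).
Local Open Scope ereal_scope.

Lemma lebesgue_integral_translation (h a b : R) (g : R -> \bar R) :
  measurable_fun setT g -> (forall x : R, 0 <= g x) ->
  \int[mu]_(x in `[(a + h)%R, (b + h)%R]) g (x - h)%R = \int[mu]_(x in `[a, b]) g x.
Proof.
move=> mg g0.
pose sh : measurableTypeR R -> measurableTypeR R := fun x => (x - h)%R.
have msh : measurable_fun setT sh.
  by apply: (measurable_funB (f := fun x => x : R)) => //.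
have shE A : measurable A -> mu A = pushforward mu sh A.
  apply: lebesgue_measure_unique => _ [[u v] _ <-].
  have e : pushforward mu sh `]u, v]%classic = mu `](u + h)%R, (v + h)%R]%classic.
    rewrite /pushforward; congr (mu _); apply/seteqP; split => x;
      by rewrite /= !in_itv/= /sh ltrBrDr lerBlDr.
  apply/esym; apply: (etrans e).
  rewrite !lebesgue_measure_itv/= !lte_fin ltrD2r; case: ifP => // _.
  by rewrite -!EFinD opprD addrACA subrr addr0.
transitivity (\int[pushforward mu sh]_(x in `[a, b]) g x); last first.
  by apply: eq_measure_integral => // *; exact/esym/shE.
rewrite ge0_integral_pushforward//; last exact: measurable_funTS.
rewrite [X in _ = \int[_]_(x in X) _](_ : _ = `[(a + h)%R, (b + h)%R]%classic)//.
by apply/seteqP; split => x; rewrite /= !in_itv/= /sh lerBrDr lerBlDr.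
Qed.

End translation.

Section shifts.
Context {R : realType}.
Local Notation mu := (@lebesgue_measure R).
Variable p : R -> R.
Hypothesis p_antitone : forall u v : R, u <= v -> p v <= p u.
Hypothesis p_ge0 : forall u : R, 0 <= p u.
Local Open Scope ereal_scope.

Let mp : measurable_fun setT p.
Proof. by apply: nonincreasing_measurable => // u v uv; exact: p_antitone. Qed.

Let mpE D : measurable_fun D (EFin \o p).
Proof. by apply/measurable_EFinP; exact: measurable_funTS. Qed.

Let p0 x : 0 <= (p x)%:E. Proof. by rewrite lee_fin. Qed.

Let integral_fin (a b : R) : (\int[mu]_(x in `[a, b]) (p x)%:E) \is a fin_num.
Proof.
rewrite ge0_fin_numE; last by apply: integral_ge0.
apply: (@le_lt_trans _ _ (\int[mu]_(x in `[a, b]) (p a)%:E)).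
  apply: ge0_le_integral => //; first exact: mpE.
  by move=> x; rewrite /= in_itv/= => /andP[ax _]; rewrite lee_fin p_antitone.
rewrite integral_cst//= lebesgue_measure_itv/=.
by case: ifP => _; rewrite ?mule0 ?ltry// -EFinB -EFinM ltry.
Qed.

Let mshift (h : R) (D : set R) : measurable_fun D (fun x : R => p (x - h)%R).
Proof.
apply: measurable_funTS; apply: measurableT_comp => //.
by apply: (measurable_funB (f := fun x => x : R)).
Qed.

Let mshiftD (h : R) (D : set R) : measurable_fun D (fun x : R => p (x + h)%R).
Proof.
rewrite (_ : (fun x => _) = (fun x : R => p (x - - h)%R)); first exact: mshift.
by apply/funext => x; rewrite opprK.
Qed.

(** By translation the integral is that of [p] over [[t, t + h]] less that over [[1 - h, 1]], and
    the latter is nonnegative. The finite [J] is added on both sides so that only nonnegative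
    functions are split. *)
Lemma shift_increment_le (h t : R) : (0 < h)%R -> (t + h <= 1)%R ->
  \int[mu]_(x in `[(t + h)%R, 1%R]) (p (x - h) - p x)%:E <= (h * p t)%:E.
Proof.
move=> h0 th1; set J := \int[mu]_(x in `[(t + h)%R, 1%R]) (p x)%:E.
have Jfin : J \is a fin_num by exact: integral_fin.
rewrite -(leeD2rE _ _ Jfin) -ge0_integralD//; last 3 first.
- by move=> x _; rewrite lee_fin subr_ge0; apply: p_antitone; rewrite gerBl ltW.
- by apply/measurable_EFinP; apply: measurable_funB; [exact: mshift|exact: measurable_funTS].
- exact: mpE.
under eq_integral do rewrite -EFinD subrK.
have -> : `[(t + h)%R, 1%R]%classic = `[(t + h)%R, ((1 - h) + h)%R]%classic :> set R.
  by rewrite subrK.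
rewrite (lebesgue_integral_translation h t (1 - h) (@mpE setT) p0).
apply: (@le_trans _ _ (\int[mu]_(x in `[t, 1%R]) (p x)%:E)).
  apply: ge0_subset_integral => //; [exact: mpE|by move=> x _; exact: p0|].
  by apply: subset_itv; rewrite bnd_simp// gerBl ltW.
have -> : `[t, 1%R]%classic = `[t, (t + h)%R]%classic `|` `](t + h)%R, 1%R]%classic :> set R.
  by rewrite -itv_bndbnd_setU// bnd_simp// lerDl ltW.
rewrite ge0_integral_setU//; last first.
  rewrite disj_set2E; apply/eqP/seteqP; split => // x [] /=.
  by rewrite !in_itv/= => /andP[_ xt] /andP[tx _]; move: tx; rewrite ltNge xt.
  exact: mpE.
apply: leeD.
  apply: (@le_trans _ _ (\int[mu]_(x in `[t, (t + h)%R]) (p t)%:E)).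
    apply: ge0_le_integral => //; first exact: mpE.
    by move=> x; rewrite /= in_itv/= => /andP[tx _]; rewrite lee_fin p_antitone.
  rewrite integral_cst//= lebesgue_measure_itv/= lte_fin ltrDl h0.
  by rewrite -EFinB addrAC subrr add0r -EFinM mulrC.
apply: ge0_subset_integral => //; first exact: mpE.
by apply: subset_itv; rewrite bnd_simp.
Qed.

(** The same telescoping from below; the integral over [[1 - h, 1]] now has to be bounded, by
    [h * p (1 - h)]. *)
Lemma shift_increment_ge (h t : R) : (0 < h)%R -> (t + h <= 1)%R ->
  (h * p (t + h) - h * p (1 - h))%:E <=
  \int[mu]_(x in `[t, (1 - h)%R]) (p x - p (x + h))%:E.
Proof.
move=> h0 th1; set J := \int[mu]_(x in `[(t + h)%R, 1%R]) (p x)%:E.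
have Jfin : J \is a fin_num by exact: integral_fin.
set A := \int[mu]_(x in _) _.
have AJ : A + J = \int[mu]_(x in `[t, (1 - h)%R]) (p x)%:E.
  rewrite /J -(lebesgue_integral_translation (- h) (t + h) 1 (@mpE setT) p0) addrK.
  rewrite -ge0_integralD//; last 4 first.
  - by move=> x _; rewrite lee_fin subr_ge0; apply: p_antitone; rewrite lerDl ltW.
  - apply/measurable_EFinP; apply: measurable_funB; first exact: measurable_funTS.
    exact: mshiftD.
  - by move=> x _; exact: p0.
  - by apply/measurable_EFinP; apply: mshift.
  by apply: eq_integral => x _; rewrite -EFinD opprK subrK.
rewrite EFinB leeBlDr// -(leeD2rE _ _ Jfin) [leRHS]addeAC AJ.
have le1 : \int[mu]_(x in `[t, 1%R]) (p x)%:E <=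
    \int[mu]_(x in `[t, (1 - h)%R]) (p x)%:E + (h * p (1 - h))%:E.
  have -> : `[t, 1%R]%classic = `[t, (1 - h)%R]%classic `|` `](1 - h)%R, 1%R]%classic :> set R.
    by rewrite -itv_bndbnd_setU// bnd_simp// ?lerBrDr// gerBl ltW.
  rewrite ge0_integral_setU//; last first.
    rewrite disj_set2E; apply/eqP/seteqP; split => // x [] /=.
    by rewrite !in_itv/= => /andP[_ xt] /andP[tx _]; move: tx; rewrite ltNge xt.
    exact: mpE.
  apply: leeD2l.
  apply: (@le_trans _ _ (\int[mu]_(x in `](1 - h)%R, 1%R]) (p (1 - h))%:E)).
    apply: ge0_le_integral => //; first exact: mpE.
    by move=> x; rewrite /= in_itv/= => /andP[tx _]; rewrite lee_fin p_antitone// ltW.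
  rewrite integral_cst//= lebesgue_measure_itv/= lte_fin gtrBl h0.
  by rewrite -EFinB (_ : (1 - (1 - h) = h)%R) ?subKr// -EFinM mulrC.
apply: le_trans le1.
have -> : `[t, 1%R]%classic = `[t, (t + h)%R[%classic `|` `[(t + h)%R, 1%R]%classic :> set R.
  by rewrite -itv_bndbnd_setU// bnd_simp// lerDl ltW.
rewrite ge0_integral_setU//; last first.
  rewrite disj_set2E; apply/eqP/seteqP; split => // x [] /=.
  by rewrite !in_itv/= => /andP[_ xt] /andP[tx _]; move: xt; rewrite ltNge tx.
  exact: mpE.
apply: leeD2r.
apply: (@le_trans _ _ (\int[mu]_(x in `[t, (t + h)%R[) (p (t + h))%:E)).
  rewrite integral_cst//= lebesgue_measure_itv/= lte_fin ltrDl h0.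
  by rewrite -EFinB addrAC subrr add0r -EFinM mulrC.
apply: ge0_le_integral => //; first exact: mpE.
by move=> x; rewrite /= in_itv/= => /andP[_ tx]; rewrite lee_fin p_antitone// ltW.
Qed.

End shifts.

(** * The envelope formula *)

Section envelope.
Context {R : realType}.
Local Notation mu := (@lebesgue_measure R).
(* [p x] is the equilibrium payoff of type [x], [c x u] the cost to type [u] of
   the equilibrium action of type [x]. *)
Variables (p : R -> R) (c : R -> R -> R) (g : R -> R).
Hypothesis p_antitone : forall u v : R, u <= v -> p v <= p u.
Hypothesis p_ge0 : forall u : R, 0 <= p u.
Hypothesis c_mono : forall x u v : R, type01 x -> 0 <= u -> u <= v -> v <= 1 ->
  c x u <= c x v.
Hypothesis c_slope : forall x, type01 x -> slope_at type01 (c x) x (g x).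
Hypothesis mc : forall (h : R) (D : set R), measurable D -> D `<=` type01 ->
  (forall x, D x -> type01 (x + h)) -> measurable_fun D (fun x => c x (x + h)).

Let T01 (x : R) : 0 <= x -> x <= 1 -> type01 x.
Proof. by move=> x0 x1; rewrite /type01/= in_itv/= x0. Qed.

Let step (k : nat) : R := k.+1%:R^-1.

Let step_gt0 (k : nat) : 0 < step k. Proof. by rewrite invr_gt0. Qed.

Let step_small (e : R) : 0 < e -> \forall k \near \oo, step k < e.
Proof. by move=> e0; exact: (near_infty_natSinv_lt (PosNum e0)). Qed.

Let quotient_cvg (f : nat -> R -> R) (s x : R) : type01 x -> `|s| = 1 ->
  (\forall k \near \oo, type01 (x + s * step k) /\
     f k x = s * (step k)^-1 * (c x (x + s * step k) - c x x)) ->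
  f k x @[k --> \oo] --> g x.
Proof.
move=> xT s1 hf; apply/cvgrPdist_le => e e0.
have [del del0 hdel] := c_slope xT e0.
near=> k.
have [yT ->] : type01 (x + s * step k) /\
     f k x = s * (step k)^-1 * (c x (x + s * step k) - c x x) by near: k.
have kd : step k < del by near: k; exact: step_small.
have ss : s * s = 1.
  by move/eqP: s1; rewrite eqr_norml => /andP[/orP[]/eqP-> _]; ring.
have dE : x + s * step k - x = s * step k by rewrite addrAC subrr add0r.
have := hdel _ yT; rewrite dE normrM s1 mul1r (gtr0_norm (step_gt0 k)) => /(_ kd).
have e2 : s * (step k)^-1 * (s * step k) = 1.
  by rewrite mulrACA ss mulVf ?mul1r// gt_eqF.
have -> : g x - s * (step k)^-1 * (c x (x + s * step k) - c x x) =
   - (s * (step k)^-1) * (c x (x + s * step k) - c x x - g x * (s * step k)).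
  by rewrite -[X in X - _](mulr1 (g x)) -e2; ring.
move=> h; rewrite normrM normrN normrM s1 mul1r normfV (gtr0_norm (step_gt0 k)).
by rewrite mulrC ler_pdivrMr.
Unshelve. all: by end_near. Qed.

Local Open Scope ereal_scope.

(** When the slightly lower type [x - step k] imitates [x], the left difference quotient of the cost
    is bounded by that of [p], whose integral telescopes to at most [p t]. Fatou's lemma passes to
    the limit with no regularity of [p] and no bound on the quotients. *)
Lemma envelope_lower :
  (forall u x : R, (0 <= u)%R -> (u <= x)%R -> (x <= 1)%R ->
     (c x x - c x u <= p u - p x)%R) ->
  forall t : R, type01 t -> \int[mu]_(x in `]t, 1%R]) (g x)%:E <= (p t)%:E.
Proof.
move=> IC t; rewrite /type01/= in_itv/= => /andP[t0 t1].
pose A k := `[(t + step k)%R, 1%R]%classic : set R.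
pose F k x := ((step k)^-1 * (c x x - c x (x - step k)))%R.
pose f k : R -> \bar R := (EFin \o F k) \_ (A k).
have AT k x : A k x -> type01 x /\ type01 (x + - step k)%R.
  rewrite /A/= in_itv/= => /andP[tx x1]; have s0 := step_gt0 k.
  by split; apply: T01 => //; move: tx x1 t0 s0; lra.
have mF k : measurable_fun (A k) (F k).
  apply: measurable_funM => //; apply: measurable_funB.
    have := mc (h := 0) (D := A k) (measurable_itv _).
    under eq_fun do rewrite addr0.
    by apply; move=> x /AT[]; rewrite ?addr0.
  apply: (mc (h := - step k)%R) => //; first exact: measurable_itv.
    by move=> x /AT[].
  by move=> x /AT[].
have F0 k x : A k x -> (0 <= F k x)%R.
  move=> Ax; have [xT yT] := AT _ _ Ax.
  rewrite /F mulr_ge0 ?invr_ge0 ?(ltW (step_gt0 k))// subr_ge0.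
  move: xT yT; rewrite /type01/= !in_itv/= => /andP[x0 x1] /andP[y0 y1].
  by apply: c_mono => //; [exact: T01|rewrite gerBl ltW].
have mf k : measurable_fun `]t, 1%R] (f k).
  apply: measurable_funTS; apply/(measurable_restrictT _ (measurable_itv _)).
  by apply/measurable_EFinP; exact: mF.
have f0 k x : 0 <= f k x.
  by rewrite /f patchE; case: ifPn => //; rewrite inE => /F0; rewrite lee_fin.
have fle k : \int[mu]_(x in `]t, 1%R]) f k x <= (p t)%:E.
  rewrite /f -integral_mkcondr.
  have [ts|ts] := leP (t + step k)%R 1%R; last first.
    rewrite (_ : _ `&` _ = set0) ?integral_set0 ?lee_fin//.
    apply/seteqP; split => // x [_]; rewrite /A/= in_itv/= => /andP[h1 h2].
    by have := le_trans h1 h2; rewrite leNgt ts.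
  rewrite setIidr; last first.
    by apply: subset_itv; rewrite bnd_simp// ltrDl.
  apply: (@le_trans _ _ (\int[mu]_(x in A k)
      ((step k)^-1%:E * (p (x - step k) - p x)%:E))).
    apply: ge0_le_integral => //.
    - exact: measurable_itv.
    - by move=> x /F0; rewrite lee_fin.
    - by apply/measurable_EFinP; exact: mF.
    - apply/measurable_EFinP; apply: measurable_funM => //; apply: measurable_funB.
        apply: measurable_funTS; apply: measurableT_comp.
          by apply: nonincreasing_measurable => // u v uv; exact: p_antitone.
        by apply: (measurable_funB (f := fun x => x : R)).
      apply: measurable_funTS.
      by apply: nonincreasing_measurable => // u v uv; exact: p_antitone.
    - move=> x Ax; have [xT yT] := AT _ _ Ax.
      rewrite lee_fin /F ler_wpM2l ?invr_ge0 ?(ltW (step_gt0 k))//.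
      move: xT yT; rewrite /type01/= !in_itv/= => /andP[x0 x1] /andP[y0 y1].
      by apply: IC => //; rewrite gerBl ltW.
  rewrite ge0_integralZl//=; last 4 first.
  - exact: measurable_itv.
  - apply/measurable_EFinP; apply: measurable_funB.
      apply: measurable_funTS; apply: measurableT_comp.
        by apply: nonincreasing_measurable => // u v uv; exact: p_antitone.
      by apply: (measurable_funB (f := fun x => x : R)).
    apply: measurable_funTS.
    by apply: nonincreasing_measurable => // u v uv; exact: p_antitone.
  - by move=> x _; rewrite lee_fin subr_ge0 p_antitone// gerBl ltW.
  - by rewrite lee_fin invr_ge0 ltW.
  have := shift_increment_le p_antitone p_ge0 (step_gt0 k) ts.
  move=> /(lee_wpmul2l _) h; apply: (le_trans (h (step k)^-1%:E _)).
    by rewrite lee_fin invr_ge0 ltW.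
  by rewrite -EFinM mulKf// gt_eqF.
apply: (@le_trans _ _ (limn_einf (fun k => \int[mu]_(x in `]t, 1%R]) f k x))); last first.
  rewrite limn_einf_lim; apply: lime_le; first exact: is_cvg_einfs.
  apply: nearW => k; apply: le_trans (fle k).
  by apply: ereal_inf_lbound; exists k => /=.
have mD : measurable (`]t, 1%R]%classic : set (measurableTypeR R)).
  exact: measurable_itv.
have := @fatou _ _ _ mu _ mD f mf (fun k x _ => f0 k x); apply: le_trans.
rewrite le_eqVlt; apply/orP; left; apply/eqP; apply: eq_integral => x.
rewrite inE/= in_itv/= => /andP[tx x1].
have xT : type01 x by apply: T01 => //; rewrite (le_trans t0)// ltW.
apply/esym; apply: (cvg_limn_einf_sup _).1.
have near_f : \forall k \near \oo, f k x = (F k x)%:E.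
  have tx' : (0 < x - t)%R by rewrite subr_gt0.
  near=> k; rewrite /f patchE ifT// inE /A/= in_itv/= x1 andbT -lerBrDl ltW//.
  by near: k; exact: step_small.
apply: (cvg_trans (near_eq_cvg (f := fun k => (F k x)%:E) _)).
  by near=> k; apply/esym; near: k.
apply: cvg_EFin; first exact: nearW.
apply: (@quotient_cvg F (-1)%R) => //; first by rewrite normrN normr1.
have tx' : (0 < x - t)%R by rewrite subr_gt0.
near=> k; have kt : (step k < x - t)%R by near: k; exact: step_small.
have s0 := step_gt0 k.
rewrite mulN1r; split; first by apply: T01; move: tx x1 t0 s0 kt; lra.
by rewrite /F mulN1r mulNr -mulrN opprB.
Unshelve. all: by end_near. Qed.

(** When the slightly higher type [x + step k] imitates [x], the right quotients of the cost are
    bounded below by those of [p]. Fatou's lemma would point the wrong way; the Lipschitz constant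
    [L] dominates the quotients instead. *)
Lemma envelope_upper (L : R) : measurable_fun type01 g ->
  (forall x u : R, (0 <= x)%R -> (x <= u)%R -> (u <= 1)%R ->
     (p x - p u <= c x u - c x x)%R) ->
  (forall x u : R, (0 <= x)%R -> (x <= u)%R -> (u <= 1)%R ->
     (c x u - c x x <= L * (u - x))%R) ->
  p 1 = 0%R ->
  forall t : R, type01 t -> (p t)%:E <= \int[mu]_(x in `]t, 1%R]) (g x)%:E.
Proof.
move=> mg IC Lip p1 t tT; move: (tT); rewrite /type01/= in_itv/= => /andP[t0 t1].
have g0 x : type01 x -> (0 <= g x)%R.
  move=> xT; apply: (slope_ge0 (type01_limit xT) _ xT (c_slope xT)) => u v.
  rewrite /type01/= !in_itv/= => /andP[u0 u1] /andP[v0 v1] uv.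
  exact: c_mono.
move: t1; rewrite le_eqVlt => /predU1P[->|t1].
  rewrite p1; apply: integral_ge0 => x; rewrite /= in_itv/= => /andP[x1 x1'].
  by move: x1; rewrite ltNge x1'.
have L0 : (0 <= L)%R.
  have h1 := Lip 0%R 1%R (lexx _) ler01 (lexx _).
  have h2 := c_mono (T01 (lexx 0%R) ler01) (lexx 0%R) ler01 (lexx 1%R).
  by move: h1 h2; rewrite subr0 mulr1; lra.
pose D := `[t, 1%R[%classic : set (measurableTypeR R).
have mD : measurable D by exact: measurable_itv.
pose A k := `[t, (1 - step k)%R]%classic : set R.
pose F k x := ((step k)^-1 * (c x (x + step k) - c x x))%R.
pose f k : R -> \bar R := (EFin \o F k) \_ (A k).
have AT k x : A k x -> type01 x /\ type01 (x + step k)%R.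
  rewrite /A/= in_itv/= => /andP[tx x1]; have s0 := step_gt0 k.
  by split; apply: T01 => //; move: tx x1 t0 s0; lra.
have mF k : measurable_fun (A k) (F k).
  apply: measurable_funM => //; apply: measurable_funB.
    by apply: mc => //; [exact: measurable_itv|move=> x /AT[]|move=> x /AT[]].
  have := mc (h := 0) (D := A k) (measurable_itv _).
  under eq_fun do rewrite addr0.
  by apply; move=> x /AT[]; rewrite ?addr0.
have FB k x : A k x -> (0 <= F k x <= L)%R.
  move=> Ax; have [xT yT] := AT _ _ Ax.
  move: (xT) yT; rewrite /type01/= !in_itv/= => /andP[x0 x1] /andP[y0 y1].
  have xs : (x <= x + step k)%R by rewrite lerDl ltW.
  apply/andP; split.
    rewrite /F mulr_ge0 ?invr_ge0 ?(ltW (step_gt0 k))// subr_ge0.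
    exact: c_mono.
  rewrite /F mulrC ler_pdivrMr//; have := Lip _ _ x0 xs y1.
  by rewrite addrAC subrr add0r.
have mf k : measurable_fun D (f k).
  apply: measurable_funTS; apply/(measurable_restrictT _ (measurable_itv _)).
  by apply/measurable_EFinP; exact: mF.
have mgD : measurable_fun D (EFin \o g).
  apply/measurable_EFinP; apply: measurable_funS mg; first exact: measurable_itv.
  by apply: subset_itv; rewrite bnd_simp.
(* The loss [2 * L * step k] covers the two ends: [p] falls by at most [L * step k] from [t] to
   [t + step k], and [p (1 - step k)] is at most [L * step k] because [p 1 = 0]. *)
have fle k : (t + step k <= 1)%R ->
    (p t - 2 * L * step k)%:E <= \int[mu]_(x in D) f k x.
  move=> ts; rewrite /f -integral_mkcondr setIidr; last first.
    by apply: subset_itv; rewrite bnd_simp// gtrBl.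
  apply: (@le_trans _ _ (\int[mu]_(x in A k)
      ((step k)^-1%:E * (p x - p (x + step k))%:E))); last first.
    apply: ge0_le_integral => //.
    - exact: measurable_itv.
    - move=> x _; rewrite mule_ge0// ?lee_fin ?invr_ge0 ?(ltW (step_gt0 k))//.
      by rewrite subr_ge0 p_antitone// lerDl ltW.
    - apply/measurable_EFinP; apply: measurable_funM => //; apply: measurable_funB.
        apply: measurable_funTS.
        by apply: nonincreasing_measurable => // u v uv; exact: p_antitone.
      apply: measurable_funTS; apply: measurableT_comp.
        by apply: nonincreasing_measurable => // u v uv; exact: p_antitone.
      by apply: (measurable_funD (f := fun x => x : R)).
    - by apply/measurable_EFinP; exact: mF.
    - move=> x Ax; have [xT yT] := AT _ _ Ax.
      rewrite lee_fin /F ler_wpM2l ?invr_ge0 ?(ltW (step_gt0 k))//.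
      move: xT yT; rewrite /type01/= !in_itv/= => /andP[x0 x1] /andP[y0 y1].
      by apply: IC => //; rewrite lerDl ltW.
  rewrite ge0_integralZl//=; last 4 first.
  - exact: measurable_itv.
  - apply/measurable_EFinP; apply: measurable_funB.
      apply: measurable_funTS.
      by apply: nonincreasing_measurable => // u v uv; exact: p_antitone.
    apply: measurable_funTS; apply: measurableT_comp.
      by apply: nonincreasing_measurable => // u v uv; exact: p_antitone.
    by apply: (measurable_funD (f := fun x => x : R)).
  - by move=> x _; rewrite lee_fin subr_ge0 p_antitone// lerDl ltW.
  - by rewrite lee_fin invr_ge0 ltW.
  have := shift_increment_ge p_antitone p_ge0 (step_gt0 k) ts.
  move=> /(lee_wpmul2l _) h; apply: (le_trans _ (h (step k)^-1%:E _)); last first.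
    by rewrite lee_fin invr_ge0 ltW.
  rewrite -EFinM lee_fin -mulrBr mulKf ?gt_eqF//.
  have s0 := step_gt0 k.
  have st : (t <= t + step k)%R by rewrite lerDl ltW.
  have s1 : (1 - step k <= 1)%R by rewrite gerBl ltW.
  have s1' : (0 <= 1 - step k)%R by move: ts t0; lra.
  have h1 := IC _ _ t0 st ts; have h2 := Lip _ _ t0 st ts.
  have h3 := IC _ _ s1' s1 (lexx _); have h4 := Lip _ _ s1' s1 (lexx _).
  by move: h1 h2 h3 h4; rewrite p1; lra.
have cvf : \int[mu]_(x in D) f k x @[k --> \oo] --> \int[mu]_(x in D) (g x)%:E.
  have iL : mu.-integrable D (cst L%:E).
    apply/integrableP; split => //.
    rewrite (eq_integral (fun=> L%:E)); last first.
      by move=> x _; rewrite /= ger0_norm.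
    rewrite integral_cst//.
    have muD : mu D = (1 - t)%:E.
      by apply: (etrans (lebesgue_measure_itv _)); rewrite /= lte_fin t1 -EFinB.
    apply: lte_mul_pinfty => //; apply: (le_lt_trans (_ : _ <= (1 - t)%:E)).
      by rewrite le_eqVlt; apply/orP; left; apply/eqP; exact: muD.
    by rewrite ltry.
  have [||_ _ //] := @dominated_convergence _ _ _ mu D mD f (EFin \o g) (cst L%:E) mf mgD _ iL.
  - apply: aeW => x; rewrite /D/= in_itv/= => /andP[tx x1].
    have xT : type01 x by apply: T01; [exact: le_trans tx|exact: ltW].
    have near_f : \forall k \near \oo, f k x = (F k x)%:E.
      have tx' : (0 < 1 - x)%R by rewrite subr_gt0.
      near=> k; rewrite /f patchE ifT// inE /A/= in_itv/= tx/= lerBrDl -lerBrDr ltW//.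
      by near: k; exact: step_small.
    apply: (cvg_trans (near_eq_cvg (f := fun k => (F k x)%:E) _)).
      by near=> k; apply/esym; near: k.
    apply: cvg_EFin; first exact: nearW.
    apply: (@quotient_cvg F 1%R) => //; first by rewrite normr1.
    have tx' : (0 < 1 - x)%R by rewrite subr_gt0.
    near=> k; have kt : (step k < 1 - x)%R by near: k; exact: step_small.
    have s0 := step_gt0 k.
    rewrite !mul1r; split => //.
    by apply: T01; move: tx x1 t0 s0 kt; lra.
  - apply: aeW => x k Dx; rewrite /f patchE; case: ifPn => [|_].
      rewrite inE => /FB/andP[F0 FL].
      by rewrite /= lee_fin ger0_norm.
    by rewrite abse0 lee_fin.
apply: (@le_trans _ _ (\int[mu]_(x in D) (g x)%:E)).
  apply/lee_addgt0Pr => e e0; rewrite -leeBlDr// -EFinB.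
  apply: (@cvge_ge _ _ _ _ _ _ _ _ cvf).
  have e1 : (0 < e / (2 * L + 1))%R by rewrite divr_gt0// ltr_wpDl// mulr_ge0.
  have tx' : (0 < 1 - t)%R by rewrite subr_gt0.
  near=> k.
  have ks : (step k < e / (2 * L + 1))%R by near: k; exact: step_small.
  have kt : (step k < 1 - t)%R by near: k; exact: step_small.
  apply: le_trans (fle k _); last by move: kt; lra.
  rewrite lee_fin lerD2l lerN2; move: ks.
  rewrite ltr_pdivlMr ?ltr_wpDl ?mulr_ge0// mulrDr mulr1 => ks.
  by have := step_gt0 k; move: ks; lra.
rewrite integral_itv_obnd_cbnd; last first.
  apply/measurable_EFinP; apply: measurable_funS mg; first exact: measurable_itv.
  by apply: subset_itv; rewrite bnd_simp.
have mD' : measurable (`[t, 1%R]%classic : set (measurableTypeR R)).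
  exact: measurable_itv.
apply: (@ge0_subset_integral _ _ _ mu D `[t, 1%R]%classic mD mD' (EFin \o g)).
- apply/measurable_EFinP; apply: measurable_funS mg; first exact: measurable_itv.
  by apply: subset_itv; rewrite bnd_simp.
- move=> x; rewrite /= in_itv/= => /andP[tx x1]; rewrite lee_fin g0//.
  by apply: T01 => //; exact: le_trans tx.
- by apply: subset_itv; rewrite bnd_simp.
Unshelve. all: by end_near. Qed.

End envelope.

(** * Expected information rents *)

Section information_rent.
Context {R : realType} (P : probability R R) (f : R -> R).
Hypothesis hf : has_density01 P f.
Hypothesis f_cont : forall t : R, type01 t -> cont_at type01 f t.
Local Notation F := (type_cdf P).
Local Notation mu := (@lebesgue_measure R).

Lemma measurable_hazard : measurable_fun type01 (fun t : R => F t / f t).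
Proof.
apply: cont_measurable => [|t tT]; first exact: measurable_itv.
have [_ f0 _] := hf; apply/cont_atP; apply: cvgM.
  by apply/cont_atP; exact: cdf_cont hf f_cont _ tT.
apply: cvgV; first by rewrite gt_eqF// f0.
by apply/cont_atP; exact: f_cont.
Qed.

Local Open Scope ereal_scope.

Let prob_below (x : R) : type01 x -> P `[0%R, x]%classic = (F x)%:E.
Proof.
move=> xT; have [_ _ PE] := hf.
rewrite /type_cdf fineK ?fin_num_measure//.
rewrite !PE; try exact: measurable_itv.
congr (\int[mu]_(_ in _) _); apply/seteqP; split => z [].
  by rewrite /= !in_itv/= => /andP[z0 zx] z1.
by rewrite /= !in_itv/= => zx /andP[z0 z1]; split; rewrite ?z1//; apply/andP; split.
Qed.

Section rent.
Variable g : R -> R.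
Hypothesis mg : measurable_fun type01 g.
Hypothesis g0 : forall t : R, type01 t -> (0 <= g t)%R.

Let g' : R -> \bar R := (EFin \o g) \_ type01.
Let b (x : R * R) : bool := ((0 <= x.1) && (x.1 <= x.2))%R.
Let G (x : R * R) : \bar R := g' x.2 * ((b x)%:R)%:E.

Let mT : measurable (@type01 R). Proof. exact: measurable_itv. Qed.

Let g'0 x : 0 <= g' x.
Proof. by rewrite /g' patchE; case: ifPn => //; rewrite inE => /g0; rewrite lee_fin. Qed.

Let mg' : measurable_fun setT g'.
Proof. by apply/(measurable_restrictT _ mT); apply/measurable_EFinP. Qed.

Let mb : measurable_fun setT b.
Proof. by apply: measurable_and; apply: measurable_fun_ler. Qed.

Let mG : measurable_fun setT G.
Proof.
apply: emeasurable_funM; first exact: measurableT_comp.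
by apply/measurable_EFinP; exact: measurable_natbool.
Qed.

Let G0 x : 0 <= G x. Proof. by rewrite mule_ge0. Qed.

Let rentE t : type01 t -> \int[mu]_(x in `]t, 1%R]) (g x)%:E = \int[mu]_x G (t, x).
Proof.
rewrite /type01/= in_itv/= => /andP[t0 t1].
rewrite integral_itv_obnd_cbnd; last first.
  apply/measurable_EFinP; apply: measurable_funS mg; first exact: mT.
  by apply: subset_itv; rewrite bnd_simp.
rewrite integral_mkcond; apply: eq_integral => x _.
rewrite /G /b /g' !patchE/= t0/=.
have [tx|xt] := leP t x.
  rewrite mule1; have [x1|x1] := leP x 1%R.
    by rewrite !mem_set// ?/type01/= in_itv/= ?tx ?x1// (le_trans t0 tx).
  by rewrite !memNset// ?/type01/= in_itv/= [(x <= 1)%R]leNgt x1 andbF.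
by rewrite mule0 memNset//= in_itv/= leNgt xt.
Qed.

Lemma measurable_rent_integral :
  measurable_fun type01 (fun t => \int[mu]_(x in `]t, 1%R]) (g x)%:E).
Proof.
apply: (eq_measurable_fun (fun t => \int[mu]_x G (t, x))).
  by move=> t; rewrite inE => tT; rewrite rentE.
apply: measurable_funTS; exact: measurable_fun_fubini_tonelli_F.
Qed.

(** After exchanging the integrals, [g x] is collected by all types below [x], which have
    probability [F x]; returning from Lebesgue measure to [P] divides by the density. *)
Lemma information_rent :
  \int[P]_(t in type01) \int[mu]_(x in `]t, 1%R]) (g x)%:E =
  \int[P]_(t in type01) (g t * F t / f t)%:E.
Proof.
have [mf f0 _] := hf.
transitivity (\int[P]_t \int[mu]_x G (t, x)).
  rewrite [RHS](integral_full_measure (D := type01))//; last 2 first.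
  - exact: P_type01 hf.
  - exact: measurable_fun_fubini_tonelli_F.
  by apply: eq_integral => t; rewrite inE => tT; rewrite rentE.
apply: (etrans (fubini_tonelli (m1 := P) (m2 := mu) G mG G0)).
rewrite (density_integral hf); last 2 first.
- apply/measurable_EFinP; under eq_fun do rewrite -mulrA.
  by apply: measurable_funM => //; exact: measurable_hazard.
- move=> t tT; rewrite lee_fin divr_ge0 ?(ltW (f0 _ tT))//.
  by rewrite mulr_ge0 ?g0// /type_cdf fine_ge0.
rewrite [RHS]integral_mkcond; apply: eq_integral => x _.
rewrite /G /= ge0_integralZl//=; last first.
  apply/measurable_EFinP; apply: measurable_natbool.
  by apply: measurableT_comp mb _; exact: measurable_pair2.
rewrite /g' !patchE; case: ifPn => [|_]; last by rewrite mul0e.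
rewrite inE => xT; rewrite /= -EFinM divfK ?gt_eqF ?f0//.
rewrite EFinM -(prob_below xT); congr (_ * _).
rewrite -[X in P X]setIT -integral_indic//.
by apply: eq_integral => t _; rewrite indicE mem_setE in_itv.
Qed.

End rent.

End information_rent.

Section measurable_costs.
Context {R : realType} (P : probability R R) (V f : R -> R) (CP CI : R -> R -> R).
Local Notation F := (type_cdf P).
Hypothesis hf : has_density01 P f.
Hypothesis hA : standing_assumptions V f F CP CI.
Local Notation vCP := (virtual F f CP).
Local Notation vCI := (virtual F f CI).

Lemma density_cont (t : R) : type01 t -> cont_at type01 f t.
Proof. by move=> tT; exact: slope_cont (derivable_in_slope (f_derivable hA tT)). Qed.

Let mT : measurable (@type01 R). Proof. exact: measurable_itv. Qed.

Context d (T : measurableType d) (D : set T) (a b : T -> R).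
Hypothesis mD : measurable D.
Hypothesis ma : measurable_fun D a.
Hypothesis mb : measurable_fun D b.
Hypothesis a0 : forall x, D x -> 0 <= a x.
Hypothesis b01 : forall x, D x -> type01 (b x).

Let mcost (C : R -> R -> R) :
  (forall p q t : R, 0 <= p -> p <= q -> type01 t -> C p t <= C q t) ->
  (forall q t : R, 0 <= q -> type01 t -> cont_at quality (C ^~ t) q) ->
  (forall q : R, 0 <= q -> measurable_fun type01 (C q)) ->
  measurable_fun D (fun x => C (a x) (b x)).
Proof. by move=> h1 h2 h3; exact: measurable_fun_cost. Qed.

Let mcont (g : R -> R) : (forall t, type01 t -> cont_at type01 g t) ->
  measurable_fun type01 g.
Proof. by move=> h; exact: cont_measurable. Qed.

Lemma measurable_value : measurable_fun D (fun x => V (a x)).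
Proof.
apply: (mcost (C := fun q _ => V q)) => // [p q t p0 pq _|q t q0 _].
  by apply: (V_mono hA).
by apply: slope_cont (derivable_in_slope (V_derivable hA _)); rewrite /quality/= in_itv/= q0.
Qed.

Lemma measurable_CP : measurable_fun D (fun x => CP (a x) (b x)).
Proof.
apply: mcost => [p q t|q t q0 tT|q q0]; first exact: (CP_mono_q hA).
  exact: slope_cont (CP_slope_q hA q0 tT).
by apply: mcont => t tT; exact: slope_cont (CP_slope_t hA q0 tT).
Qed.

Lemma measurable_CI : measurable_fun D (fun x => CI (a x) (b x)).
Proof.
apply: mcost => [p q t|q t q0 tT|q q0]; first exact: (CI_mono_q hA).
  exact: slope_cont (CI_slope_q hA q0 tT).
by apply: mcont => t tT; exact: slope_cont (CI_slope_t hA q0 tT).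
Qed.

Lemma measurable_DtCP : measurable_fun D (fun x => Dt CP (a x) (b x)).
Proof.
apply: mcost => [p q t|q t q0 tT|q q0]; first exact: (CPt_mono_q hA).
  exact: (CPt_cont_q hA q0 tT).
by apply: mcont => t tT; exact: (CPt_cont_t hA q0 tT).
Qed.

Lemma measurable_DtCI : measurable_fun D (fun x => Dt CI (a x) (b x)).
Proof.
apply: mcost => [p q t|q t q0 tT|q q0]; first exact: (CIt_mono_q hA).
  exact: (CIt_cont_q hA q0 tT).
by apply: mcont => t tT; exact: (CIt_cont_t hA q0 tT).
Qed.

Let mhazard : measurable_fun D (fun x => F (b x) / f (b x)).
Proof.
apply: (measurable_comp mT _ (measurable_hazard hf density_cont) mb).
by move=> _ [x Dx <-]; exact: b01.
Qed.

Lemma measurable_vCP : measurable_fun D (fun x => vCP (a x) (b x)).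
Proof.
rewrite /virtual; apply: measurable_funD; first exact: measurable_CP.
under eq_fun do rewrite -mulrA.
by apply: measurable_funM => //; exact: measurable_DtCP.
Qed.

Lemma measurable_vCI : measurable_fun D (fun x => vCI (a x) (b x)).
Proof.
rewrite /virtual; apply: measurable_funD; first exact: measurable_CI.
under eq_fun do rewrite -mulrA.
by apply: measurable_funM => //; exact: measurable_DtCI.
Qed.

End measurable_costs.

Section interim.
Context {R : realType} {n : nat} (M : mechanism (R := R) n) (sg : strategy M).

Lemma messages_with_type i t th :
  messages sg (with_type i t th) = dfwith (messages sg th) i (sg i t).1.
Proof.
apply: functional_extensionality_dep => j; rewrite /messages with_typeE.
by case: dfwithP => [|k ik]; rewrite ?eqxx// eq_sym (negPf ik).
Qed.

Lemma qualities_with_type i t th :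
  qualities sg (with_type i t th) = dfwith (qualities sg th) i (sg i t).2.
Proof.
apply/funext => j; rewrite /qualities with_typeE.
by case: dfwithP => [|k ik]; rewrite ?eqxx// eq_sym (negPf ik).
Qed.

Lemma induced_alloc_with_type i t th :
  induced_alloc sg i (with_type i t th) = dev_alloc sg (sg i t).1 (sg i t).2 th.
Proof. by rewrite /induced_alloc messages_with_type qualities_with_type. Qed.

Lemma induced_transfer_with_type i t th :
  induced_transfer sg i (with_type i t th) = dev_transfer sg (sg i t).1 (sg i t).2 th.
Proof. by rewrite /induced_transfer messages_with_type qualities_with_type. Qed.

Variables (CP CI : R -> R -> R) (Pn : probability (n.-tuple R) R).
Hypothesis Pn1 : Pn (cube n) = 1%E.
Hypothesis wd : well_defined Pn sg.

Lemma interim_payoffE i t (m : msg M i) q : 0 <= q ->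
  interim_payoff CP CI Pn sg t m q =
  \int[Pn]_(th in cube n) dev_transfer sg m q th
  - CP q t * \int[Pn]_(th in cube n) dev_alloc sg m q th - CI q t.
Proof.
move=> q0; have mC : measurable (@cube R n) by exact: measurable_cube.
have it := wd_dev_transfer wd m q0; have iz := wd_dev_alloc wd m q0.
have ic : Pn.-integrable (cube n) (EFin \o cst (CI q t)).
  by apply: (@bounded_integrable _ _ _ Pn _ (cst (CI q t)) `|CI q t|).
have icz : Pn.-integrable (cube n) (EFin \o (fun th => CP q t * dev_alloc sg m q th)).
  exact: (integrableZl mC (CP q t) iz).
rewrite /interim_payoff RintegralB//; last exact: (integrableB mC it icz).
by rewrite RintegralB// RintegralZl// Rintegral_cst1.
Qed.

End interim.

Section projection01.
Context {R : realType}.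
Implicit Types t u : R.

(** Projection onto the types. Composing with it extends functions that are antitone on types to
    antitone functions on the line, the form in which scores and payoffs enter the integral
    lemmas. *)
Definition to01 t : R := Num.max 0 (Num.min t 1).

Lemma to01_itv t : 0 <= to01 t <= 1.
Proof. by rewrite /to01 le_max lexx/= ge_max ler01 ge_min lexx orbT. Qed.

Lemma to01_type t : type01 (to01 t).
Proof. by rewrite /type01/= in_itv/= to01_itv. Qed.

Lemma to01K t : 0 <= t <= 1 -> to01 t = t.
Proof. by move=> /andP[t0 t1]; rewrite /to01 (min_idPl t1) (max_idPr t0). Qed.

Lemma to01_mono t u : t <= u -> to01 t <= to01 u.
Proof. by move=> tu; rewrite /to01 le_max2// le_min2. Qed.

Lemma measurable_to01 : measurable_fun setT (@to01).
Proof. by apply: measurable_maxr => //; exact: measurable_minr. Qed.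

End projection01.

Section cost_lipschitz.
Context {R : realType}.

Lemma lipschitz_slope (g d : R -> R) :
  (forall t, type01 t -> slope_at type01 g t (d t)) ->
  (forall t, type01 t -> cont_at type01 d t) ->
  exists L : R, forall x u : R, 0 <= x -> x <= u -> u <= 1 -> g u - g x <= L * (u - x).
Proof.
move=> gs dc.
have dw : {within `[0, 1], continuous d}.
  by apply/subspace_continuousP => t tT; apply/cont_atP; exact: dc.
have [c _ dmax] := EVT_max ler01 dw.
exists (d c) => x u x0 xu u1.
have sub : `[x, u]%classic `<=` @type01 R.
  by apply: subset_itv; rewrite bnd_simp.
have ls z : x <= z <= u -> slope_at `[x, u] (fun t => d c * t - g t) z (d c * 1 - d z).
  move=> zxu; have zT : type01 z by apply: sub; rewrite /= in_itv.
  apply: slopeB; last exact: slopeS (gs _ zT).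
  apply: slopeZ => e e0; exists 1 => // y _ _.
  by rewrite mul1r subrr normr0 mulr_ge0// ltW.
rewrite -subr_ge0.
have -> : d c * (u - x) - (g u - g x) = d c * u - g u - (d c * x - g x) by ring.
rewrite subr_ge0; apply: (nondecr_slope (g := fun t => d c * t - g t)) => // z zxu.
  exact: slope_cont (ls _ zxu).
have zxu' : x <= z <= u by move: zxu => /andP[h1 h2]; rewrite !ltW.
exists (d c * 1 - d z); last exact: ls.
have zT : type01 z by apply: sub; rewrite /= in_itv.
by rewrite mulr1 subr_ge0; apply: dmax; exact: zT.
Qed.

End cost_lipschitz.

(** * Equilibrium payoffs of a feasible mechanism *)

Section payoff_equivalence.
Context {R : realType} {n : nat} (V f : R -> R) (CP CI : R -> R -> R)
  (P : probability R R) (Pn : probability (n.-tuple R) R).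
Local Notation F := (type_cdf P).
Local Notation C := (@cube R n).
Local Notation mu := (@lebesgue_measure R).
Hypothesis hf : has_density01 P f.
Hypothesis hPn : iid_profile P Pn.
Hypothesis hA : standing_assumptions V f F CP CI.
Variables (M : mechanism (R := R) n) (sg : strategy M).
Hypothesis hsg : feasible CP CI Pn sg.
Variable i : 'I_n.

Let P01 : P type01 = 1%E. Proof. exact: P_type01 hf. Qed.
Let C1 : Pn C = 1%E. Proof. exact: cube_prob1 hPn P01. Qed.
Let mC : measurable C. Proof. exact: measurable_cube. Qed.
Let mT : measurable (@type01 R). Proof. exact: measurable_itv. Qed.
Let T01 (t : R) : 0 <= t <= 1 -> type01 t.
Proof. by move=> t01; rewrite /type01/= in_itv. Qed.

Let q t := induced_quality sg i t.
Let T t := \int[Pn]_(th in C) dev_transfer sg (sg i t).1 (sg i t).2 th.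

Definition interim_alloc t := \int[Pn]_(th in C) dev_alloc sg (sg i t).1 (sg i t).2 th.
Local Notation z := interim_alloc.
Local Notation payoff := (equilibrium_payoff CP CI Pn sg i).

Let wd : well_defined Pn sg. Proof. by case: hsg. Qed.

Let q0 t : type01 t -> 0 <= q t.
Proof. by have [_ h _ _ _] := hsg; exact: h. Qed.

Let payoffE t : type01 t -> payoff t = T t - CP (q t) t * z t - CI (q t) t.
Proof. by move=> tT; rewrite /equilibrium_payoff interim_payoffE//; exact: q0. Qed.

Lemma induced_alloc01 th : C th -> 0 <= induced_alloc sg i th <= 1.
Proof.
move=> Cth; have [_ _ h _ _] := hsg; have [h0 h1] := h th Cth.
rewrite h0/= -h1 (bigD1 i)//= lerDl; apply: sumr_ge0 => j _; exact: h0.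
Qed.

Lemma EFin_interim_alloc t : type01 t ->
  (z t)%:E = (\int[Pn]_(th in C) (induced_alloc sg i (with_type i t th))%:E)%E.
Proof.
move=> tT; rewrite EFin_Rintegral//; last by apply: wd_dev_alloc => //; exact: q0.
by apply: eq_integral => th _; rewrite induced_alloc_with_type.
Qed.

Let EFin_transfer t : type01 t ->
  (T t)%:E = (\int[Pn]_(th in C) (induced_transfer sg i (with_type i t th))%:E)%E.
Proof.
move=> tT; rewrite EFin_Rintegral//; last by apply: wd_dev_transfer => //; exact: q0.
by apply: eq_integral => th _; rewrite induced_transfer_with_type.
Qed.

Lemma interim_alloc01 t : type01 t -> 0 <= z t <= 1.
Proof.
move=> tT; rewrite -!lee_fin EFin_interim_alloc//; apply/andP; split.
  apply: integral_ge0 => th Cth; rewrite lee_fin.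
  by have /andP[] := induced_alloc01 (cube_with_type i tT Cth).
apply: (@le_trans _ _ (\int[Pn]_(th in C) (cst 1%E th))%E).
  apply: ge0_le_integral => //.
  - by move=> th Cth; rewrite lee_fin; have /andP[] := induced_alloc01 (cube_with_type i tT Cth).
  - apply/measurable_EFinP.
    apply: (measurable_comp mC _ (wd_alloc wd i) (measurable_funTS (measurable_with_type2 i t))).
    by move=> _ [th Cth <-]; exact: cube_with_type.
  - by move=> th Cth; rewrite lee_fin; have /andP[] := induced_alloc01 (cube_with_type i tT Cth).
by rewrite integral_cst//= mul1e C1.
Qed.

Lemma measurable_interim_alloc : measurable_fun type01 z.
Proof.
apply/measurable_EFinP.
apply: (eq_measurable_fun
  (fun t => \int[Pn]_(th in C) (induced_alloc sg i (with_type i t th))%:E)%E).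
  by move=> t; rewrite inE => tT; rewrite -EFin_interim_alloc.
apply: (measurable_resample hPn P01 i (h := EFin \o induced_alloc sg i)).
  by apply/measurable_EFinP; exact: (wd_alloc wd).
by move=> th Cth; rewrite /= lee_fin; have /andP[] := induced_alloc01 Cth.
Qed.

Let mz := measurable_interim_alloc.

Let measurable_q : measurable_fun type01 q. Proof. exact: (wd_quality wd). Qed.

Let IC t u : type01 t -> type01 u ->
  T t - CP (q t) u * z t - CI (q t) u <= payoff u.
Proof.
move=> tT uT; have [_ _ _ bn _] := hsg.
by have := bn i u uT (sg i t).1 (sg i t).2 (q0 tT); rewrite interim_payoffE//; exact: q0.
Qed.

Let payoff_ge0 t : type01 t -> 0 <= payoff t.
Proof. by have [_ _ _ _ ir] := hsg; exact: ir. Qed.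

Let c x u := CP (q x) u * z x + CI (q x) u.

Definition rent_density x := Dt CP (q x) x * z x + Dt CI (q x) x.
Local Notation g := rent_density.

Let c_mono x u v : type01 x -> 0 <= u -> u <= v -> v <= 1 -> c x u <= c x v.
Proof.
move=> xT u0 uv v1; have /andP[z0 _] := interim_alloc01 xT.
rewrite lerD//; last exact: (CI_mono_t hA (q0 xT)).
by rewrite ler_wpM2r//; exact: (CP_mono_t hA (q0 xT)).
Qed.

Let c_slope x : type01 x -> slope_at type01 (c x) x (g x).
Proof.
move=> xT; apply: slopeD; last exact: (CI_slope_t hA (q0 xT) xT).
rewrite [_ * z x]mulrC; have -> : (fun t => CP (q x) t * z x) = (fun t => z x * CP (q x) t).
  by apply/funext => t; rewrite mulrC.
by apply: slopeZ; exact: (CP_slope_t hA (q0 xT) xT).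
Qed.

Let mc (h : R) (D : set R) : measurable D -> D `<=` type01 ->
  (forall x, D x -> type01 (x + h)) -> measurable_fun D (fun x => c x (x + h)).
Proof.
move=> mD DT DhT; have mq : measurable_fun D q by exact: measurable_funS measurable_q.
have mh : measurable_fun D (fun x : R => x + h) by exact: (measurable_funD (f := fun x => x : R)).
have qD x : D x -> 0 <= q x by move=> /DT/q0.
apply: measurable_funD; last exact: (measurable_CI hA).
apply: measurable_funM; first exact: (measurable_CP hA).
exact: measurable_funS measurable_interim_alloc.
Qed.

Lemma measurable_rent : measurable_fun type01 g.
Proof.
apply: measurable_funD; last exact: (measurable_DtCI hA).
by apply: measurable_funM => //; exact: (measurable_DtCP hA).
Qed.

Lemma rent_density_ge0 t : type01 t -> 0 <= g t.
Proof.
move=> tT; have /andP[z0 _] := interim_alloc01 tT.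
by rewrite addr_ge0 ?(CIt_ge0 hA) ?mulr_ge0 ?(CPt_ge0 hA)//; exact: q0.
Qed.

Let p t := payoff (to01 t).

Let p_ge0 t : 0 <= p t. Proof. by apply: payoff_ge0; apply: T01; exact: to01_itv. Qed.

Let IC_down u x : 0 <= u -> u <= x -> x <= 1 -> c x x - c x u <= p u - p x.
Proof.
move=> u0 ux x1; have uT : type01 u by apply: T01; rewrite u0 (le_trans ux).
have xT : type01 x by apply: T01; rewrite x1 (le_trans u0).
rewrite /p !to01K ?u0 ?x1 ?(le_trans ux) ?(le_trans u0)//.
by have := IC xT uT; rewrite (payoffE xT) /c; lra.
Qed.

Let IC_up x u : 0 <= x -> x <= u -> u <= 1 -> p x - p u <= c x u - c x x.
Proof.
move=> x0 xu u1; have xT : type01 x by apply: T01; rewrite x0 (le_trans xu).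
have uT : type01 u by apply: T01; rewrite u1 (le_trans x0).
rewrite /p !to01K ?x0 ?u1 ?(le_trans xu) ?(le_trans x0)//.
by have := IC xT uT; rewrite (payoffE xT) /c; lra.
Qed.

Let p_antitone u v : u <= v -> p v <= p u.
Proof.
move=> /to01_mono uv; have /andP[u0 _] := to01_itv u; have /andP[v0 v1] := to01_itv v.
have := IC_down u0 uv v1; have := c_mono (T01 (to01_itv v)) u0 uv v1.
by rewrite /p !(to01K (to01_itv _)); lra.
Qed.

Lemma measurable_payoff : measurable_fun type01 payoff.
Proof.
apply: (eq_measurable_fun p).
  by move=> t; rewrite inE /type01/= in_itv/= => t01; rewrite /p to01K.
by apply: measurable_funTS; exact: nonincreasing_measurable.
Qed.

Lemma payoff_transferE t : type01 t ->
  (payoff t + (CP (q t) t * z t + CI (q t) t))%:E =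
  (\int[Pn]_(th in C) (induced_transfer sg i (with_type i t th))%:E)%E.
Proof. by move=> tT; rewrite -EFin_transfer// payoffE//; congr EFin; ring. Qed.

Local Open Scope ereal_scope.

Lemma payoff_lower t : type01 t ->
  \int[mu]_(x in `]t, 1%R]) (g x)%:E <= (payoff t)%:E.
Proof.
move=> tT.
have := envelope_lower p_antitone p_ge0 c_mono c_slope mc IC_down tT.
by rewrite /p to01K//; move: tT; rewrite /type01/= in_itv.
Qed.

Lemma payoff_upper (qbar : R) t : (forall x, type01 x -> (q x <= qbar)%R) ->
  payoff 1 = 0%R -> type01 t -> (payoff t)%:E <= \int[mu]_(x in `]t, 1%R]) (g x)%:E.
Proof.
move=> qb p1 tT.
have qbar0 : (0 <= qbar)%R by exact: le_trans (q0 tT) (qb _ tT).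
(* Cost increments in the type grow with the quality, so Lipschitz constants at [qbar] serve all
   qualities below it. *)
have [L1 h1] := lipschitz_slope (fun t tT => CP_slope_t hA qbar0 tT)
  (fun t tT => CPt_cont_t hA qbar0 tT).
have [L2 h2] := lipschitz_slope (fun t tT => CI_slope_t hA qbar0 tT)
  (fun t tT => CIt_cont_t hA qbar0 tT).
have Lip x u : (0 <= x)%R -> (x <= u)%R -> (u <= 1)%R ->
    (c x u - c x x <= (L1 + L2) * (u - x))%R.
  move=> x0 xu u1; have xT : type01 x by apply: T01; rewrite x0 (le_trans xu).
  have /andP[z0 z1] := interim_alloc01 xT.
  have d1 := cost_increment_mono (fun (q t : R) a b => CP_slope_q hA a b)
    (fun (q t u : R) a b c d => CPq_mono_t hA a b c d) (q0 xT) (qb _ xT) x0 xu u1.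
  have d2 := cost_increment_mono (fun (q t : R) a b => CI_slope_q hA a b)
    (fun (q t u : R) a b c d => CIq_mono_t hA a b c d) (q0 xT) (qb _ xT) x0 xu u1.
  have e1 := h1 _ _ x0 xu u1; have e2 := h2 _ _ x0 xu u1.
  have m1 : (0 <= CP (q x) u - CP (q x) x)%R.
    by rewrite subr_ge0; apply: (CP_mono_t hA (q0 xT)).
  have m2 : ((CP (q x) u - CP (q x) x) * z x <= CP (q x) u - CP (q x) x)%R.
    by rewrite ler_piMr.
  by move: d1 d2 e1 e2 m2; rewrite /c; lra.
have := envelope_upper p_antitone p_ge0 c_mono c_slope mc measurable_rent IC_up Lip.
rewrite /p to01K ?lexx ?ler01// => /(_ p1 t tT).
by rewrite to01K//; move: tT; rewrite /type01/= in_itv.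
Qed.

End payoff_equivalence.

(** * Expected transfers and virtual costs *)

Section virtual_surplus.
Context {R : realType} {n : nat} (V f : R -> R) (CP CI : R -> R -> R)
  (P : probability R R) (Pn : probability (n.-tuple R) R).
Local Notation F := (type_cdf P).
Local Notation C := (@cube R n).
Local Notation mu := (@lebesgue_measure R).
Local Notation vCP := (virtual F f CP).
Local Notation vCI := (virtual F f CI).
Hypothesis hf : has_density01 P f.
Hypothesis hPn : iid_profile P Pn.
Hypothesis hA : standing_assumptions V f F CP CI.

Let f_cont : forall t : R, type01 t -> cont_at type01 f t := density_cont hA.
Let f0 (t : R) : type01 t -> 0 < f t. Proof. by have [] := hf; auto. Qed.
Let P01 : P type01 = 1%E. Proof. exact: P_type01 hf. Qed.
Let C1 : Pn C = 1%E. Proof. exact: cube_prob1 hPn P01. Qed.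
Let mC : measurable C. Proof. exact: measurable_cube. Qed.
Let mT : measurable (@type01 R). Proof. exact: measurable_itv. Qed.

Let F0 := cdf_0 hf.
Let F_incr := cdf_incr hf f_cont.
Let vCP0 q t : 0 <= q -> type01 t -> 0 <= vCP q t.
Proof. exact: (vCP_ge0 hA f0 F0 F_incr). Qed.
Let vCI0 q t : 0 <= q -> type01 t -> 0 <= vCI q t.
Proof. exact: (vCI_ge0 hA f0 F0 F_incr). Qed.

Lemma measurable_tnth_comp i (g : R -> R) :
  measurable_fun type01 g -> measurable_fun C (fun th => g (tnth th i)).
Proof.
move=> mg; apply: (measurable_comp mT _ mg); last exact: measurable_funTS (measurable_tnth i).
by move=> _ [th Cth <-]; exact: Cth.
Qed.

Section relaxed_terms.
Variables (q : R -> R) (z : n.-tuple R -> R) (i : 'I_n).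
Hypothesis mq : measurable_fun type01 q.
Hypothesis q0 : forall t : R, type01 t -> 0 <= q t.
Hypothesis mz : measurable_fun C z.
Hypothesis z01 : forall th, C th -> 0 <= z th <= 1.

Definition virtual_cost (th : n.-tuple R) : R :=
  vCP (q (tnth th i)) (tnth th i) * z th + vCI (q (tnth th i)) (tnth th i).

Let qC0 th : C th -> 0 <= q (tnth th i). Proof. by move=> Cth; apply: q0; exact: Cth. Qed.

Lemma virtual_cost_ge0 th : C th -> 0 <= virtual_cost th.
Proof.
move=> Cth; have /andP[z0 _] := z01 Cth.
by rewrite addr_ge0 ?mulr_ge0// ?vCP0 ?vCI0 ?qC0//; exact: Cth.
Qed.

Let mtn : measurable_fun C (fun th : n.-tuple R => tnth th i).
Proof. exact: measurable_funTS (measurable_tnth i). Qed.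

Lemma measurable_virtual_cost : measurable_fun C virtual_cost.
Proof.
have mqi := measurable_tnth_comp i mq.
apply: measurable_funD; last exact: (measurable_vCI hf hA).
by apply: measurable_funM => //; exact: (measurable_vCP hf hA).
Qed.

Lemma measurable_sale : measurable_fun C (fun th => V (q (tnth th i)) * z th).
Proof.
have mqi := measurable_tnth_comp i mq.
by apply: measurable_funM => //; exact: (measurable_value hA (b := fun th => tnth th i)).
Qed.

End relaxed_terms.
Section expected_transfer.
Variables (M : mechanism (R := R) n) (sg : strategy M).
Hypothesis hsg : feasible CP CI Pn sg.
Variable i : 'I_n.

Let q := induced_quality sg i.
Let z := induced_alloc sg i.
Let Z := interim_alloc Pn sg i.
Local Notation payoff := (equilibrium_payoff CP CI Pn sg i).
Local Notation g := (rent_density CP CI Pn sg i).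

Let wd : well_defined Pn sg. Proof. by case: hsg. Qed.
Let q0 t : type01 t -> 0 <= q t. Proof. by have [_ h _ _ _] := hsg; exact: h. Qed.
Let mq : measurable_fun type01 q. Proof. exact: (wd_quality wd). Qed.
Let mz : measurable_fun C z. Proof. exact: (wd_alloc wd). Qed.
Let z01 th : C th -> 0 <= z th <= 1. Proof. exact: (induced_alloc01 hsg). Qed.
Let Z01 t : type01 t -> 0 <= Z t <= 1. Proof. exact: (interim_alloc01 hf hPn hsg). Qed.

Let mZ : measurable_fun type01 Z.
Proof. exact: (measurable_interim_alloc hf hPn hsg). Qed.

Let cost t := CP (q t) t * Z t + CI (q t) t.

Let cost0 t : type01 t -> 0 <= cost t.
Proof.
move=> tT; have /andP[Z0 _] := Z01 tT.
rewrite addr_ge0 ?mulr_ge0 ?(CI_ge0 hA) ?q0//; apply: (CP_ge0 hA) => //.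
by rewrite /quality/= in_itv/= q0.
Qed.

Let mcost : measurable_fun type01 cost.
Proof.
apply: measurable_funD; last exact: (measurable_CI hA).
by apply: measurable_funM => //; exact: (measurable_CP hA).
Qed.

Let mg : measurable_fun type01 g. Proof. exact: (measurable_rent hf hPn hA hsg). Qed.
Let g0 t : type01 t -> 0 <= g t. Proof. exact: (rent_density_ge0 hf hPn hA hsg). Qed.

Let type01_above (t x : R) : type01 t -> t < x -> x <= 1 -> type01 x.
Proof.
rewrite /type01/= !in_itv/= => /andP[t0 _] tx ->.
by rewrite (le_trans t0)// ltW.
Qed.

Local Open Scope ereal_scope.

(** Given the own type, the mean virtual cost is the actual cost plus [g * F / f];
    [information_rent] turns the second term into the rent of the envelope formula. *)
Lemma expected_virtual_cost :
  \int[Pn]_(th in C) (virtual_cost q z i th)%:E =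
  \int[P]_(t in type01) (\int[mu]_(x in `]t, 1%R]) (g x)%:E + (cost t)%:E).
Proof.
rewrite (ge0_resample_integral hPn P01 i); last 2 first.
- by apply/measurable_EFinP; exact: measurable_virtual_cost.
- by move=> th Cth; rewrite lee_fin; exact: virtual_cost_ge0.
rewrite [RHS]ge0_integralD//; last 3 first.
- move=> t tT; apply: integral_ge0 => x; rewrite /= in_itv/= => /andP[tx x1].
  by rewrite lee_fin g0//; exact: type01_above tT tx x1.
- exact: (measurable_rent_integral mg g0).
- exact/measurable_EFinP.
rewrite (information_rent hf f_cont mg g0) -ge0_integralD//; last 3 first.
- move=> t tT; rewrite lee_fin divr_ge0 ?(ltW (f0 _))// mulr_ge0 ?g0//.
  exact: (F_ge0 F0 F_incr).
- apply/measurable_EFinP; under eq_fun do rewrite -mulrA.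
  by apply: measurable_funM => //; exact: (measurable_hazard hf f_cont).
- exact/measurable_EFinP.
apply: eq_integral => t; rewrite inE => tT.
have qt0 := q0 tT.
under eq_integral do rewrite /virtual_cost with_typeE eqxx EFinD EFinM.
rewrite ge0_integralD//; last 3 first.
- move=> th Cth; rewrite mule_ge0// lee_fin ?vCP0//.
  by have /andP[] := z01 (cube_with_type i tT Cth).
- apply: emeasurable_funM => //; apply/measurable_EFinP.
  apply: (measurable_comp mC _ mz (measurable_funTS (measurable_with_type2 i t))).
  by move=> _ [th Cth <-]; exact: cube_with_type.
- by move=> th _; rewrite lee_fin vCI0.
rewrite ge0_integralZl//; last 3 first.
- apply/measurable_EFinP.
  apply: (measurable_comp mC _ mz (measurable_funTS (measurable_with_type2 i t))).
  by move=> _ [th Cth <-]; exact: cube_with_type.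
- by move=> th Cth; rewrite lee_fin; have /andP[] := z01 (cube_with_type i tT Cth).
- by rewrite lee_fin vCP0.
rewrite integral_cst//= C1 mule1 -(EFin_interim_alloc hsg)//.
rewrite -EFinM -!EFinD; congr EFin.
rewrite /virtual /cost /rent_density -/q -/Z.
by field; rewrite gt_eqF// f0.
Qed.

Let transferE : \int[Pn]_(th in C) (induced_transfer sg i th)%:E =
  \int[P]_(t in type01) (payoff t + cost t)%:E.
Proof.
have it := wd_transfer wd i.
rewrite (resample_integral hPn P01 i (measurable_int _ it) it).
apply: eq_integral => t; rewrite inE => tT.
by rewrite (payoff_transferE hf hPn hsg).
Qed.

Lemma expected_transfer_ge :
  \int[Pn]_(th in C) (virtual_cost q z i th)%:E <=
  \int[Pn]_(th in C) (induced_transfer sg i th)%:E.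
Proof.
rewrite expected_virtual_cost transferE; apply: ge0_le_integral => //.
- move=> t tT; rewrite adde_ge0 ?lee_fin ?cost0//.
  apply: integral_ge0 => x; rewrite /= in_itv/= => /andP[tx x1].
  by rewrite lee_fin g0//; exact: type01_above tT tx x1.
- apply: emeasurable_funD; last exact/measurable_EFinP.
  exact: (measurable_rent_integral mg g0).
- apply/measurable_EFinP; apply: measurable_funD => //.
  exact: (measurable_payoff hf hPn hA hsg).
- move=> t tT; rewrite [leRHS]EFinD leeD2r//; exact: (payoff_lower hf hPn hA hsg).
Qed.

Lemma expected_transfer_eq (qbar : R) : (forall x, type01 x -> (q x <= qbar)%R) ->
  payoff 1 = 0%R ->
  \int[Pn]_(th in C) (induced_transfer sg i th)%:E =
  \int[Pn]_(th in C) (virtual_cost q z i th)%:E.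
Proof.
move=> qb p1; rewrite expected_virtual_cost transferE.
apply: eq_integral => t; rewrite inE => tT; rewrite [LHS]EFinD; congr (_ + _).
apply/eqP; rewrite eq_le (payoff_lower hf hPn hA hsg)//= andbT.
exact: (payoff_upper hf hPn hA hsg qb).
Qed.

End expected_transfer.
End virtual_surplus.

(** * The relaxed problem *)

Section relaxed_problem.
Context {R : realType} {n : nat} (V f : R -> R) (CP CI : R -> R -> R)
  (P : probability R R) (Pn : probability (n.-tuple R) R).
Local Notation F := (type_cdf P).
Local Notation C := (@cube R n).
Local Notation vCP := (virtual F f CP).
Local Notation vCI := (virtual F f CI).
Hypothesis hf : has_density01 P f.
Hypothesis hPn : iid_profile P Pn.
Hypothesis hA : standing_assumptions V f F CP CI.
Variable qs : R -> R.
Hypothesis hqs : optimal_symmetric_quality V f F CP CI n qs.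

Let f_cont : forall t : R, type01 t -> cont_at type01 f t := density_cont hA.
Let f0 (t : R) : type01 t -> 0 < f t. Proof. by have [] := hf; auto. Qed.
Let P01 : P type01 = 1%E. Proof. exact: P_type01 hf. Qed.
Let mC : measurable C. Proof. exact: measurable_cube. Qed.
Let F0 := cdf_0 hf.
Let F1 := cdf_1 hf.
Let F_incr := cdf_incr hf f_cont.
Let vCP0 q t : 0 <= q -> type01 t -> 0 <= vCP q t.
Proof. exact: (vCP_ge0 hA f0 F0 F_incr). Qed.
Let vCI0 q t : 0 <= q -> type01 t -> 0 <= vCI q t.
Proof. exact: (vCI_ge0 hA f0 F0 F_incr). Qed.
Let qs0_ge0 : 0 <= qs 0. Proof. by case: hqs => h _; case: (h 0); rewrite ?lexx ?ltr01. Qed.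
Let T0 : @type01 R 0. Proof. by rewrite /type01/= in_itv/= lexx ler01. Qed.

(** Beyond [qs 0] the value rises by no more than the virtual costs of type 0, which are the lowest.
    The bound keeps the objective of (P2) from above, where nothing else limits [V]. *)
Lemma virtual_surplus_le (q t : R) : 0 <= q -> type01 t ->
  V q - vCP q t - vCI q t <= V (qs 0).
Proof.
move=> q0 tT; have a := vCP0 q0 tT; have b := vCI0 q0 tT.
have [qq|qq] := leP q (qs 0).
  by have := V_mono hA q0 qq; move: a b; lra.
have := V_above hA F0 F1 F_incr hqs qq.
have := vCP0 qs0_ge0 T0; have := vCI0 qs0_ge0 T0.
move: (tT); rewrite /type01/= in_itv/= => /andP[t0 t1].
have := vCP_mono_t hA q0 (lexx 0) t0 t1; have := vCI_mono_t hA q0 (lexx 0) t0 t1.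
lra.
Qed.

Section rules.
Variables (q : 'I_n -> R -> R) (z : 'I_n -> n.-tuple R -> R).
Hypothesis mq : forall i, measurable_fun type01 (q i).
Hypothesis mz : forall i, measurable_fun C (z i).
Hypothesis hq : quality_rule q.
Hypothesis hz : allocation_rule z.

Lemma allocation_rule01 i th : C th -> 0 <= z i th <= 1.
Proof.
move=> Cth; have [h0 h1] := hz Cth; rewrite h0/= -h1 (bigD1 i)//= lerDl.
by apply: sumr_ge0 => j _; exact: h0.
Qed.

Let q0 i (th : n.-tuple R) : C th -> 0 <= q i (tnth th i).
Proof. by move=> Cth; apply: hq; exact: Cth. Qed.

Definition total_value th : R := \sum_(i < n) V (q i (tnth th i)) * z i th.

Definition relaxed_surplus th : R :=
  \sum_(i < n) (V (q i (tnth th i)) * z i th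
     - vCP (q i (tnth th i)) (tnth th i) * z i th - vCI (q i (tnth th i)) (tnth th i)).

Local Notation vcost i := (virtual_cost f CP CI P (q i) (z i) i).

Lemma relaxed_surplusE th : relaxed_surplus th = total_value th - \sum_(i < n) vcost i th.
Proof.
rewrite /relaxed_surplus /total_value -sumrB; apply: eq_bigr => i _.
by rewrite /virtual_cost; ring.
Qed.

Lemma relaxed_surplus_le th : C th -> relaxed_surplus th <= V (qs 0).
Proof.
move=> Cth; have [z0 z1] := hz Cth.
rewrite -[leRHS]mulr1 -z1 mulr_sumr; apply: ler_sum => i _.
have h := virtual_surplus_le (q0 i Cth) (Cth i); have b := vCI0 (q0 i Cth) (Cth i).
have /andP[zi0 zi1] := allocation_rule01 i Cth.
have e1 : (V (q i (tnth th i)) - vCP (q i (tnth th i)) (tnth th i)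
  - vCI (q i (tnth th i)) (tnth th i)) * z i th <= V (qs 0) * z i th by rewrite ler_wpM2r.
have e2 : vCI (q i (tnth th i)) (tnth th i) * z i th <= vCI (q i (tnth th i)) (tnth th i).
  by rewrite ler_piMr.
by move: e1 e2; lra.
Qed.

Lemma total_value_ge th : C th -> V 0 <= total_value th.
Proof.
move=> Cth; have [z0 z1] := hz Cth; rewrite -[leLHS]mulr1 -z1 mulr_sumr.
by apply: ler_sum => i _; rewrite ler_wpM2r// (V_mono hA)// q0.
Qed.

Lemma measurable_total_value : measurable_fun C total_value.
Proof.
by apply: measurable_sum => i; apply: (measurable_sale hA); [exact: mq|exact: hq|exact: mz].
Qed.

Lemma measurable_relaxed_surplus : measurable_fun C relaxed_surplus.
Proof.
apply: (eq_measurable_fun (fun th => total_value th - \sum_(i < n) vcost i th)).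
  by move=> th _; rewrite relaxed_surplusE.
apply: measurable_funB; first exact: measurable_total_value.
apply: measurable_sum => i; apply: (measurable_virtual_cost hf hA) => //.
exact: hq.
Qed.

Section integrable_costs.
Hypothesis int_cost : forall i, Pn.-integrable C (EFin \o vcost i).

Let int_sum_cost : Pn.-integrable C (EFin \o (fun th => \sum_(i < n) vcost i th)).
Proof.
rewrite (_ : _ \o _ = fun th => (\sum_(i < n) (vcost i th)%:E)%E).
  by apply: integrable_sum => // i _; exact: int_cost.
by apply/funext => th; rewrite sumEFin.
Qed.

(** Although [V] may be unbounded, the surplus is at most [V (qs 0)], so the total value is at most
    this plus the virtual costs. *)
Lemma integrable_total_value : Pn.-integrable C (EFin \o total_value).
Proof.
pose g th := `|V 0| + `|V (qs 0)| + \sum_(i < n) vcost i th.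
apply: (@le_integrable _ _ _ _ _ mC _ (EFin \o g)).
- by apply/measurable_EFinP; exact: measurable_total_value.
- move=> th Cth; rewrite /= lee_fin.
  have c0 : 0 <= \sum_(i < n) vcost i th.
    apply: sumr_ge0 => i _; apply: (virtual_cost_ge0 hf hA) => //; first exact: hq.
    by move=> th' Cth'; exact: allocation_rule01.
  rewrite [leRHS]ger0_norm ?addr_ge0// ler_norml; apply/andP; split.
    have := total_value_ge Cth; have := lerNnormlW (lexx `|V 0|).
    have := normr_ge0 (V (qs 0)); move: c0; rewrite /g; lra.
  have := relaxed_surplus_le Cth; rewrite relaxed_surplusE.
  have := ler_norm (V (qs 0)); have := normr_ge0 (V 0); move: c0; rewrite /g; lra.
- pose b : R := `|V 0| + `|V (qs 0)|.
  rewrite (_ : EFin \o g = (fun th => b%:E + (\sum_(i < n) vcost i th)%:E)%E); last first.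
    by apply/funext => th; rewrite /= EFinD.
  apply: integrableD => //.
  by apply: (@bounded_integrable _ _ _ Pn _ (cst b) `|b|).
Qed.

Lemma relaxed_objectiveE : relaxed_objective V f F CP CI Pn q z =
  (\int[Pn]_(th in C) (total_value th)%:E
   - \sum_(i < n) \int[Pn]_(th in C) (vcost i th)%:E)%E.
Proof.
rewrite -integral_sum// -integralB//; last 2 first.
- exact: integrable_total_value.
- by apply: integrable_sum => // i _; exact: int_cost.
apply: eq_integral => th _; rewrite sumEFin -EFinB; congr EFin.
exact: relaxed_surplusE.
Qed.

End integrable_costs.
End rules.

Section mechanism_utility.
Variables (M : mechanism (R := R) n) (sg : strategy M).
Hypothesis hsg : feasible CP CI Pn sg.

Local Notation q := (induced_quality sg).
Local Notation z := (induced_alloc sg).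
Local Notation vcost i := (virtual_cost f CP CI P (q i) (z i) i).

Let wd : well_defined Pn sg. Proof. by case: hsg. Qed.
Let hq : quality_rule q. Proof. by case: hsg. Qed.
Let hz : allocation_rule z. Proof. by case: hsg. Qed.

Local Open Scope ereal_scope.

(** Nonnegative virtual costs are dominated in expectation by transfers, whose expectation is finite
    in a feasible mechanism. *)
Let int_cost i : Pn.-integrable C (EFin \o vcost i).
Proof.
have c0 th : C th -> 0 <= (vcost i th)%:E.
  move=> Cth; rewrite lee_fin; apply: (virtual_cost_ge0 hf hA) => //; first exact: hq.
  by move=> th' Cth'; exact: allocation_rule01.
apply/integrableP; split.
  apply/measurable_EFinP; apply: (measurable_virtual_cost hf hA).
  - exact: (wd_quality wd).
  - exact: hq.
  - exact: (wd_alloc wd).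
rewrite (eq_integral (EFin \o vcost i)); last first.
  by move=> th; rewrite inE => Cth; rewrite gee0_abs// c0.
apply: (le_lt_trans (expected_transfer_ge hf hPn hA hsg i)).
have := integrable_fin_num mC (wd_transfer wd i).
by rewrite ltey => /fin_numP[].
Qed.

Let utilityE : buyer_utility V Pn sg = \int[Pn]_(th in C) (total_value q z th)%:E
   - \sum_(i < n) \int[Pn]_(th in C) (induced_transfer sg i th)%:E.
Proof.
have it i := wd_transfer wd i.
rewrite -integral_sum// -integralB//; last 2 first.
- exact: (integrable_total_value (wd_quality wd) (wd_alloc wd) hq hz int_cost).
- by apply: integrable_sum => // i _; exact: it.
by apply: eq_integral => th _; rewrite sumEFin -EFinB sumrB.
Qed.

Let objectiveE := relaxed_objectiveE (wd_quality wd) (wd_alloc wd) hq hz int_cost.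

Lemma utility_le_objective :
  buyer_utility V Pn sg <= relaxed_objective V f F CP CI Pn q z.
Proof.
rewrite utilityE objectiveE; apply: leeB => //.
by apply: lee_sum => i _; exact: (expected_transfer_ge hf hPn hA hsg).
Qed.

Lemma utility_eq_objective (qbar : R) :
  (forall i t, type01 t -> (q i t <= qbar)%R) ->
  (forall i, equilibrium_payoff CP CI Pn sg i 1 = 0%R) ->
  buyer_utility V Pn sg = relaxed_objective V f F CP CI Pn q z.
Proof.
move=> qb p1; rewrite utilityE objectiveE; congr (_ - _).
by apply: eq_bigr => i _; exact: (expected_transfer_eq hf hPn hA hsg (qb i) (p1 i)).
Qed.

End mechanism_utility.
End relaxed_problem.

(** * Comparison of scores level by level *)

Section layer_cake.
Context {R : realType} {n : nat} (P : probability R R)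
  (Pn : probability (n.-tuple R) R).
Hypothesis hn : (2 <= n)%N.
Hypothesis hPn : iid_profile P Pn.
Hypothesis P01 : P type01 = 1%E.
Implicit Types (i j : 'I_n) (th : n.-tuple R).
Local Notation C := (@cube R n).
Local Notation mu := (@lebesgue_measure R).

Lemma prod_natbool (I : finType) (b : I -> bool) :
  \prod_j (b j)%:R = ([forall j, b j])%:R :> R.
Proof.
have [/forallP h|/forallPn[j /negbTE bj]] := boolP [forall j, b j].
  by rewrite big1// => j _; rewrite h.
by rewrite (bigD1 j)//= bj mul0r.
Qed.

Lemma rectangle_integral (b : 'I_n -> R -> bool) :
  (forall j, measurable_fun setT (b j)) ->
  (\int[Pn]_th (\prod_j (b j (tnth th j))%:R)%:E
    = (\prod_j fine (P [set t | b j t]))%:E)%E.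
Proof.
move=> mb; have mbs j : measurable [set t | b j t].
  by rewrite -[X in measurable X]setTI; exact: (mb j).
have mr := measurable_rectangle mbs.
rewrite -(hPn mbs) -[X in Pn X]setIT; apply: (etrans _ (integral_indic Pn measurableT mr)).
apply: eq_integral => th _; rewrite prod_natbool indicE.
suff -> : [forall j, b j (tnth th j)] = (th \in rectangle (fun j => [set t | b j t])) by [].
apply/forallP/idP => [h|]; first by rewrite inE.
by rewrite inE.
Qed.

Lemma integral_below (c d x : R) : c <= x <= d ->
  (\int[mu]_w (((c <= w < d) && (w < x))%R%:R)%:E = (x - c)%:E)%E.
Proof.
move=> /andP[cx xd]; transitivity (mu `[c, x[).
  rewrite -[X in mu X]setIT -integral_indic//.
  apply: eq_integral => w _; rewrite indicE mem_setE in_itv/=; congr EFin; congr (nat_of_bool _)%:R.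
  case: (leP c w) => //= _; case: (ltP w x) => [wx|]; last by rewrite andbF.
  by rewrite (lt_le_trans wx).
apply: (etrans (lebesgue_measure_itv _)); rewrite /= lte_fin.
case: ltP => [_|xc]; first by rewrite -EFinB.
by rewrite (@le_anti _ _ x c) ?subrr// xc.
Qed.

Lemma integral_between (c d m x : R) : c <= m -> x <= d ->
  (\int[mu]_w (((c <= w < d) && (m <= w < x))%R%:R)%:E = (Num.max 0 (x - m))%:E)%E.
Proof.
move=> cm xd; transitivity (mu `[m, x[).
  rewrite -[X in mu X]setIT -integral_indic//.
  apply: eq_integral => w _; rewrite indicE mem_setE in_itv/=; congr EFin; congr (nat_of_bool _)%:R.
  have [mw|mw] := leP m w; rewrite ?andbF//=.
  rewrite (le_trans cm mw)/=; case: (ltP w x) => [wx|]; last by rewrite andbF.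
  by rewrite (lt_le_trans wx).
apply: (etrans (lebesgue_measure_itv _)); rewrite /= lte_fin.
case: ltP => [mx|xm].
  by rewrite -EFinB (max_idPr _)// subr_ge0 ltW.
by rewrite (max_idPl _)// subr_le0.
Qed.

Variables (c d : R) (K : R -> R).
Hypothesis K_antitone : forall u v : R, u <= v -> K v <= K u.
Hypothesis K_range : forall t : R, c <= K t <= d.

(** [g] indicates that some score [U] exceeds the level [w], and [h i] that the score [U'] of firm
    [i] does while no rival value of [K] does: the layers of the best score and of firm [i]'s
    margin. Writing them as products over firms turns expectations into powers of distribution
    functions. *)
Let g (U : R -> R) th (w : R) : R := 1 - \prod_j (U (tnth th j) <= w)%R%:R.
Let h (U : R -> R) i th (w : R) : R :=
  \prod_j (if j == i then w < U (tnth th j) else K (tnth th j) <= w)%R%:R.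
Let G (U U' : R -> R) (x : n.-tuple R * R) : R :=
  (c <= x.2 < d)%R%:R * (g U x.1 x.2 + \sum_i h U' i x.1 x.2).

Definition best_score (U : R -> R) th : R := \big[Num.max/c]_j U (tnth th j).

Let mK : measurable_fun setT K. Proof. exact: measurable_score. Qed.

Let cd : c <= d. Proof. by have /andP[h1 h2] := K_range 0; exact: le_trans h1 h2. Qed.

Let g01 U th w : 0 <= g U th w <= 1.
Proof. by rewrite /g prod_natbool; case: [forall _, _]; rewrite ?subrr ?subr0 ?lexx ?ler01. Qed.

Let h01 U i th w : 0 <= h U i th w <= 1.
Proof. by rewrite /h prod_natbool; case: [forall _, _]; rewrite ?lexx ?ler01. Qed.

Let G0 U U' x : 0 <= G U U' x.
Proof.
rewrite /G mulr_ge0// addr_ge0//; first by case/andP: (g01 U x.1 x.2).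
by apply: sumr_ge0 => i _; case/andP: (h01 U' i x.1 x.2).
Qed.

Let below (X : R -> R) (w : R) : R := fine (P [set t | (X t <= w)%R]).

Let above (X : R -> R) (w : R) : measurable_fun setT X ->
  fine (P [set t | (w < X t)%R]) = (1 - below X w)%R.
Proof.
move=> mX; have mb : measurable_fun setT (fun t => (X t <= w)%R).
  exact: measurable_fun_ler.
have mbs : measurable [set t | (X t <= w)%R].
  by rewrite -[Y in measurable Y]setTI; exact: mb.
rewrite (_ : [set t | (w < X t)%R] = ~` [set t | (X t <= w)%R]); last first.
  by apply/seteqP; split => t /=; rewrite ltNge => /negP.
by rewrite probability_setC// fineB ?fin_num_measure.
Qed.

Section test_functions.
Variables U U' : R -> R.
Hypothesis mU : measurable_fun setT U.
Hypothesis mU' : measurable_fun setT U'.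
Hypothesis U_range : forall t : R, c <= U t <= d.
Hypothesis U'_range : forall t : R, c <= U' t <= d.

Lemma measurable_layers : measurable_fun setT (G U U').
Proof.
have mt j : measurable_fun setT (fun x : n.-tuple R * R => tnth x.1 j).
  by apply: (measurableT_comp (measurable_tnth j)).
have mu' j : measurable_fun setT (fun x : n.-tuple R * R => U' (tnth x.1 j)).
  exact: measurableT_comp.
have mu0 j : measurable_fun setT (fun x : n.-tuple R * R => U (tnth x.1 j)).
  exact: measurableT_comp.
have mk j : measurable_fun setT (fun x : n.-tuple R * R => K (tnth x.1 j)).
  exact: measurableT_comp.
apply: measurable_funM.
  apply: measurable_natbool; apply: measurable_and.
    exact: measurable_fun_ler.
  exact: measurable_fun_ltr.
apply: measurable_funD.
  apply: measurable_funB => //; apply: measurable_prod => j _.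
  by apply: measurable_natbool; exact: measurable_fun_ler.
apply: measurable_sum => i; apply: measurable_prod => j _.
apply: measurable_natbool; case: (j == i).
  exact: measurable_fun_ltr.
exact: measurable_fun_ler.
Qed.

Lemma best_score_range th : c <= best_score U th <= d.
Proof.
apply/andP; split; first exact: bigmax_ge_id.
by apply/bigmax_leP; split=> // j _; case/andP: (U_range (tnth th j)).
Qed.

Let rival_le_forall i th w : C th ->
  (K (rival i th) <= w) = [forall j, (j != i) ==> (K (tnth th j) <= w)].
Proof.
move=> Cth; apply/idP/forallP => [Kw j|Kw].
  by apply/implyP => ji; apply: le_trans Kw; apply: K_antitone; exact: rival_le.
by have [j ji ->] := rival_attained hn i Cth; exact: (implyP (Kw j)).
Qed.

Local Open Scope ereal_scope.

Lemma integral_layers th : C th -> \int[mu]_w (G U U' (th, w))%:E =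
  (best_score U th - c + \sum_i Num.max 0 (U' (tnth th i) - K (rival i th)))%:E.
Proof.
move=> Cth; pose ind (b : bool) : \bar R := (b%:R)%:E.
have mb (m x : R) : measurable_fun setT (fun w : R => ((c <= w < d) && (m <= w < x))%R).
  apply: measurable_and; apply: measurable_and;
    (exact: measurable_fun_ler || exact: measurable_fun_ltr).
have mb' (x : R) : measurable_fun setT (fun w : R => ((c <= w < d) && (w < x))%R).
  apply: measurable_and; last exact: measurable_fun_ltr.
  by apply: measurable_and; (exact: measurable_fun_ler || exact: measurable_fun_ltr).
transitivity (\int[mu]_w (ind ((c <= w < d) && (w < best_score U th))%R +
    \sum_i ind ((c <= w < d) && (K (rival i th) <= w < U' (tnth th i)))%R)).
  apply: eq_integral => w _; rewrite /ind sumEFin -EFinD; congr EFin.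
  rewrite /G /=; have [cw|] := boolP (c <= w < d)%R; last first.
    by rewrite mul0r/= big1 ?addr0.
  rewrite mul1r/=; congr (_ + _)%R.
    rewrite /g prod_natbool ltNge; have -> : (best_score U th <= w)%R =
        [forall j, (U (tnth th j) <= w)%R].
      apply/bigmax_leP/forallP => [[_ Uw] j|Uw]; first exact: Uw.
      by split => [|j _]; [case/andP: cw|exact: Uw].
    by case: [forall _, _]; rewrite ?subrr ?subr0.
  apply: eq_bigr => i _; rewrite /h prod_natbool (rival_le_forall _ _ Cth); congr ((nat_of_bool _)%:R)%R.
  apply/forallP/andP => [a|[/forallP a b] j].
    split; last by have := a i; rewrite eqxx.
    by apply/forallP => j; apply/implyP => ji; have := a j; rewrite (negPf ji).
  have [->//|ji] := eqVneq j i; exact: (implyP (a j) ji).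
rewrite ge0_integralD//; last 4 first.
- by move=> w _; rewrite lee_fin.
- by apply/measurable_EFinP; exact: (measurable_natbool (mb' _)).
- by move=> w _; apply: sume_ge0 => i _; rewrite lee_fin.
- by apply: emeasurable_sum => i; apply/measurable_EFinP; exact: (measurable_natbool (mb _ _)).
rewrite (integral_below (best_score_range th)) ge0_integral_sum//; last 2 first.
- by move=> i; apply/measurable_EFinP; exact: (measurable_natbool (mb _ _)).
- by move=> i w _; rewrite lee_fin.
rewrite [RHS]EFinD -sumEFin; congr (_ + _); apply: eq_bigr => i _.
apply: integral_between; first by case/andP: (K_range (rival i th)).
by case/andP: (U'_range (tnth th i)).
Qed.

Lemma expected_layers w : (c <= w < d)%R -> \int[Pn]_th (G U U' (th, w))%:E =
  (1 - below U w ^+ n + n%:R * ((1 - below U' w) * below K w ^+ n.-1))%R%:E.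
Proof.
move=> cw; pose b i j t := (if j == i then w < U' t else K t <= w)%R.
have mb i j : measurable_fun setT (b i j).
  by rewrite /b; case: (j == i); [exact: measurable_fun_ltr|exact: measurable_fun_ler].
have mb' (j : 'I_n) : measurable_fun setT (fun t => (U t <= w)%R).
  exact: measurable_fun_ler.
have mp (e : 'I_n -> R -> bool) : (forall j, measurable_fun setT (e j)) ->
    measurable_fun setT (fun th => (\prod_j (e j (tnth th j))%:R)%R : R).
  move=> me; apply: measurable_prod => j _; apply: measurable_natbool.
  exact: (measurableT_comp (me j) (measurable_tnth j)).
transitivity (\int[Pn]_th ((g U th w)%:E + \sum_i (h U' i th w)%:E)).
  by apply: eq_integral => th _; rewrite /G/= cw mul1r sumEFin -EFinD.
have g0 th : (0 <= g U th w)%R by case/andP: (g01 U th w).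
have h0 i th : (0 <= h U' i th w)%R by case/andP: (h01 U' i th w).
have mh i : measurable_fun setT (fun th => h U' i th w) by exact: (mp (b i)).
have mg : measurable_fun setT (fun th => g U th w).
  by apply: measurable_funB => //; exact: (mp (fun _ t => (U t <= w)%R)).
rewrite ge0_integralD//; last 4 first.
- by move=> th _; rewrite lee_fin.
- exact/measurable_EFinP.
- by move=> th _; apply: sume_ge0 => i _; rewrite lee_fin.
- by apply: emeasurable_sum => i; exact/measurable_EFinP.
rewrite ge0_integral_sum//; last 2 first.
- by move=> i; exact/measurable_EFinP.
- by move=> i th _; rewrite lee_fin.
rewrite EFinD; congr (_ + _).
  rewrite /g; under eq_integral do rewrite EFinB.
  rewrite integralB//; last 2 first.
  - by apply: (@bounded_integrable _ _ _ Pn _ (cst 1%R) 1%R) => // th _; rewrite normr1.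
  - apply: (@bounded_integrable _ _ _ Pn _ (fun th => (\prod_j (U (tnth th j) <= w)%R%:R)%R) 1%R) => //.
      exact: (mp (fun _ t => (U t <= w)%R)).
    by move=> th _; rewrite prod_natbool; case: [forall _, _]; rewrite ?normr1 ?normr0.
  rewrite (rectangle_integral mb') integral_cst//= mul1e probability_setT.
  by rewrite prodr_const card_ord.
under eq_bigr => i _.
  rewrite (rectangle_integral (mb i)) (bigD1 i)//= {1}/b eqxx above//.
  rewrite (eq_bigr (fun=> below K w)); last by move=> j ji; rewrite /b (negPf ji).
  rewrite prodr_const cardC1 card_ord.
  over.
by rewrite sumEFin sumr_const card_ord [in RHS]mulr_natl.
Qed.

End test_functions.

Local Open Scope ereal_scope.

(** Convexity of the power, proved algebraically: the induction step leaves the remainder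
    [m.+1%:R * a ^+ m * (b - a) ^+ 2]. *)
Lemma power_tangent (a b : R) m : (0 <= a)%R -> (0 <= b)%R ->
  (a ^+ m.+1 + m.+1%:R * ((b - a) * a ^+ m) <= b ^+ m.+1)%R.
Proof.
move=> a0 b0; elim: m => [|m IH]; first by rewrite !expr1 expr0; lra.
have h1 : (b * (a ^+ m.+1 + m.+1%:R * ((b - a) * a ^+ m)) <= b ^+ m.+2)%R.
  by rewrite [leRHS]exprS ler_wpM2l.
apply: le_trans h1; rewrite -subr_ge0.
have -> : (b * (a ^+ m.+1 + m.+1%:R * ((b - a) * a ^+ m)) -
  (a ^+ m.+2 + m.+2%:R * ((b - a) * a ^+ m.+1)) =
  m.+1%:R * a ^+ m * (b - a) ^+ 2)%R.
  by rewrite !exprS -[m.+2]addn1 natrD; ring.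
by rewrite mulr_ge0 ?sqr_ge0// mulr_ge0// exprn_ge0.
Qed.

(* If [a] and [b] are the distribution functions of [K] and [U] at [w], the
   layers at [w] have expectations [1 - b^n + n a^(n-1) (1 - a)] and
   [1 - a^n + n a^(n-1) (1 - b)]. *)
Lemma layer_cake_bound (U : R -> R) : measurable_fun setT U ->
  (forall t : R, c <= U t <= d)%R ->
  \int[Pn]_(th in C) (best_score U th - c
     + \sum_i Num.max 0 (K (tnth th i) - K (rival i th)))%:E <=
  \int[Pn]_(th in C) (best_score K th - c
     + \sum_i Num.max 0 (U (tnth th i) - K (rival i th)))%:E.
Proof.
move=> mU U_range.
(* Each margin sum stands with the opposite best score, so both sides are integrals of nonnegative
   layers and the two integrations can be exchanged. *)
have tonelli (X X' : R -> R) : measurable_fun setT X -> measurable_fun setT X' ->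
    (forall t : R, c <= X t <= d)%R -> (forall t : R, c <= X' t <= d)%R ->
    \int[Pn]_(th in C) (best_score X th - c
     + \sum_i Num.max 0 (X' (tnth th i) - K (rival i th)))%:E =
    \int[mu]_w \int[Pn]_th (G X X' (th, w))%:E.
  move=> mX mX' Xr X'r.
  have mGE : measurable_fun setT (EFin \o G X X') by apply/measurable_EFinP; exact: measurable_layers.
  transitivity (\int[Pn]_th \int[mu]_w (G X X' (th, w))%:E).
    rewrite [RHS](integral_full_measure (D := C)).
    - by apply: eq_integral => th; rewrite inE => Cth; rewrite integral_layers.
    - exact: measurable_cube.
    - exact: cube_prob1 hPn P01.
    - apply: (@measurable_fun_fubini_tonelli_F _ _ _ _ _ mu (EFin \o G X X')) => //.
      by move=> x; rewrite /= lee_fin.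
  exact: (fubini_tonelli (m1 := Pn) (m2 := mu) (EFin \o G X X') mGE (fun x => G0 X X' x)).
rewrite !tonelli//; apply: ge0_le_integral => //.
- by move=> w _; apply: integral_ge0 => th _; rewrite lee_fin.
- apply: (@measurable_fun_fubini_tonelli_G _ _ _ _ _ Pn (EFin \o G U K)).
    by apply/measurable_EFinP; exact: measurable_layers.
  by move=> x; rewrite /= lee_fin.
- apply: (@measurable_fun_fubini_tonelli_G _ _ _ _ _ Pn (EFin \o G K U)).
    by apply/measurable_EFinP; exact: measurable_layers.
  by move=> x; rewrite /= lee_fin.
move=> w _; have [cw|cw] := boolP (c <= w < d)%R; last first.
  by rewrite /G /= (negPf cw); under eq_integral do rewrite mul0r;
    under [leRHS]eq_integral do rewrite mul0r.
rewrite !expected_layers// lee_fin.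
set a := fine (P [set t | (K t <= w)%R]); set b := fine (P [set t | (U t <= w)%R]).
have a0 : (0 <= a)%R by rewrite fine_ge0.
have b0 : (0 <= b)%R by rewrite fine_ge0.
have := power_tangent n.-1 a0 b0; rewrite prednK ?(ltn_trans _ hn)// => h1.
rewrite -subr_ge0.
have -> : (1 - a ^+ n + n%:R * ((1 - b) * a ^+ n.-1)
  - (1 - b ^+ n + n%:R * ((1 - a) * a ^+ n.-1)) =
  b ^+ n - (a ^+ n + n%:R * ((b - a) * a ^+ n.-1)))%R by ring.
by rewrite subr_ge0.
Qed.

End layer_cake.

Section unbounded_below.
Context d (T : measurableType d) {R : realType} (mu : probability T R).
Local Open Scope ereal_scope.

(* [g] need not be integrable: its integral may be [-oo]. *)
Lemma integral_le_of_slack (D : set T) (g : T -> R) (k r : R) :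
  measurable D -> mu D = 1 -> measurable_fun D g -> (0 <= k)%R ->
  (forall x, D x -> (g x <= k)%R) ->
  (k - r)%:E <= \int[mu]_(x in D) (k - g x)%:E ->
  \int[mu]_(x in D) (g x)%:E <= r%:E.
Proof.
move=> mD D1 mg k0 gk.
pose gp x := Num.max (g x) 0%R; pose gn x := Num.max (- g x)%R 0%R.
have mgp : measurable_fun D gp by exact: measurable_maxr.
have mgn : measurable_fun D gn by apply: measurable_maxr => //; exact: measurableT_comp.
have gp0 x : (0 <= gp x)%R by rewrite /gp le_max lexx orbT.
have gn0 x : (0 <= gn x)%R by rewrite /gn le_max lexx orbT.
have gpk x : D x -> (gp x <= k)%R by move=> /gk gxk; rewrite /gp ge_max gxk.
have igp : mu.-integrable D (EFin \o gp).
  by apply: (@bounded_integrable _ _ _ mu _ gp k) => // x Dx; rewrite ger0_norm// gpk.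
have ik : mu.-integrable D (EFin \o cst k).
  by apply: (@bounded_integrable _ _ _ mu _ (cst k) k) => // x Dx; rewrite ger0_norm.
rewrite [X in _ -> X <= _]integralE.
have -> : \int[mu]_(x in D) ((EFin \o g)^\+ x) = \int[mu]_(x in D) (gp x)%:E.
  by apply: eq_integral => x _; rewrite funeposE /gp EFin_max.
have -> : \int[mu]_(x in D) ((EFin \o g)^\- x) = \int[mu]_(x in D) (gn x)%:E.
  by apply: eq_integral => x _; rewrite funenegE /gn EFin_max EFinN.
have -> : \int[mu]_(x in D) (k - g x)%:E =
    \int[mu]_(x in D) ((k - gp x)%:E + (gn x)%:E).
  apply: eq_integral => x _; rewrite -EFinD; congr EFin; rewrite /gp /gn.
  by case: (leP (g x) 0%R) => gx; case: (leP (- g x)%R 0%R) => gx'; move: gx gx'; lra.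
rewrite ge0_integralD//; last 4 first.
- by move=> x Dx; rewrite lee_fin subr_ge0 gpk.
- by apply/measurable_EFinP; exact: measurable_funB.
- by move=> x Dx; rewrite lee_fin.
- exact/measurable_EFinP.
have -> : \int[mu]_(x in D) (k - gp x)%:E = k%:E - \int[mu]_(x in D) (gp x)%:E.
  under eq_integral do rewrite EFinB.
  by rewrite integralB// integral_cst//= D1 mule1.
have : \int[mu]_(x in D) (gp x)%:E \is a fin_num by exact: integrable_fin_num igp.
have : 0 <= \int[mu]_(x in D) (gn x)%:E by apply: integral_ge0 => x _; rewrite lee_fin.
case: (\int[mu]_(x in D) (gp x)%:E) => [a| |]//; case: (\int[mu]_(x in D) (gn x)%:E) => [b| |]//.
  by move=> _ _; rewrite -!EFinB -EFinD !lee_fin; lra.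
by move=> _ _ _; rewrite leNye.
Qed.

End unbounded_below.

(** * The optimum of the relaxed problem *)

Section relaxed_optimum.
Context {R : realType} {n : nat} (V f : R -> R) (CP CI : R -> R -> R)
  (P : probability R R) (Pn : probability (n.-tuple R) R).
Local Notation F := (type_cdf P).
Local Notation C := (@cube R n).
Local Notation vCP := (virtual F f CP).
Local Notation vCI := (virtual F f CI).
Local Notation y := (lowest_prob n F).
Hypothesis hn : (2 <= n)%N.
Hypothesis hf : has_density01 P f.
Hypothesis hPn : iid_profile P Pn.
Hypothesis hA : standing_assumptions V f F CP CI.
Variables qs tinv : R -> R.
Hypothesis hqs : optimal_symmetric_quality V f F CP CI n qs.
Hypothesis htinv : forall t : R, 0 <= t <= 1 -> tinv (qs t) = t.

Let f_cont : forall t : R, type01 t -> cont_at type01 f t := density_cont hA.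
Let f0 (t : R) : type01 t -> 0 < f t. Proof. by have [] := hf; auto. Qed.
Let P01 : P type01 = 1%E. Proof. exact: P_type01 hf. Qed.
Let C1 : Pn C = 1%E. Proof. exact: cube_prob1 hPn P01. Qed.
Let mC : measurable C. Proof. exact: measurable_cube. Qed.
Let mT : measurable (@type01 R). Proof. exact: measurable_itv. Qed.
Let F0 := cdf_0 hf.
Let F1 := cdf_1 hf.
Let F_incr := cdf_incr hf f_cont.
Let F_cont := cdf_cont hf f_cont.
Let vCI0 q t : 0 <= q -> type01 t -> 0 <= vCI q t.
Proof. exact: (vCI_ge0 hA f0 F0 F_incr). Qed.
Let T1 : @type01 R 1. Proof. by rewrite /type01/= in_itv/= lexx ler01. Qed.
Let T01 (t : R) : type01 t -> 0 <= t <= 1. Proof. by rewrite /type01/= in_itv. Qed.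

Let qs_anti := qs_antitone hA f0 F0 F1 F_incr hqs.
Let qs1 : qs 1 = 0. Proof. by case: hqs. Qed.

Lemma optimal_quality_ge0 (t : R) : type01 t -> 0 <= qs t.
Proof. by move=> /T01/andP[t0 t1]; rewrite -qs1 qs_anti. Qed.
Let qs_ge0 := optimal_quality_ge0.

Lemma optimal_quality_le (t : R) : type01 t -> qs t <= qs 0.
Proof. by move=> /T01/andP[t0 t1]; rewrite qs_anti. Qed.
Let qs_le := optimal_quality_le.

Lemma measurable_optimal_quality : measurable_fun type01 qs.
Proof.
apply: (eq_measurable_fun (qs \o to01)).
  by move=> t; rewrite inE => /T01 t01; rewrite /= to01K.
apply: measurable_funTS; apply: nonincreasing_measurable => // u v uv /=.
have /andP[u0 _] := to01_itv u; have /andP[_ v1] := to01_itv v.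
by apply: qs_anti => //; exact: to01_mono.
Qed.
Let mqs := measurable_optimal_quality.

Definition virtual_score (t : R) : R := type_score V qs vCP (to01 t).
Local Notation K := virtual_score.

Let tinvr := tinv_range hA f0 F0 F1 F_incr F_cont hn hqs htinv.
Let tinvk := tinvK hA f0 F0 F1 F_incr F_cont hn hqs htinv.

Let ygt0 : forall t : R, 0 <= t < 1 -> 0 < y t := lowest_prob_gt0 F1 F_incr n.
Let vCPs (q t : R) : 0 <= q -> type01 t -> slope_at quality (vCP ^~ t) q (Dq vCP q t).
Proof. exact: (vCP_slope_q hA). Qed.
Let vCPqm (q t u : R) : 0 <= q -> 0 <= t -> t <= u -> u <= 1 -> Dq vCP q t <= Dq vCP q u.
Proof. exact: (vCPq_mono_t hA). Qed.
Let vCIs (q t : R) : 0 <= q -> type01 t -> slope_at quality (vCI ^~ t) q (Dq vCI q t).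
Proof. exact: (vCI_slope_q hA). Qed.
Let vCIqm (q t u : R) : 0 <= q -> 0 <= t -> t <= u -> u <= 1 -> Dq vCI q t <= Dq vCI q u.
Proof. exact: (vCIq_mono_t hA). Qed.
Let vCIq0 (q t : R) : 0 <= q -> type01 t -> 0 <= Dq vCI q t.
Proof. exact: (vCIq_ge0 hA f0 F0 F_incr). Qed.
Let vCPm (q t u : R) : 0 <= q -> 0 <= t -> t <= u -> u <= 1 -> vCP q t <= vCP q u.
Proof. exact: (vCP_mono_t hA). Qed.
Let Vc (q : R) : 0 <= q <= qs 0 -> cont_at `[0, qs 0] V q.
Proof. exact: (V_cont hA). Qed.
Let Vs := V_slope hA f0 F0 F1 F_incr F_cont hn hqs htinv.
Let Va := V_above hA F0 F1 F_incr hqs.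

Lemma virtual_score_antitone (u v : R) : u <= v -> K v <= K u.
Proof.
move=> /to01_mono uv; have /andP[u0 u1] := to01_itv u; have /andP[v0 v1] := to01_itv v.
have := type_score_antitone qs_anti qs1 tinvr tinvk ygt0 vCPs vCPqm vCIq0 Vc Vs u0 uv v1.
have := vCPm (qs_ge0 (to01_type v)) u0 uv v1.
by rewrite /K; lra.
Qed.

Let KE (t : R) : type01 t -> K t = type_score V qs vCP t.
Proof. by move=> /T01 t01; rewrite /K to01K. Qed.

Lemma virtual_score_range (t : R) : K 1 <= K t <= K 0.
Proof.
have /andP[t0 t1] := to01_itv t.
have -> : K t = K (to01 t) by rewrite /K (to01K (to01_itv t)).
by rewrite !virtual_score_antitone.
Qed.

Lemma virtual_best_response i (t q : R) : type01 t -> 0 <= q ->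
  rival_gain Pn K i (V q - vCP q t) - vCI q t <=
  rival_gain Pn K i (K t) - vCI (qs t) t.
Proof.
move=> tT q0; rewrite (KE tT).
have hb (u k : R) : type01 u -> k <= type_score V qs vCP u -> exists2 w : R,
    0 <= w <= y u & forall l : R, rival_gain Pn K i k - rival_gain Pn K i l <= w * (k - l).
  move=> uT; rewrite -(KE uT).
  exact: (rival_gain_sub_below hn hPn hf virtual_score_antitone i uT).
have ha (u k : R) : type01 u -> type_score V qs vCP u <= k -> exists2 w : R,
    y u <= w <= 1 & forall l : R, rival_gain Pn K i k - rival_gain Pn K i l <= w * (k - l).
  move=> uT; rewrite -(KE uT).
  exact: (rival_gain_sub_above hn hPn hf virtual_score_antitone i uT).
exact: (best_response qs_anti qs1 tinvr tinvk ygt0 (lowest_prob0 F0 n) vCPs vCIs vCPm vCPqm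
  vCIqm vCIq0 Vc Vs Va hb ha).
Qed.

Let c := K 1.
(** A margin against a score [m >= c] less the investment cost is either nonpositive or at most
    [V (qs 0) - c]. *)
Let bnd : R := `|V (qs 0)| + `|c|.

Let gain_le (q t m : R) : 0 <= q -> type01 t -> c <= m ->
  Num.max 0 (V q - vCP q t - m) - vCI q t <= bnd.
Proof.
move=> q0 tT cm; have b := vCI0 q0 tT; have := virtual_surplus_le hf hA hqs q0 tT.
have := ler_norm (V (qs 0)); have := lerNnormlW (lexx `|c|).
have := normr_ge0 (V (qs 0)); have := normr_ge0 c; move: b cm; rewrite /bnd.
by case: (leP 0 (V q - vCP q t - m)); lra.
Qed.

Let gain (q : R -> R) i (th : n.-tuple R) : R :=
  Num.max 0 (V (q (tnth th i)) - vCP (q (tnth th i)) (tnth th i) - K (rival i th)).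

(* The contribution of firm [i] may fail to be integrable, but it is bounded
   above: [slack] measures it downwards from a bound. *)
Let slack (q : R -> R) i (th : n.-tuple R) : R :=
  bnd - (gain q i th - vCI (q (tnth th i)) (tnth th i)).

Section slack.
Variable q : R -> R.
Hypothesis mq : measurable_fun type01 q.
Hypothesis q0 : forall t, type01 t -> 0 <= q t.

Let W t := V (q t) - vCP (q t) t.

Lemma measurable_own_score : measurable_fun type01 W.
Proof.
apply: measurable_funB; last exact: (measurable_vCP hf hA).
exact: (measurable_value hA (b := fun t => t)).
Qed.

Let mKr D i : measurable_fun D (fun th : n.-tuple R => K (rival i th)).
Proof. exact: (measurable_rival_score virtual_score_antitone). Qed.

Lemma measurable_gain i : measurable_fun C (gain q i).
Proof.
apply: measurable_maxr => //; apply: measurable_funB => //.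
exact: (measurable_tnth_comp i measurable_own_score).
Qed.

Lemma measurable_investment i : measurable_fun C (fun th => vCI (q (tnth th i)) (tnth th i)).
Proof.
apply: (measurable_tnth_comp i (g := fun t => vCI (q t) t)).
exact: (measurable_vCI hf hA).
Qed.

Lemma measurable_slack i : measurable_fun C (slack q i).
Proof.
apply: measurable_funB => //; apply: measurable_funB; first exact: measurable_gain.
exact: measurable_investment.
Qed.

Lemma slack_ge0 i th : C th -> 0 <= slack q i th.
Proof.
move=> Cth; rewrite subr_ge0; have tT : type01 (tnth th i) by exact: Cth.
  apply: gain_le => //; first exact: q0.
by case/andP: (virtual_score_range (rival i th)).
Qed.

Lemma interim_slack i t : type01 t ->
  (\int[Pn]_(th in C) (slack q i (with_type i t th))%:E =
   (bnd - (rival_gain Pn K i (W t) - vCI (q t) t))%:E)%E.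
Proof.
move=> tT; pose g (th : n.-tuple R) := Num.max 0 (W t - K (rival i th)).
have ig : Pn.-integrable C (EFin \o g).
  apply: (@bounded_integrable _ _ _ Pn _ g (`|W t| + (`|c| + `|K 0|))) => //.
    by apply: measurable_maxr => //; exact: measurable_funB.
  move=> th _; have /andP[k1 k2] := virtual_score_range (rival i th).
  have h1 := ler_norm (W t); have h2 := lerNnormlW (lexx `|c|).
  have h3 := normr_ge0 (W t); have h4 := normr_ge0 (K 0); have h5 := normr_ge0 c.
  rewrite ger0_norm ?le_max ?lexx//= ge_max; apply/andP; split; first by move: h3 h4 h5; lra.
  by move: k1 h1 h2 h4; rewrite /c; lra.
pose k := bnd + vCI (q t) t.
have ik : Pn.-integrable C (EFin \o cst k) by apply: (@bounded_integrable _ _ _ Pn _ (cst k) `|k|).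
transitivity (\int[Pn]_(th in C) (k%:E - (g th)%:E))%E.
  apply: eq_integral => th _; rewrite -EFinB /slack /gain with_typeE eqxx rival_with_type.
  by congr EFin; rewrite /k /g /W; lra.
rewrite integralB// integral_cst//= C1 mule1 -EFin_Rintegral// -EFinB; congr EFin.
by rewrite /k /rival_gain /g; lra.
Qed.

End slack.

(** Given the own type, the slack is a constant minus the payoff in the best-reply problem, which
    [qs] maximizes type by type. Nonnegativity of the slack allows conditioning without
    integrability. *)
Lemma slack_optimal (q : R -> R) i : measurable_fun type01 q ->
  (forall t, type01 t -> 0 <= q t) ->
  (\int[Pn]_(th in C) (slack qs i th)%:E <= \int[Pn]_(th in C) (slack q i th)%:E)%E.
Proof.
move=> mq q0.
have e (p : R -> R) : measurable_fun type01 p -> (forall t, type01 t -> 0 <= p t) ->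
    (\int[Pn]_(th in C) (slack p i th)%:E = \int[P]_(t in type01)
       \int[Pn]_(th in C) (slack p i (with_type i t th))%:E)%E.
  move=> mp p0; apply: (ge0_resample_integral hPn P01 i (h := EFin \o slack p i)).
    by apply/measurable_EFinP; exact: measurable_slack.
  by move=> th Cth; rewrite /= lee_fin slack_ge0.
have m (p : R -> R) : measurable_fun type01 p -> (forall t, type01 t -> 0 <= p t) ->
    measurable_fun type01 (fun t => \int[Pn]_(th in C) (slack p i (with_type i t th))%:E)%E.
  move=> mp p0; apply: (measurable_resample hPn P01 i (h := EFin \o slack p i)).
    by apply/measurable_EFinP; exact: measurable_slack.
  by move=> th Cth; rewrite /= lee_fin slack_ge0.
rewrite (e _ mqs qs_ge0) (e _ mq q0); apply: ge0_le_integral => //.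
- move=> t tT; apply: integral_ge0 => th Cth; rewrite lee_fin.
  by apply: slack_ge0 => //; exact: cube_with_type.
- exact: m.
- exact: m.
move=> t tT; rewrite !interim_slack// lee_fin lerD2l lerN2.
have := virtual_best_response i tT (q0 _ tT).
by rewrite (KE tT) /type_score.
Qed.

(** As a function of [w], the left side has slope [x >= 0] below [m] and [x - 1 <= 0] above it.
    Clamping to an interval that contains [m] moves [w] towards [m], hence raises it. This supplies
    the bounded scores that the layer comparison needs. *)
Lemma clamped_sale_le (w m x : R) : c <= m <= K 0 -> 0 <= x <= 1 ->
  w * x - Num.max 0 (w - m) <=
  Num.max c (Num.min (K 0) w) * x - Num.max 0 (Num.max c (Num.min (K 0) w) - m).
Proof.
move=> /andP[cm md] /andP[x0 x1].
have cd : c <= K 0 by exact: le_trans md.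
have [wd|dw] := leP (K 0) w.
  rewrite (max_idPr cd) !(max_idPr _) ?subr_ge0// ?(le_trans md)//.
  have : (w - K 0) * x <= w - K 0 by rewrite ler_piMr// subr_ge0.
  by lra.
have [wc|cw] := leP w c; last by rewrite lexx.
rewrite !(max_idPl _) ?subr_le0// ?(le_trans wc)//.
by rewrite lerB// ler_wpM2r.
Qed.

Section bound.
Variables (q : R -> R) (z zs : 'I_n -> n.-tuple R -> R).
Hypothesis mq : measurable_fun type01 q.
Hypothesis q0 : forall t, type01 t -> 0 <= q t.
Hypothesis mz : forall i, measurable_fun C (z i).
Hypothesis hz : allocation_rule z.
Hypothesis zs_best : forall th, C th ->
  \sum_i K (tnth th i) * zs i th = best_score c K th.

Let W t := V (q t) - vCP (q t) t.
Let Wb t := Num.max c (Num.min (K 0) (W (to01 t))).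
Let B U (th : n.-tuple R) := \sum_i Num.max 0 (U (tnth th i) - K (rival i th)).
Let I (th : n.-tuple R) : R := \sum_i vCI (qs (tnth th i)) (tnth th i).

Let cd : c <= K 0. Proof. by case/andP: (virtual_score_range 1). Qed.

Let Wb_range t : c <= Wb t <= K 0.
Proof. by rewrite /Wb le_max lexx/= ge_max cd ge_min lexx. Qed.

Let mWb : measurable_fun setT Wb.
Proof.
apply: measurable_maxr => //; apply: measurable_minr => //.
apply: (measurable_comp mT _ (measurable_own_score mq q0) (@measurable_to01 R)).
by move=> _ [t _ <-]; exact: to01_type.
Qed.

(** An upper bound on the surplus: at most [K 0] from the best clamped score and at most [bnd] from
    each firm. *)
Let k : R := n%:R * bnd + `|K 0|.

(** Each firm's margin over its rivals is added and subtracted. With the investment cost it forms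
    [bnd - slack]; without it, the sale minus the margin is clamped, and the clamped sales are at
    most the best score. *)
Let surplus_le th : C th -> relaxed_surplus V f CP CI P (fun=> q) z th <=
  best_score c Wb th - B Wb th + \sum_i (bnd - slack q i th).
Proof.
move=> Cth; have [z0 z1] := hz Cth.
have best : \sum_i Wb (tnth th i) * z i th <= best_score c Wb th.
  rewrite -[leRHS]mulr1 -z1 mulr_sumr; apply: ler_sum => i _.
  by rewrite ler_wpM2r//; exact: le_bigmax.
apply: le_trans (lerD (lerB best (lexx (B Wb th))) (lexx _)).
rewrite -sumrB -big_split/=; apply: ler_sum => i _.
have := clamped_sale_le (W (tnth th i)) (virtual_score_range (rival i th))
  (allocation_rule01 hz i Cth).
rewrite /Wb to01K; last by apply: T01; exact: Cth.
by rewrite /slack /gain /W; lra.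
Qed.

Let B_ge0 U th : 0 <= B U th.
Proof. by apply: sumr_ge0 => i _; rewrite le_max lexx. Qed.

Let intD (g h : n.-tuple R -> R) : Pn.-integrable C (EFin \o g) ->
  Pn.-integrable C (EFin \o h) -> Pn.-integrable C (EFin \o (fun th => g th + h th)).
Proof. exact: integrableD. Qed.

Let intB (g h : n.-tuple R -> R) : Pn.-integrable C (EFin \o g) ->
  Pn.-integrable C (EFin \o h) -> Pn.-integrable C (EFin \o (fun th => g th - h th)).
Proof. exact: integrableB. Qed.

Let int_cst (r : R) : Pn.-integrable C (EFin \o cst r).
Proof. by apply: (@bounded_integrable _ _ _ Pn _ (cst r) `|r|). Qed.

Let int_sum (g : 'I_n -> n.-tuple R -> R) : (forall i, Pn.-integrable C (EFin \o g i)) ->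
  Pn.-integrable C (EFin \o (fun th => \sum_i g i th)).
Proof.
move=> ig; rewrite (_ : _ \o _ = fun th => (\sum_i (g i th)%:E)%E).
  by apply: integrable_sum => // i _; exact: ig.
by apply/funext => th; rewrite sumEFin.
Qed.

Let int_best U : measurable_fun setT U -> (forall t, c <= U t <= K 0) ->
  Pn.-integrable C (EFin \o best_score c U).
Proof.
move=> mU Ur; apply: (@bounded_integrable _ _ _ Pn _ _ (`|c| + `|K 0|)) => //.
  apply: measurable_funTS; rewrite /best_score; elim: (index_enum _) => [|j l IH].
    by under eq_fun do rewrite big_nil; exact: measurable_cst.
  under eq_fun do rewrite big_cons; apply: measurable_maxr => //.
  exact: (measurableT_comp mU (measurable_tnth j)).
move=> th _; have /andP[h1 h2] : c <= best_score c U th <= K 0.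
  exact: (best_score_range virtual_score_range Ur th).
have := lerNnormlW (lexx `|c|); have := ler_norm (K 0).
have := normr_ge0 c; have := normr_ge0 (K 0).
by rewrite ler_norml => *; apply/andP; split; lra.
Qed.

Let mK : measurable_fun setT K.
Proof. exact: (measurable_score virtual_score_antitone). Qed.

Let int_B U : measurable_fun setT U -> (forall t, c <= U t <= K 0) ->
  Pn.-integrable C (EFin \o B U).
Proof.
move=> mU Ur; apply: int_sum => i.
apply: (@bounded_integrable _ _ _ Pn _ _ (K 0 - c)) => //.
  apply: measurable_maxr => //; apply: measurable_funB.
    by apply: measurable_funTS; apply: (measurableT_comp mU (measurable_tnth i)).
  exact: (measurable_rival_score virtual_score_antitone).
move=> th _; have /andP[h1 h2] := Ur (tnth th i).
have /andP[k1 k2] := virtual_score_range (rival i th).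
rewrite ger0_norm ?le_max ?lexx//= ge_max subr_ge0 cd/= lerB//.
Qed.

Let int_I : Pn.-integrable C (EFin \o I).
Proof.
apply: int_sum => i; apply: (@bounded_integrable _ _ _ Pn _ _ (vCI (qs 0) 1)) => //.
  exact: measurable_investment.
move=> th Cth; have tT : type01 (tnth th i) by exact: Cth.
have /andP[t0 t1] := T01 tT.
rewrite ger0_norm; last by apply: vCI0 => //; exact: qs_ge0.
apply: (le_trans (vCI_mono_t hA (qs_ge0 tT) t0 t1 (lexx 1))).
by apply: (vCI_mono_q hA f0 F0 F_incr) => //; [exact: qs_ge0|exact: qs_le].
Qed.

Let r : R := \int[Pn]_(th in C) (best_score c K th - I th).

Let objectiveE : relaxed_objective V f F CP CI Pn (fun=> qs) zs = r%:E.
Proof.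
rewrite /r EFin_Rintegral//; last by apply: intB => //; exact: int_best mK virtual_score_range.
apply: eq_integral => th; rewrite inE => Cth; congr EFin.
rewrite -(zs_best Cth) /I -sumrB; apply: eq_bigr => i _.
rewrite KE ?/type_score; last exact: Cth.
by ring.
Qed.

Let sum_slack th : C th -> \sum_i slack qs i th = n%:R * bnd - B K th + I th.
Proof.
move=> Cth; rewrite /slack sumrB sumr_const card_ord [in RHS]mulr_natl sumrB.
have -> : \sum_i gain qs i th = B K th.
  by apply: eq_bigr => i _; rewrite /gain (KE (Cth i)).
by rewrite /I; ring.
Qed.

(** Once the slacks at [qs] are written out, the two integrands differ exactly by the two sides of
    the layer-cake inequality. *)
Let score_slack : \int[Pn]_(th in C) (k - (best_score c K th - I th)) <=
  \int[Pn]_(th in C) (`|K 0| - best_score c Wb th + B Wb th + \sum_i slack qs i th).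
Proof.
have iK := int_best mK virtual_score_range; have iW := int_best mWb Wb_range.
have iBK := int_B mK virtual_score_range; have iBW := int_B mWb Wb_range.
have i1 : Pn.-integrable C (EFin \o (fun th => best_score c Wb th - c + B K th)).
  by apply: intD => //; apply: intB => //; exact: int_cst.
have i2 : Pn.-integrable C (EFin \o (fun th => best_score c K th - c + B Wb th)).
  by apply: intD => //; apply: intB => //; exact: int_cst.
have i3 : Pn.-integrable C (EFin \o (fun th => k - (best_score c K th - I th))).
  by apply: intB; [exact: int_cst|exact: intB].
have h := layer_cake_bound hn hPn P01 virtual_score_antitone virtual_score_range mWb Wb_range.
have h' : \int[Pn]_(th in C) (best_score c Wb th - c + B K th) <=
    \int[Pn]_(th in C) (best_score c K th - c + B Wb th).
  by rewrite -lee_fin !EFin_Rintegral.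
have -> : \int[Pn]_(th in C) (`|K 0| - best_score c Wb th + B Wb th + \sum_i slack qs i th) =
    \int[Pn]_(th in C) ((k - (best_score c K th - I th)) +
    ((best_score c K th - c + B Wb th) - (best_score c Wb th - c + B K th))).
  apply: eq_Rintegral => th; rewrite inE => Cth.
  rewrite sum_slack//.
  by rewrite /k; ring.
rewrite (RintegralD mC i3 (intB i2 i1)).
by rewrite lerDl (RintegralB mC i2 i1) subr_ge0.
Qed.

(** The comparison runs on [k] minus the surplus: bound it below by the slacks of [q], replace these
    by the smaller expected slacks of [qs], then apply the layer comparison. All intermediate
    integrands are nonnegative, so an infinite cost of [q] does no harm. *)
Lemma relaxed_bound : (relaxed_objective V f F CP CI Pn (fun=> q) z <=
  relaxed_objective V f F CP CI Pn (fun=> qs) zs)%E.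
Proof.
have k0 : 0 <= k by rewrite addr_ge0// mulr_ge0// addr_ge0.
have surplus_k th : C th -> relaxed_surplus V f CP CI P (fun=> q) z th <= k.
  move=> Cth; apply: le_trans (surplus_le Cth) _; rewrite /k addrC; apply: lerD.
    rewrite -[X in _ <= X%:R * _]card_ord mulr_natl -sumr_const; apply: ler_sum => i _.
    by rewrite gerBl slack_ge0.
  have /andP[_ h] : c <= best_score c Wb th <= K 0.
    exact: (best_score_range virtual_score_range Wb_range th).
  by apply: le_trans (ler_norm _); rewrite lerBlDr (le_trans h)// lerDl B_ge0.
have best_ge0 th : 0 <= `|K 0| - best_score c Wb th + B Wb th.
  rewrite addr_ge0// subr_ge0; apply: le_trans (ler_norm _).
  have /andP[_ ->//] : c <= best_score c Wb th <= K 0.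
  exact: (best_score_range virtual_score_range Wb_range th).
have iK := int_best mK virtual_score_range; have iW := int_best mWb Wb_range.
have iBW := int_B mWb Wb_range.
have ih : Pn.-integrable C (EFin \o (fun th => `|K 0| - best_score c Wb th + B Wb th)).
  by apply: intD => //; apply: intB => //; exact: int_cst.
have q_rule : quality_rule (fun _ : 'I_n => q) by move=> i t; exact: q0.
have ms : measurable_fun C (relaxed_surplus V f CP CI P (fun=> q) z).
  exact: (measurable_relaxed_surplus hf hA (fun=> mq) mz q_rule).
have mslack (p : R -> R) i : measurable_fun type01 p -> (forall t, type01 t -> 0 <= p t) ->
    measurable_fun C (EFin \o slack p i).
  by move=> mp p0; apply/measurable_EFinP; exact: measurable_slack.
rewrite objectiveE; apply: (integral_le_of_slack mC C1 ms k0 surplus_k).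
have split_slack (p : R -> R) : measurable_fun type01 p -> (forall t, type01 t -> 0 <= p t) ->
  (\int[Pn]_(th in C) ((`|K 0| - best_score c Wb th + B Wb th)
      + \sum_i slack p i th)%:E =
   \int[Pn]_(th in C) (`|K 0| - best_score c Wb th + B Wb th)%:E
      + \sum_i \int[Pn]_(th in C) (slack p i th)%:E)%E.
  move=> mp p0; rewrite -ge0_integral_sum//; last 2 first.
  - by move=> i; exact: mslack.
  - by move=> i th Cth; rewrite lee_fin slack_ge0.
  rewrite -ge0_integralD//; last 4 first.
  - by move=> th _; rewrite lee_fin.
  - exact: (measurable_int _ ih).
  - by move=> th Cth; apply: sume_ge0 => i _; rewrite lee_fin slack_ge0.
  - by apply: emeasurable_sum => i; exact: mslack.
  by apply: eq_integral => th _; rewrite EFinD sumEFin.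
have islack : Pn.-integrable C (EFin \o (fun th => \sum_i slack qs i th)).
  apply: (eq_integrable mC (EFin \o (fun th => n%:R * bnd - B K th + I th))).
    by move=> th; rewrite inE => Cth; rewrite /= sum_slack.
  by apply: intD => //; apply: intB; [exact: int_cst|exact: int_B mK virtual_score_range].
apply: (@le_trans _ _ (\int[Pn]_(th in C) ((`|K 0| - best_score c Wb th + B Wb th)
      + \sum_i slack qs i th)%:E)%E).
  rewrite -EFin_Rintegral//; last exact: (intD ih islack).
  rewrite lee_fin; apply: le_trans score_slack.
  by rewrite (RintegralB mC (int_cst k) (intB iK int_I)) Rintegral_cst1.
apply: (@le_trans _ _ (\int[Pn]_(th in C) ((`|K 0| - best_score c Wb th + B Wb th)
      + \sum_i slack q i th)%:E)%E).
  rewrite !split_slack// leeD2l//; apply: lee_sum => i _; exact: slack_optimal.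
apply: ge0_le_integral => //.
- by move=> th Cth; rewrite lee_fin addr_ge0// sumr_ge0// => i _; rewrite slack_ge0.
- apply/measurable_EFinP; apply: measurable_funD.
    by apply/measurable_EFinP; exact: (measurable_int _ ih).
  by apply: measurable_sum => i; exact: measurable_slack.
- by apply/measurable_EFinP; exact: measurable_funB.
move=> th Cth; rewrite lee_fin; have := surplus_le Cth.
rewrite sumrB sumr_const card_ord -mulr_natl /k; lra.
Qed.

End bound.

End relaxed_optimum.

(** * The first-score auction *)

Section top_share.
Context {R : realType} {n : nat}.
Implicit Types (v : 'I_n -> R) (i j : 'I_n).

(** The winners and shares of the first-score auction as functions of the vector of scores alone, so
    that tie-breaking is studied apart from bids and qualities. *)
Definition top_set v : {set 'I_n} := [set i | [forall j, v j <= v i]]%SET.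
Definition top_share v i : R := (i \in top_set v)%:R / #|top_set v|%:R.

Lemma in_top_set v i : (i \in top_set v) = [forall j, v j <= v i].
Proof. by rewrite inE. Qed.

Lemma top_set_gt0 v i : (0 < #|top_set v|)%N.
Proof.
apply/card_gt0P; exists [arg max_(j > i) v j]%O; rewrite in_top_set; apply/forallP => j.
by case: arg_maxP => // k _; exact.
Qed.

Lemma top_share01 v i : 0 <= top_share v i <= 1.
Proof.
have c0 : (0 : R) < #|top_set v|%:R by rewrite ltr0n (top_set_gt0 v i).
rewrite divr_ge0//= ler_pdivrMr// mul1r; case: (i \in _) => //.
by rewrite ler1n (top_set_gt0 v i).
Qed.

Lemma sum_top_share v (i0 : 'I_n) : \sum_i top_share v i = 1.
Proof.
rewrite -mulr_suml -natr_sum.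
have -> : (\sum_i (i \in top_set v) = #|top_set v|)%N.
  by rewrite -sum1_card [RHS]big_mkcond; apply: eq_bigr => i _; case: (i \in _).
by rewrite divff// pnatr_eq0 -lt0n (top_set_gt0 v i0).
Qed.

Lemma top_share_in v i : i \in top_set v -> forall j, v j <= v i.
Proof. by rewrite in_top_set => /forallP. Qed.

Lemma top_share_winner v i : (forall j, j != i -> v j < v i) -> top_share v i = 1.
Proof.
move=> h; have e : top_set v = [set i]%SET.
  apply/setP => j; rewrite in_top_set inE; apply/forallP/eqP => [hj|-> k].
    by apply/eqP/negPn/negP => ji; have := hj i; rewrite leNgt h.
  by have [->//|ki] := eqVneq k i; rewrite ltW// h.
by rewrite /top_share e cards1 inE eqxx divr1.
Qed.

Lemma top_share_loser v i j : v i < v j -> top_share v i = 0.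
Proof.
move=> ij; rewrite /top_share (_ : _ \in _ = false) ?mul0r// in_top_set.
by apply/negbTE/forallPn; exists j; rewrite -ltNge.
Qed.

Lemma top_share_perm v (p : 'S_n) i : top_share v (p i) = top_share (v \o p) i.
Proof.
have e j : (j \in top_set (v \o p)) = (p j \in top_set v).
  rewrite !in_top_set; apply/forallP/forallP => h k; last exact: h.
  by have := h ((p^-1)%g k); rewrite /= permKV.
rewrite /top_share e; congr (_ / _%:R).
rewrite -(card_imset (top_set (v \o p)) (@perm_inj _ p)); apply: eq_card => k.
rewrite -{1}(permKV p k) -e; apply/idP/imsetP => [h|[j jt ->]]; last by rewrite permK.
by exists ((p^-1)%g k); rewrite ?permKV.
Qed.

Lemma measurable_top_share d (T : measurableType d) (D : set T) (v : 'I_n -> T -> R) i :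
  (forall j, measurable_fun D (v j)) -> measurable_fun D (fun x => top_share (v ^~ x) i).
Proof.
move=> mv; pose w k x : R := \prod_j (v j x <= v k x)%R%:R.
have wE k x : w k x = (k \in top_set (v ^~ x))%:R.
  by rewrite in_top_set /w prod_natbool.
have mw k : measurable_fun D (w k).
  apply: measurable_prod => j _; apply: measurable_natbool.
  exact: (measurable_fun_ler (mv j) (mv k)).
(* A finite sum over all candidate sets of winners; the product is the indicator that [A] is the
   actual one. *)
rewrite (_ : (fun x => _) = fun x => \sum_(A : {set 'I_n})
   (i \in A)%:R / #|A|%:R * \prod_k (if k \in A then w k x else 1 - w k x)); last first.
  apply/funext => x; rewrite (bigD1 (top_set (v ^~ x)))//= [X in _ + X]big1 => [|A AW].
    rewrite addr0 [X in _ * X]big1 ?mulr1// => k _; rewrite wE.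
    by case: (k \in _); rewrite ?subr0.
  have [k kA] : exists k, (k \in A) != (k \in top_set (v ^~ x)).
    apply/existsP; rewrite -negb_forall; apply: contra AW => /forallP h.
    by apply/eqP/setP => k; exact/eqP.
  rewrite [X in _ * X](bigD1 k)//= wE; move: kA.
  by case: (k \in A); case: (k \in _) => //= _; rewrite ?subrr mul0r mulr0.
apply: measurable_sum => A; apply: measurable_funM => //.
apply: measurable_prod => k _; case: (k \in A) => //.
exact: measurable_funB.
Qed.

End top_share.

(** * Equilibrium of the first-score auction *)

Section auction.
Context {R : realType} {n : nat} (V f : R -> R) (CP CI : R -> R -> R)
  (P : probability R R) (Pn : probability (n.-tuple R) R).
Local Notation F := (type_cdf P).
Local Notation C := (@cube R n).
Local Notation y := (lowest_prob n F).
Hypothesis hn : (2 <= n)%N.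
Hypothesis hf : has_density01 P f.
Hypothesis hPn : iid_profile P Pn.
Hypothesis hA : standing_assumptions V f F CP CI.
Variables qs tinv s : R -> R.
Hypothesis hqs : optimal_symmetric_quality V f F CP CI n qs.
Hypothesis htinv : forall t : R, 0 <= t <= 1 -> tinv (qs t) = t.
Hypothesis hs : optimal_score F CP CI n qs tinv s.

Let f_cont : forall t : R, type01 t -> cont_at type01 f t := density_cont hA.
Let f0 (t : R) : type01 t -> 0 < f t. Proof. by have [] := hf; auto. Qed.
Let P01 : P type01 = 1%E. Proof. exact: P_type01 hf. Qed.
Let C1 : Pn C = 1%E. Proof. exact: cube_prob1 hPn P01. Qed.
Let mC : measurable C. Proof. exact: measurable_cube. Qed.
Let mT : measurable (@type01 R). Proof. exact: measurable_itv. Qed.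
Let F0 := cdf_0 hf.
Let F1 := cdf_1 hf.
Let F_incr := cdf_incr hf f_cont.
Let F_cont := cdf_cont hf f_cont.
Let T1 : @type01 R 1. Proof. by rewrite /type01/= in_itv/= lexx ler01. Qed.
Let T01 (t : R) : type01 t -> 0 <= t <= 1. Proof. by rewrite /type01/= in_itv. Qed.
Let qs_anti := qs_antitone hA f0 F0 F1 F_incr hqs.
Let qs1 : qs 1 = 0. Proof. by case: hqs. Qed.
Let qs_ge0 := optimal_quality_ge0 hf hA hqs.
Let mqs := measurable_optimal_quality hf hA hqs.
Let tinvr := tinv_range hA f0 F0 F1 F_incr F_cont hn hqs htinv.
Let tinvk := tinvK hA f0 F0 F1 F_incr F_cont hn hqs htinv.
Let ygt0 : forall t : R, 0 <= t < 1 -> 0 < y t := lowest_prob_gt0 F1 F_incr n.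
Let CPs (q t : R) : 0 <= q -> type01 t -> slope_at quality (CP ^~ t) q (Dq CP q t).
Proof. exact: (CP_slope_q hA). Qed.
Let CPqm (q t u : R) : 0 <= q -> 0 <= t -> t <= u -> u <= 1 -> Dq CP q t <= Dq CP q u.
Proof. exact: (CPq_mono_t hA). Qed.
Let CIs (q t : R) : 0 <= q -> type01 t -> slope_at quality (CI ^~ t) q (Dq CI q t).
Proof. exact: (CI_slope_q hA). Qed.
Let CIqm (q t u : R) : 0 <= q -> 0 <= t -> t <= u -> u <= 1 -> Dq CI q t <= Dq CI q u.
Proof. exact: (CIq_mono_t hA). Qed.
Let CIq0 (q t : R) : 0 <= q -> type01 t -> 0 <= Dq CI q t.
Proof. exact: (CIq_ge0 hA). Qed.
Let CPm (q t u : R) : 0 <= q -> 0 <= t -> t <= u -> u <= 1 -> CP q t <= CP q u.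
Proof. exact: (CP_mono_t hA). Qed.
Let CP0 (q t : R) : 0 <= q -> type01 t -> 0 <= CP q t.
Proof. by move=> q0; apply: (CP_ge0 hA); rewrite /quality/= in_itv/= q0. Qed.
Let sc (q : R) : 0 <= q <= qs 0 -> cont_at `[0, qs 0] s q.
Proof. exact: (score_cont hs). Qed.
Let ss := score_slope hs.
Let sa (q : R) : qs 0 < q -> s q - s (qs 0) <= (CP q 0 + CI q 0) - (CP (qs 0) 0 + CI (qs 0) 0).
Proof. by have [_ _] := hs; exact. Qed.

Definition break_even_score (t : R) : R := type_score s qs CP (to01 t).
Local Notation K := break_even_score.

Let KE (t : R) : type01 t -> K t = s (qs t) - CP (qs t) t.
Proof. by move=> /T01 t01; rewrite /K to01K. Qed.

Let K_incr (u v : R) : 0 <= u -> u <= v -> v <= 1 -> K v + (CP (qs v) v - CP (qs v) u) <= K u.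
Proof.
move=> u0 uv v1; rewrite /K !to01K ?u0 ?v1 ?(le_trans u0 uv) ?(le_trans uv v1)//.
exact: (type_score_antitone qs_anti qs1 tinvr tinvk ygt0 CPs CPqm CIq0 sc ss u0 uv v1).
Qed.

Lemma break_even_score_antitone (u v : R) : u <= v -> K v <= K u.
Proof.
move=> /to01_mono uv; have /andP[u0 _] := to01_itv u; have /andP[v0 v1] := to01_itv v.
have e t : K t = K (to01 t) by rewrite /K (to01K (to01_itv t)).
have := K_incr u0 uv v1; have := CPm (qs_ge0 (to01_type v)) u0 uv v1.
by rewrite (e u) (e v); lra.
Qed.
Local Notation K_anti := break_even_score_antitone.

Lemma break_even_score_decr (u v : R) : 0 <= u -> u < v -> v <= 1 -> K v < K u.
Proof.
move=> u0 uv v1; have := K_incr u0 (ltW uv) v1.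
have vT : type01 v by rewrite /type01/= in_itv/= v1 (le_trans u0 (ltW uv)).
have := CP_incr_t hA (qs_ge0 vT) u0 uv v1; lra.
Qed.
Local Notation K_decr := break_even_score_decr.

Let i0 : 'I_n := Ordinal (ltnW hn).
Let S := equilibrium_score P Pn K i0.

Let S_le (t : R) : type01 t -> S t <= K t.
Proof. by move=> /T01; exact: (equilibrium_score_le hn hPn hf f_cont K_anti). Qed.

Let S_decr (t u : R) : 0 <= t -> t < u -> u <= 1 -> S u < S t.
Proof. exact: (equilibrium_score_decr hn hPn hf f_cont K_anti K_decr). Qed.

Let S_anti (t u : R) : 0 <= t -> t <= u -> u <= 1 -> S u <= S t.
Proof. exact: (equilibrium_score_antitone hn hPn hf f_cont K_anti K_decr). Qed.

Let price_ge0 (t : R) : 0 <= Num.max 0 (s (qs t) - S t).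
Proof. by rewrite le_max lexx. Qed.

(* The price is nonnegative by itself on [0, 1]; [Num.max] only makes it so
   elsewhere. *)
Definition auction_strategy : strategy (first_score_auction n s) :=
  fun i t => (NngNum (price_ge0 t), qs t).
Local Notation sg := auction_strategy.

(** [S t] is at most the break-even score, so the price covers the production cost, which is
    nonnegative. *)
Let price (t : R) : type01 t -> Num.max 0 (s (qs t) - S t) = s (qs t) - S t.
Proof.
move=> tT; apply/max_idPr; have := S_le tT; rewrite KE//.
by have := CP0 (qs_ge0 tT) tT; lra.
Qed.

Let own_score (t : R) := s (qs t) - Num.max 0 (s (qs t) - S t).

Let own_scoreE (t : R) : type01 t -> own_score t = S t.
Proof. by move=> tT; rewrite /own_score price//; lra. Qed.

Let mS : measurable_fun type01 S.
Proof.
apply: (eq_measurable_fun (S \o to01)).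
  by move=> t; rewrite inE => /T01 t01; rewrite /= to01K.
apply: measurable_funTS; apply: nonincreasing_measurable => // u v uv /=.
have /andP[u0 _] := to01_itv u; have /andP[_ v1] := to01_itv v.
by apply: S_anti => //; exact: to01_mono.
Qed.

Lemma measurable_own_bid : measurable_fun type01 own_score.
Proof.
by apply: (eq_measurable_fun S) => // t; rewrite inE => tT; rewrite own_scoreE.
Qed.

Lemma first_score_allocE (m : 'I_n -> {nonneg R}) (q : 'I_n -> R) i :
  first_score_alloc s m q i = top_share (score s m q) i.
Proof. by []. Qed.

Lemma auction_allocE i th :
  induced_alloc sg i th = top_share (fun j => own_score (tnth th j)) i.
Proof. by []. Qed.

Lemma auction_alloc_scoreE i th : C th ->
  induced_alloc sg i th = top_share (fun j => S (tnth th j)) i.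
Proof.
move=> Cth; rewrite auction_allocE; congr top_share; apply/funext => j.
by rewrite own_scoreE//; exact: Cth.
Qed.

(** A strictly lower rival type would offer a strictly higher score, by strict decrease of [S]. *)
Lemma auction_lowest_wins i th : C th ->
  induced_alloc sg i th != 0 -> forall j, tnth th i <= tnth th j.
Proof.
move=> Cth; rewrite auction_alloc_scoreE// /top_share.
case: (boolP (i \in _)) => [|_]; last by rewrite mul0r eqxx.
move=> iW _ j; rewrite leNgt; apply/negP => ji; have := top_share_in iW j.
have /T01/andP[j0 j1] := Cth j; have /T01/andP[_ i1] := Cth i.
by rewrite leNgt S_decr.
Qed.

Section deviation.
Variables (i : 'I_n) (m : {nonneg R}) (q : R).

Let x := s q - m%:num.

Let dev th : R := dev_alloc sg (i := i) m q th.

Let dev_scoreE th : C th -> dev th =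
  top_share (fun j => if j == i then x else S (tnth th j)) i.
Proof.
move=> Cth; rewrite /dev /dev_alloc /= first_score_allocE.
congr top_share; apply/funext => j; rewrite /score.
have [->|ji] := eqVneq j i; first by rewrite !dfwithin.
by rewrite !dfwithout 1?eq_sym// -(own_scoreE (Cth j)).
Qed.

Lemma dev_alloc01 th : C th -> 0 <= dev th <= 1.
Proof. by move=> Cth; rewrite dev_scoreE//; exact: top_share01. Qed.

Let mdev : measurable_fun C dev.
Proof.
pose v j th := if j == i then x else own_score (tnth th j).
apply: (eq_measurable_fun (fun th => top_share (v ^~ th) i)).
  move=> th; rewrite inE => Cth; rewrite dev_scoreE//; congr top_share.
  by apply/funext => j; rewrite /v; case: (j == i); rewrite ?(own_scoreE (Cth j)).
apply: measurable_top_share => j; rewrite /v; case: (j == i); first exact: measurable_cst.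
exact: (measurable_tnth_comp j measurable_own_bid).
Qed.

Lemma integrable_dev_alloc : Pn.-integrable C (EFin \o dev_alloc sg (i := i) m q).
Proof.
apply: (@bounded_integrable _ _ _ Pn _ dev 1) => // th Cth.
by have /andP[h0 h1] := dev_alloc01 Cth; rewrite ger0_norm.
Qed.

Lemma dev_transferE th :
  dev_transfer sg (i := i) m q th = m%:num * dev_alloc sg (i := i) m q th.
Proof. by rewrite /dev_transfer /= dfwithin. Qed.

Lemma integrable_dev_transfer : Pn.-integrable C (EFin \o dev_transfer sg (i := i) m q).
Proof.
rewrite (_ : _ \o _ = fun th => (m%:num%:E * (dev th)%:E)%E); last first.
  by apply/funext => th; rewrite -EFinM -dev_transferE.
exact: (integrableZl mC _ integrable_dev_alloc).
Qed.

Lemma dev_wins th : C th -> S (rival i th) < x -> dev th = 1.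
Proof.
move=> Cth rx; rewrite dev_scoreE//; apply: top_share_winner => j ji.
rewrite eqxx (negPf ji); apply: le_lt_trans rx.
have /T01/andP[_ j1] := Cth j; have /T01/andP[r0 _] := rival01 hn i Cth.
by apply: S_anti => //; exact: rival_le.
Qed.

Lemma dev_loses th : C th -> x < S (rival i th) -> dev th = 0.
Proof.
move=> Cth; have [j ji ->] := rival_attained hn i Cth => xj.
by rewrite dev_scoreE//; apply: (top_share_loser (j := j)); rewrite eqxx (negPf ji).
Qed.

Let H := rival_gain Pn K i.

Lemma dev_payoff t : type01 t -> interim_payoff CP CI Pn sg (i := i) t m q =
  (m%:num - CP q t) * (\int[Pn]_(th in C) dev th) - CI q t.
Proof.
move=> tT.
have iz := integrable_dev_alloc; have it := integrable_dev_transfer.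
rewrite /interim_payoff.
pose k := m%:num - CP q t.
transitivity (\int[Pn]_(th in C) (k * dev th - CI q t)).
  by apply: eq_Rintegral => th _; rewrite dev_transferE /k /dev; ring.
have ic : Pn.-integrable C (EFin \o cst (CI q t)).
  by apply: (@bounded_integrable _ _ _ Pn _ (cst (CI q t)) `|CI q t|).
have ik : Pn.-integrable C (EFin \o (fun th => k * dev th)).
  exact: (integrableZl mC k iz).
by rewrite (RintegralB mC ik ic) RintegralZl// Rintegral_cst1.
Qed.

Lemma dev_payoff_le t : type01 t ->
  interim_payoff CP CI Pn sg (i := i) t m q <= H (s q - CP q t) - CI q t.
Proof.
move=> tT; rewrite dev_payoff// lerD2r.
(* With [x] the score offered, the margin on the contract is the break-even score [s q - CP q t]
   minus [x], the form in which [deviation_bound] applies for any pair of price and quality. *)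
have -> : m%:num - CP q t = s q - CP q t - x by rewrite /x; lra.
apply: (deviation_bound hn hPn hf f_cont K_anti K_decr (i0 := i0)).
- exact: integrable_dev_alloc.
- exact: dev_wins.
- exact: dev_loses.
- exact: dev_alloc01.
Qed.

End deviation.

Let H i := rival_gain Pn K i.

Lemma auction_payoff i t : type01 t ->
  equilibrium_payoff CP CI Pn sg i t = H i (K t) - CI (qs t) t.
Proof.
move=> tT; pose m : {nonneg R} := NngNum (price_ge0 t).
rewrite /equilibrium_payoff (dev_payoff i m (qs t) tT); congr (_ - _).
have xE : s (qs t) - m%:num = S t by rewrite /m/= price//; lra.
have -> : m%:num - CP (qs t) t = K t - S t by rewrite KE// -xE; lra.
apply: (equilibrium_gain hn hPn hf f_cont K_anti K_decr (i0 := i0)).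
- exact: T01.
- exact: integrable_dev_alloc.
- by move=> th Cth; rewrite -/S -xE; exact: dev_wins.
- by move=> th Cth; rewrite -/S -xE; exact: dev_loses.
- by move=> th Cth; exact: dev_alloc01.
Qed.

Lemma auction_best_response i t q : type01 t -> 0 <= q ->
  H i (s q - CP q t) - CI q t <= H i (K t) - CI (qs t) t.
Proof.
move=> tT q0; rewrite (KE tT) -/(type_score s qs CP t).
have ts u : type01 u -> type_score s qs CP u = K u by move=> uT; rewrite KE.
have hb (u k : R) : type01 u -> k <= type_score s qs CP u -> exists2 w : R,
    0 <= w <= y u & forall l : R, H i k - H i l <= w * (k - l).
  by move=> uT; rewrite (ts u uT); exact: (rival_gain_sub_below hn hPn hf K_anti i uT).
have ha (u k : R) : type01 u -> type_score s qs CP u <= k -> exists2 w : R,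
    y u <= w <= 1 & forall l : R, H i k - H i l <= w * (k - l).
  by move=> uT; rewrite (ts u uT); exact: (rival_gain_sub_above hn hPn hf K_anti i uT).
exact: (best_response qs_anti qs1 tinvr tinvk ygt0 (lowest_prob0 F0 n) CPs CIs CPm CPqm
  CIqm CIq0 sc ss sa hb ha).
Qed.

(** Type 1 invests nothing, and no rival has a lower break-even score, so its gain vanishes. This is
    the boundary value that makes the rent bound an equality. *)
Lemma auction_payoff1 i : equilibrium_payoff CP CI Pn sg i 1 = 0.
Proof.
rewrite auction_payoff// qs1 (CI_0 hA)// subr0 /H /rival_gain.
transitivity (\int[Pn]_(th in C) (cst 0 th : R)); last by rewrite Rintegral_cst1.
apply: eq_Rintegral => th; rewrite inE => Cth; apply/max_idPl.
have /T01/andP[_ r1] := rival01 hn i Cth.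
by rewrite subr_le0; exact: K_anti.
Qed.

Lemma auction_alloc01 i th : 0 <= induced_alloc sg i th <= 1.
Proof. by rewrite auction_allocE; exact: top_share01. Qed.

Lemma measurable_auction_alloc i : measurable_fun C (induced_alloc sg i).
Proof.
apply: (measurable_top_share (v := fun j th => own_score (tnth th j))) => j.
exact: (measurable_tnth_comp j measurable_own_bid).
Qed.

Lemma auction_allocation_rule : allocation_rule (induced_alloc sg).
Proof.
move=> th Cth; split; first by move=> i; case/andP: (auction_alloc01 i th).
exact: (sum_top_share _ i0).
Qed.

Lemma integrable_auction_transfer i : Pn.-integrable C (EFin \o induced_transfer sg i).
Proof.
pose b t := Num.max 0 (s (qs t) - S t).
have bE t : type01 t -> b t = s (qs t) - S t by exact: price.
have mb : measurable_fun type01 b.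
  apply: (eq_measurable_fun (fun t => K t + CP (qs t) t - S t)).
    by move=> t; rewrite inE => tT; rewrite bE// KE//; lra.
  apply: measurable_funB => //; apply: measurable_funD.
    by apply: measurable_funTS; exact: measurable_score K_anti.
  exact: (measurable_CP hA).
have b_le t : type01 t -> b t <= K 0 + CP (qs 0) 1 - S 1.
  move=> tT; have /andP[t0 t1] := T01 tT; rewrite bE//.
  have e1 := K_anti t0; have e2 := S_anti t0 t1 (lexx 1).
  have e3 := CPm (qs_ge0 tT) t0 t1 (lexx 1).
  have e4 := CP_mono_q hA (qs_ge0 tT) (optimal_quality_le hf hA hqs tT) T1.
  by move: (KE tT) e1 e2 e3 e4; lra.
apply: (@bounded_integrable _ _ _ Pn _
  (fun th => b (tnth th i) * induced_alloc sg i th) (K 0 + CP (qs 0) 1 - S 1)) => //.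
  by apply: measurable_funM; [exact: measurable_tnth_comp|exact: measurable_auction_alloc].
move=> th Cth; have /andP[z0 z1] := auction_alloc01 i th.
have b0 : 0 <= b (tnth th i) by exact: price_ge0.
rewrite ger0_norm ?mulr_ge0//; apply: le_trans (b_le _ (Cth i)).
by rewrite ler_piMr.
Qed.

Lemma auction_feasible : feasible CP CI Pn sg.
Proof.
split.
- split.
  + by move=> i; exact: mqs.
  + exact: measurable_auction_alloc.
  + exact: integrable_auction_transfer.
  + by move=> i m q q0; exact: integrable_dev_alloc.
  + by move=> i m q q0; exact: integrable_dev_transfer.
- by move=> i t; exact: qs_ge0.
- exact: auction_allocation_rule.
- move=> i t tT m q q0; rewrite auction_payoff//.
  by apply: (le_trans (dev_payoff_le i m q tT)); exact: auction_best_response.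
- move=> i t tT; rewrite auction_payoff//.
  (* Quality 0 requires no investment and its expected gain is nonnegative, so the equilibrium
     payoff is too. *)
  apply: le_trans (auction_best_response i tT (lexx 0)).
  by rewrite (CI_0 hA)// subr0; exact: rival_gain_ge0.
Qed.

Lemma auction_symmetric : symmetric_mechanism sg.
Proof.
split=> // p i th Cth; rewrite !auction_allocE top_share_perm; congr top_share.
by apply/funext => j /=; rewrite tnth_mktuple.
Qed.

End auction.

(** * Attainment of the symmetric bound by the auction *)

Theorem theorem1 (R : realType) (n : nat) (hn : (2 <= n)%N)
    (V f : R -> R) (CP CI : R -> R -> R)
    (P : probability R R) (Pn : probability (n.-tuple R) R)
    (hf : has_density01 P f) (hPn : iid_profile P Pn)
    (hA : standing_assumptions V f (type_cdf P) CP CI)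
    (qs tinv s : R -> R)
    (hqs : optimal_symmetric_quality V f (type_cdf P) CP CI n qs)
    (htinv : forall t : R, 0 <= t <= 1 -> tinv (qs t) = t)
    (hs : optimal_score (type_cdf P) CP CI n qs tinv s) :
  exists sg : strategy (first_score_auction n s),
    [/\ feasible CP CI Pn sg,
        symmetric_mechanism sg,
        buyer_utility V Pn sg
          = relaxed_symmetric_value V f (type_cdf P) CP CI Pn &
        forall (M : mechanism n) (sg' : strategy M),
          feasible CP CI Pn sg' -> symmetric_mechanism sg' ->
          (buyer_utility V Pn sg' <= buyer_utility V Pn sg)%E].
Proof.
pose sg := auction_strategy CP P Pn hn qs s.
have sg_feasible : feasible CP CI Pn sg.
  exact: (auction_feasible hn hf hPn hA hqs htinv hs).
have sg_symmetric : symmetric_mechanism sg := auction_symmetric CP P Pn hn qs s.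
have utility_sg : buyer_utility V Pn sg = relaxed_objective V f (type_cdf P) CP CI Pn
    (fun=> qs) (induced_alloc sg).
  apply: (utility_eq_objective hf hPn hA hqs sg_feasible (qbar := qs 0)).
    by move=> i t; exact: (optimal_quality_le hf hA hqs).
  exact: (auction_payoff1 hn hf hPn hA hqs htinv hs).
pose K := virtual_score V f CP P qs.
have K_antitone : forall u v : R, u <= v -> K v <= K u.
  exact: (virtual_score_antitone hn hf hA hqs htinv).
(* A firm with a positive share has the lowest type, hence the highest virtual score, because the
   virtual score is antitone like the equilibrium score. The actual allocation therefore maximizes
   virtual surplus. *)
have best th : cube n th ->
    \sum_i K (tnth th i) * induced_alloc sg i th = best_score (K 1) K th.
  move=> Cth; have [z0 z1] := auction_allocation_rule CP P Pn hn qs s Cth.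
  transitivity (best_score (K 1) K th * \sum_i induced_alloc sg i th).
    rewrite mulr_sumr; apply: eq_bigr => i _.
    have [->|zi] := eqVneq (induced_alloc sg i th) 0; first by rewrite !mulr0.
    congr (_ * _); apply/le_anti; rewrite le_bigmax/=.
    apply/bigmax_leP; split => [|j _]; first by apply: K_antitone; exact: cube_le1.
    by apply: K_antitone; exact: (auction_lowest_wins hf hPn hA hqs htinv hs Cth zi).
  by rewrite z1 mulr1.
have bound (q : 'I_n -> R -> R) (z : 'I_n -> n.-tuple R -> R) :
    (forall i, measurable_fun type01 (q i)) ->
    (forall i, measurable_fun (cube n) (z i)) ->
    quality_rule q -> allocation_rule z -> symmetric_rules q z ->
    (relaxed_objective V f (type_cdf P) CP CI Pn q z <= buyer_utility V Pn sg)%E.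
  (* Symmetry of qualities lets one firm's function stand for all, so that all firms face the common
     score distribution of the layer comparison. *)
  move=> mq mz hq hz [q_eq _]; pose i0 : 'I_n := Ordinal (ltnW hn).
  have -> : relaxed_objective V f (type_cdf P) CP CI Pn q z =
      relaxed_objective V f (type_cdf P) CP CI Pn (fun=> q i0) z.
    apply: eq_integral => th; rewrite inE => Cth; congr EFin.
    by apply: eq_bigr => i _; rewrite (q_eq i i0 _ (Cth i)).
  rewrite utility_sg.
  exact: (relaxed_bound hn hf hPn hA hqs htinv (mq i0) (hq i0) mz hz best).
exists sg; split => //.
- apply/le_anti/andP; split.
    apply: ereal_sup_ubound; exists (induced_quality sg), (induced_alloc sg).
    by have [wd hq hz _ _] := sg_feasible; split => //; case: wd.
  by apply: ub_ereal_sup => _ [q [z [mq mz [hq hz] sym ->]]]; exact: bound.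
- move=> M sg' feas sym; have [wd hq hz _ _] := feas.
  apply: (le_trans (utility_le_objective hf hPn hA hqs feas)).
  by apply: bound => //; case: wd.
Qed.
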